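(* For any $w, w'\in\widehat{\mathfrak{H}^{0}}$ it holds that $Z_\omega(w\mathbin{\sqcup\!\!\sqcup}_\hbar w'-w*_\hbar w')=0$.
   Context: Let $\hbar$ be a formal variable, $\mathcal{C}=\mathbb{Q}[\hbar]$ and $\mathfrak{H}=\mathcal{C}\langle a,b\rangle$ the non-commutative polynomial ring in $a,b$. For $k\ge 1$ put $g_k=ba^k$ and $e_k=b(a+\hbar)a^{k-1}$; thus $e_1-g_1=\hbar b$. Let $\mathcal{A}=\{\hbar b\}\cup\{ba^k\mid k\ge 1\}$. Let $\mathcal{M}$ be the set of $1$ and all words in the letters of $\mathcal A$, and $\mathcal{M}_0\subset\mathcal M$ those whose rightmost letter is not $e_1-g_1$ (including $1$). Let $\widehat{\mathfrak{H}^{1}}$, $\widehat{\mathfrak{H}^{0}}$ be the $\mathcal{C}$-spans of $\mathcal{M}$, $\mathcal{M}_0$. Shuffle product: the $\mathcal{C}$-bilinear operation $\mathbin{\sqcup\!\!\sqcup}_\hbar$ on $\mathfrak{H}$ determined by $w\mathbin{\sqcup\!\!\sqcup}_\hbar 1=1\mathbin{\sqcup\!\!\sqcup}_\hbar w=w$, $wa\mathbin{\sqcup\!\!\sqcup}_\hbar w'a=(wa\mathbin{\sqcup\!\!\sqcup}_\hbar w'+w\mathbin{\sqcup\!\!\sqcup}_\hbar w'a+\hbar\, w\mathbin{\sqcup\!\!\sqcup}_\hbar w')a$, $wb\mathbin{\sqcup\!\!\sqcup}_\hbar w'=w\mathbin{\sqcup\!\!\sqcup}_\hbar w'b=(w\mathbin{\sqcup\!\!\sqcup}_\hbar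 w')b$. Harmonic product: with $\mathfrak z$ the $\mathcal C$-span of $\mathcal A$ and $\circ_\hbar$ the symmetric $\mathcal C$-bilinear map on $\mathfrak z$ with $(e_1-g_1)\circ_\hbar(e_1-g_1)=\hbar(e_1-g_1)$, $(e_1-g_1)\circ_\hbar g_k=\hbar g_k$, $g_k\circ_\hbar g_l=g_{k+l}$, the operation $*_\hbar$ on $\widehat{\mathfrak{H}^{1}}$ is the $\mathcal C$-bilinear map determined by $w*_\hbar1=1*_\hbar w=w$ and $(wu)*_\hbar(w'v)=(w*_\hbar w'v)u+(wu*_\hbar w')v+(w*_\hbar w')(u\circ_\hbar v)$ ($u,v\in\mathcal A$). Both products preserve $\widehat{\mathfrak{H}^{0}}$. Fix $0<\omega<2$ and let $\hbar$ act on $\mathbb C$ (and on functions into $\mathbb C$) as multiplication by $2\pi i\omega$. Define the $\mathcal{C}$-linear map $I_\omega(\cdot\,|\,t)$ on $\mathfrak z$ by $I_\omega(e_1-g_1\,|\,t)=2\pi i\omega$ and $I_\omega(g_k\,|\,t)=\left(\frac{2\pi i\omega}{e^{-2\pi i\omega t}-1}\right)^k$. Define the $\mathcal{C}$-linear map $Z_\omega:\widehat{\mathfrak{H}^{0}}\to\mathbb{C}$ by $Z_\omega(1)=1$ and, for $u_1,\dots,u_r\in\mathcal A$ with $u_r\neq e_1-g_1$, \[ Z_\omega(u_1\cdots u_r)=\prod_{a=1}^r\int_{-\epsilon+i\mathbb R}\frac{dt_a}{e^{2\pi i t_a}-1}\prod_{a=1}^r I_\omega(u_a\,|\,t_1+\cdots+t_a),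 \] where $0<\epsilon<\min(1,1/(r\omega))$ (absolutely convergent and independent of $\epsilon$). *)

(* Defs.v *)
From HB Require Import structures.
From mathcomp Require Import all_boot all_order all_algebra.
From mathcomp Require Import finmap complex monalg.
From mathcomp Require Import all_classical.

Set Implicit Arguments.
Unset Strict Implicit.
Unset Printing Implicit Defensive.

Import Order.TTheory GRing.Theory Num.Theory.
Local Open Scope ring_scope.

(** * Algebra *)

(* The formal variable hbar is the indeterminate 'X of {poly rat}. *)
Notation Qh := {poly rat}.
Notation hbar := ('X : Qh).

(* Free algebra over Qh = Q[hbar] on a choiceType: finitely supported Qh-valued
   functions on the free monoid {fmonom T}, whose elements are sequences. *)
Notation free T := {malg Qh[{fmonom T}]}.

Definition wd (T : choiceType) (u : seq T) : free T := << FMonom u >>.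

(* Qh<a,b>, with [false] standing for a and [true] for b. *)
Notation frakH := (free bool).

Definition gen_a : frakH := wd [:: false].
Definition gen_b : frakH := wd [:: true].

Definition g_ (k : nat) : frakH := gen_b * gen_a ^+ k.
Definition e_ (k : nat) : frakH := gen_b * (gen_a + hbar%:MP) * gen_a ^+ k.-1.

(* The alphabet A is indexed by nat: 0 is the letter hbar b = e_1 - g_1, and
   k >= 1 is the letter g_k = b a^k. *)
Definition letter (k : nat) : frakH := if k is 0%N then e_ 1 - g_ 1 else g_ k.

(* The free algebra on A, and its canonical morphism to Qh<a,b>. It is injective
   (embed_inj below), and its image is the Qh-span of M. *)
Notation frakA := (free nat).

Definition word_prod (u : seq nat) : frakH := \prod_(k <- u) letter k.

Definition embed (v : frakA) : frakH :=
  \sum_(u <- msupp v) v@_u *: word_prod u.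

Definition hatH1 (x : frakH) : Prop := exists v : frakA, embed v = x.

Definition admissible (u : seq nat) : bool := (u == [::]) || (last 0%N u != 0%N).

Definition hatH0 (x : frakH) : Prop :=
  exists2 v : frakA, {in msupp v, forall u : {fmonom nat}, admissible u} &
                  embed v = x.

(* The coordinates on M of an element of hatH1, and 0 outside of hatH1. *)
Definition coordA (x : frakH) : frakA := xget 0 [set v | embed v = x]%classic.

Definition bilinear_ext (T : choiceType) (p : seq T -> seq T -> free T)
    (x y : free T) : free T :=
  \sum_(u <- msupp x) \sum_(v <- msupp y) (x@_u * y@_v) *: p u v.

(* Both products are defined by recursion from the rightmost letter; in the
   recursive functions below a word is therefore given in reversed order. *)

Fixpoint shuffle_rev (u : seq bool) : seq bool -> frakH :=
  fix aux (v : seq bool) : frakH :=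
    match u, v with
    | [::], _ => wd (rev v)
    | _, [::] => wd (rev u)
    | true :: u', _ => shuffle_rev u' v * gen_b
    | _, true :: v' => aux v' * gen_b
    | false :: u', false :: v' =>
        (aux v' + shuffle_rev u' v + hbar *: shuffle_rev u' v') * gen_a
    end.

Definition shuffle_hbar : frakH -> frakH -> frakH :=
  bilinear_ext (fun u v => shuffle_rev (rev u) (rev v)).

Definition circ (k l : nat) : frakA :=
  match k, l with
  | 0%N, 0%N => hbar *: wd [:: 0%N]
  | 0%N, _ => hbar *: wd [:: l]
  | _, 0%N => hbar *: wd [:: k]
  | _, _ => wd [:: (k + l)%N]
  end.

Fixpoint harmonic_rev (u : seq nat) : seq nat -> frakA :=
  fix aux (v : seq nat) : frakA :=
    match u, v with
    | [::], _ => wd (rev v)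
    | _, [::] => wd (rev u)
    | k :: u', l :: v' =>
        harmonic_rev u' v * wd [:: k] + aux v' * wd [:: l]
        + harmonic_rev u' v' * circ k l
    end.

Definition harmonicA : frakA -> frakA -> frakA :=
  bilinear_ext (fun u v => harmonic_rev (rev u) (rev v)).

(* Transported along [embed] (see harmonicE); only meaningful on hatH1. *)
Definition harmonic_hbar (x y : frakH) : frakH :=
  embed (harmonicA (coordA x) (coordA y)).

(** * Characteristic identities of the above operations *)

Section Combination.
Context (V : lmodType Qh).
Implicit Types (c : Qh) (x y : V).

Lemma addscale_congr c x y x' y' : x = x' -> y = y' -> c *: x + y = c *: x' + y'.
Proof. by move=> -> ->. Qed.

Lemma combD c x1 x2 y1 y2 :
  c *: x1 + y1 + (c *: x2 + y2) = c *: (x1 + x2) + (y1 + y2).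
Proof. by rewrite scalerDr addrACA. Qed.

Lemma combZ d c x y : d *: (c *: x + y) = c *: (d *: x) + d *: y.
Proof. by rewrite scalerDr !scalerA mulrC. Qed.

Context (A : lalgType Qh).

Lemma linM c (x y z : A) : (c *: x + y) * z = c *: (x * z) + y * z.
Proof. by rewrite mulrDl scalerAl. Qed.

Lemma comb3M c (x1 x2 x3 y1 y2 y3 z1 z2 z3 : A) :
  (c *: x1 + y1) * z1 + (c *: x2 + y2) * z2 + (c *: x3 + y3) * z3 =
  c *: (x1 * z1 + x2 * z2 + x3 * z3) + (y1 * z1 + y2 * z2 + y3 * z3).
Proof.
by rewrite !linM !scalerDr (addrACA (c *: _)) (addrACA (_ + _) _ (c *: _)).
Qed.
End Combination.

Section FreeAlgebra.
Context (T : choiceType).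
Implicit Types (u v : seq T) (x y z : free T).

Lemma wdM u v : wd u * wd v = wd (u ++ v).
Proof.
rewrite /wd -[LHS]/(fgmul _ _) fgmulUU mulr1.
suff -> : FMonom (u ++ v) = mmul (FMonom u) (FMonom v) by [].
exact: (esym (fmmulE (FMonom u) (FMonom v))).
Qed.

Lemma wd1 : wd [::] = 1 :> free T.
Proof. by rewrite -mpolyC1E /wd -fmoneE. Qed.

Lemma scale_wd (c : Qh) (m : {fmonom T}) : << c *g m >> = c *: wd m :> free T.
Proof.
apply/malgP => k; rewrite mcoeffZ /wd fmK !mcoeffU mulrnAr mulr1; reflexivity.
Qed.

Lemma wd_malgC u (c : Qh) : wd u * c%:MP = c *: wd u.
Proof.
rewrite /wd -[LHS]/(fgmul _ _) fgmulUU mul1r mulm1.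
exact: (scale_wd c (FMonom u)).
Qed.

Lemma free_ind (P : free T -> Prop) :
  (forall u, P (wd u)) -> (forall c x y, P x -> P y -> P (c *: x + y)) ->
  forall x, P x.
Proof.
move=> Pwd Plin x.
have P0 : P 0.
  by have := Plin (-1) _ _ (Pwd [::]) (Pwd [::]); rewrite scaleN1r addNr.
rewrite [x]monalgE; elim/big_ind: _ => // [y z Py Pz|m _].
  by have := Plin 1 _ _ Py Pz; rewrite scale1r.
by rewrite scale_wd -[X in P X]addr0; apply: Plin.
Qed.

Context (p : seq T -> seq T -> free T).

Lemma bilinear_extEw (d1 d2 : {fset {fmonom T}}) x y :
  (msupp x `<=` d1)%fset -> (msupp y `<=` d2)%fset ->
  bilinear_ext p x y = \sum_(u <- d1) \sum_(v <- d2) (x@_u * y@_v) *: p u v.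
Proof.
move=> s1 s2; rewrite /bilinear_ext.
rewrite (big_fset_incl _ s1) => [|u _ /mcoeff_outdom ->]; last first.
  by apply: big1 => v _; rewrite mul0r scale0r.
apply: eq_bigr => u _; rewrite (big_fset_incl _ s2) // => v _ /mcoeff_outdom ->.
by rewrite mulr0 scale0r.
Qed.

Lemma bilinear_ext_wd u v : bilinear_ext p (wd u) (wd v) = p u v.
Proof.
by rewrite /bilinear_ext !msuppU1 !big_seq_fset1 !mcoeffUU mulr1 scale1r.
Qed.

Lemma bilinear_extDl (c : Qh) x y z :
  bilinear_ext p (c *: x + y) z = c *: bilinear_ext p x z + bilinear_ext p y z.
Proof.
have s1 : (msupp x `<=` msupp x `|` msupp y `|` msupp (c *: x + y))%fset.
  by rewrite -fsetUA fsubsetUl.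
have s2 : (msupp y `<=` msupp x `|` msupp y `|` msupp (c *: x + y))%fset.
  by rewrite [(msupp x `|` _)%fset]fsetUC -fsetUA fsubsetUl.
have s3 : (msupp (c *: x + y) `<=` msupp x `|` msupp y `|` msupp (c *: x + y))%fset.
  by rewrite fsubsetUr.
rewrite (bilinear_extEw s1 (fsubset_refl _)) (bilinear_extEw s2 (fsubset_refl _)).
rewrite (bilinear_extEw s3 (fsubset_refl _)).
rewrite scaler_sumr -big_split /=; apply: eq_bigr => u _.
rewrite scaler_sumr -big_split /=; apply: eq_bigr => v _.
by rewrite mcoeffD mcoeffZ mulrDl scalerDl -mulrA scalerA.
Qed.
End FreeAlgebra.

Section BilinearRight.
Context (T : choiceType) (p : seq T -> seq T -> free T).
Lemma bilinear_extDr (c : Qh) (x y z : free T) :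
  bilinear_ext p z (c *: x + y) = c *: bilinear_ext p z x + bilinear_ext p z y.
Proof.
pose q u v := p v u.
have sw (s t : free T) : bilinear_ext p s t = bilinear_ext q t s.
  rewrite /bilinear_ext exchange_big; apply: eq_bigr => u _.
  by apply: eq_bigr => v _; rewrite mulrC.
by rewrite !sw bilinear_extDl.
Qed.
End BilinearRight.

Lemma shuffle_revE u v : shuffle_rev u v =
    match u, v with
    | [::], _ => wd (rev v)
    | _, [::] => wd (rev u)
    | true :: u', _ => shuffle_rev u' v * gen_b
    | _, true :: v' => shuffle_rev u v' * gen_b
    | false :: u', false :: v' =>
        (shuffle_rev u v' + shuffle_rev u' v + hbar *: shuffle_rev u' v') * gen_a
    end.
Proof. by case: u v => [|[] u] [|[] v]. Qed.

Lemma shuffle_rev0 u : shuffle_rev u [::] = wd (rev u).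
Proof. by case: u => [|[] u]. Qed.

Lemma shuffle_1w (w : frakH) : shuffle_hbar 1 w = w.
Proof.
rewrite /shuffle_hbar; elim/free_ind: w => [u|c x y IHx IHy].
  by rewrite -wd1 bilinear_ext_wd shuffle_revE revK.
rewrite bilinear_extDr IHx IHy; reflexivity.
Qed.

Lemma shuffle_w1 (w : frakH) : shuffle_hbar w 1 = w.
Proof.
rewrite /shuffle_hbar; elim/free_ind: w => [u|c x y IHx IHy].
  by rewrite -wd1 bilinear_ext_wd shuffle_rev0 revK.
rewrite bilinear_extDl IHx IHy; reflexivity.
Qed.

Lemma shuffle_b_l (w w' : frakH) :
  shuffle_hbar (w * gen_b) w' = shuffle_hbar w w' * gen_b.
Proof.
rewrite /shuffle_hbar; elim/free_ind: w => [u|c x y IHx IHy]; last first.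
  rewrite [in RHS]bilinear_extDl [in LHS]linM [in LHS]bilinear_extDl linM.
  exact: (addscale_congr c IHx IHy).
elim/free_ind: w' => [v|c x y IHx IHy]; last first.
  rewrite [in RHS]bilinear_extDr [in LHS]bilinear_extDr linM.
  exact: (addscale_congr c IHx IHy).
rewrite wdM cats1 !bilinear_ext_wd rev_rcons [LHS]shuffle_revE.
case: (rev v) => [|a l]; last reflexivity.
by rewrite shuffle_rev0 wdM rev_cons cats1.
Qed.

Lemma shuffle_b_r (w w' : frakH) :
  shuffle_hbar w (w' * gen_b) = shuffle_hbar w w' * gen_b.
Proof.
rewrite /shuffle_hbar; elim/free_ind: w => [u|c x y IHx IHy]; last first.
  rewrite [in RHS]bilinear_extDl [in LHS]bilinear_extDl linM.
  exact: (addscale_congr c IHx IHy).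
elim/free_ind: w' => [v|c x y IHx IHy]; last first.
  rewrite [in RHS]bilinear_extDr [in LHS]linM [in LHS]bilinear_extDr linM.
  exact: (addscale_congr c IHx IHy).
rewrite wdM cats1 !bilinear_ext_wd rev_rcons.
elim: (rev u) => [|[] {}u IH].
- by rewrite !shuffle_revE wdM rev_cons cats1.
- rewrite [LHS]shuffle_revE IH [in RHS]shuffle_revE {IH}.
  case: (rev v) => [|a l]; last reflexivity.
  by rewrite shuffle_rev0 wdM rev_cons cats1.
- rewrite [LHS]shuffle_revE; reflexivity.
Qed.

Lemma shuffle_aa (w w' : frakH) :
  shuffle_hbar (w * gen_a) (w' * gen_a) =
  (shuffle_hbar (w * gen_a) w' + shuffle_hbar w (w' * gen_a)
   + hbar *: shuffle_hbar w w') * gen_a.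
Proof.
rewrite /shuffle_hbar; elim/free_ind: w => [u|c x y IHx IHy]; last first.
  rewrite [(c *: x + y) * _]linM !(bilinear_extDl _ c) combZ !combD linM.
  exact: (addscale_congr c IHx IHy).
elim/free_ind: w' => [v|c x y IHx IHy]; last first.
  rewrite [(c *: x + y) * _]linM !(bilinear_extDr _ c) combZ !combD linM.
  exact: (addscale_congr c IHx IHy).
rewrite !wdM !bilinear_ext_wd !rev_cat; reflexivity.
Qed.

Lemma harmonic_revE u v : harmonic_rev u v =
    match u, v with
    | [::], _ => wd (rev v)
    | _, [::] => wd (rev u)
    | k :: u', l :: v' =>
        harmonic_rev u' v * wd [:: k] + harmonic_rev u v' * wd [:: l]
        + harmonic_rev u' v' * circ k l
    end.
Proof. by case: u v => [|k u] [|l v]. Qed.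

Lemma harmonic_rev0 u : harmonic_rev u [::] = wd (rev u).
Proof. by case: u. Qed.

Lemma harmonicA_1w (w : frakA) : harmonicA 1 w = w.
Proof.
rewrite /harmonicA; elim/free_ind: w => [u|c x y IHx IHy].
  by rewrite -wd1 bilinear_ext_wd harmonic_revE revK.
rewrite bilinear_extDr IHx IHy; reflexivity.
Qed.

Lemma harmonicA_w1 (w : frakA) : harmonicA w 1 = w.
Proof.
rewrite /harmonicA; elim/free_ind: w => [u|c x y IHx IHy].
  rewrite -wd1 bilinear_ext_wd -[rev [::]]/[::] harmonic_rev0 revK; reflexivity.
rewrite bilinear_extDl IHx IHy; reflexivity.
Qed.

Lemma harmonicA_letters (w w' : frakA) (k l : nat) :
  harmonicA (w * wd [:: k]) (w' * wd [:: l]) =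
  harmonicA w (w' * wd [:: l]) * wd [:: k]
  + harmonicA (w * wd [:: k]) w' * wd [:: l]
  + harmonicA w w' * circ k l.
Proof.
rewrite /harmonicA; elim/free_ind: w => [u|c x y IHx IHy]; last first.
  rewrite [(c *: x + y) * _]linM !(bilinear_extDl _ c) [RHS]comb3M.
  exact: (addscale_congr c IHx IHy).
elim/free_ind: w' => [v|c x y IHx IHy]; last first.
  rewrite [(c *: x + y) * _]linM !(bilinear_extDr _ c) [RHS]comb3M.
  exact: (addscale_congr c IHx IHy).
rewrite !wdM !cats1 !bilinear_ext_wd !rev_rcons; reflexivity.
Qed.

Lemma letter0 : letter 0 = hbar *: gen_b.
Proof.
rewrite /letter /e_ /g_ /= expr0 mulr1 expr1 mulrDr addrAC subrr add0r.
exact: wd_malgC.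
Qed.

Lemma embedEw (d : {fset {fmonom nat}}) (v : frakA) : (msupp v `<=` d)%fset ->
  embed v = \sum_(u <- d) v@_u *: word_prod u.
Proof.
move=> s; rewrite /embed (big_fset_incl _ s) // => u _ /mcoeff_outdom ->.
by rewrite scale0r.
Qed.

Lemma embed_wd u : embed (wd u) = word_prod u.
Proof. by rewrite /embed msuppU1 big_seq_fset1 mcoeffUU scale1r. Qed.

Lemma embed_lin (c : Qh) (x y : frakA) : embed (c *: x + y) = c *: embed x + embed y.
Proof.
have s1 : (msupp x `<=` msupp x `|` msupp y `|` msupp (c *: x + y))%fset.
  by rewrite -fsetUA fsubsetUl.
have s2 : (msupp y `<=` msupp x `|` msupp y `|` msupp (c *: x + y))%fset.
  by rewrite [(msupp x `|` _)%fset]fsetUC -fsetUA fsubsetUl.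
have s3 : (msupp (c *: x + y) `<=` msupp x `|` msupp y `|` msupp (c *: x + y))%fset.
  by rewrite fsubsetUr.
rewrite (embedEw s1) (embedEw s2) (embedEw s3) scaler_sumr -big_split /=.
by apply: eq_bigr => u _; rewrite mcoeffD mcoeffZ scalerDl scalerA.
Qed.

Definition code (u : seq nat) : seq bool :=
  flatten [seq true :: nseq k false | k <- u].

Lemma code_inj : injective code.
Proof.
have sepK k l (s t : seq nat) :
    nseq k false ++ code s = nseq l false ++ code t -> k = l /\ code s = code t.
  elim: k l => [|k IH] [|l] /=; [by []|by case: s|by case: t {IH}|].
  by case=> /IH[-> ->].
elim=> [|k s IH] [|l t] //= [] /sepK [-> /IH ->] //.
Qed.

Lemma gen_aX k : gen_a ^+ k = wd (nseq k false).
Proof. by elim: k => [|k IH]; rewrite ?wd1 // exprS IH wdM. Qed.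

Lemma word_prodE u : word_prod u = hbar ^+ count (pred1 0%N) u *: wd (code u).
Proof.
elim: u => [|k u IH]; first by rewrite /word_prod big_nil expr0 scale1r wd1.
rewrite /word_prod big_cons -/(word_prod u) {}IH.
case: k => [|k].
  rewrite letter0 -scalerAl -(wd_malgC (code u)) mulrA wdM wd_malgC scalerA.
  by rewrite -exprS.
by rewrite /letter /g_ gen_aX wdM -!wd_malgC mulrA wdM.
Qed.

Lemma embed_coef v u : (embed v)@_(FMonom (code u)) =
  v@_(FMonom u) * hbar ^+ count (pred1 0%N) u.
Proof.
elim/free_ind: v => [s|c x y IHx IHy]; last first.
  by rewrite embed_lin !mcoeffD !mcoeffZ {}IHx {}IHy mulrDl mulrA.
rewrite embed_wd word_prodE mcoeffZ !mcoeffU1.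
have -> : (FMonom (code s) == FMonom (code u)) = (FMonom s == FMonom u).
  by apply/eqP/eqP => [[/code_inj ->]|[->]].
by case: eqP => [[->]|_]; rewrite ?mulr1 ?mul1r ?mulr0 ?mul0r.
Qed.

Lemma embed_inj : injective embed.
Proof.
move=> v w E; apply/malgP => m; rewrite -(fmK m).
have := congr1 (mcoeff (FMonom (code m))) E; rewrite !embed_coef.
by apply: mulIf; rewrite expf_neq0 // polyX_eq0.
Qed.

Lemma embedK : cancel embed coordA.
Proof.
move=> v; apply: embed_inj.
exact: (@xgetPex _ 0 [set u | embed u = embed v]%classic (ex_intro _ v erefl)).
Qed.

Lemma harmonicE x y : harmonic_hbar (embed x) (embed y) = embed (harmonicA x y).
Proof. by rewrite /harmonic_hbar !embedK. Qed.

(** * Analysis *)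

From mathcomp Require Import all_reals all_analysis.

Section Zomega.
Context {R : realType}.
Local Open Scope complex_scope.
Implicit Types (eps : R) (s t : R[i]).

Definition expC t : R[i] :=
  let: x +i* y := t in (expR x * cos y) +i* (expR x * sin y).

(* Integral of f over the line - eps + iR, oriented upwards; for
   t = - eps + i y one has dt = i dy. *)
Definition line_integral eps (f : R[i] -> R[i]) : R[i] :=
  let F (y : R) := f ((- eps) +i* y) in
  'i * ((Rintegral lebesgue_measure setT (fun y : R => complex.Re (F y)))
        +i* (Rintegral lebesgue_measure setT (fun y : R => complex.Im (F y)))).

(* Integral over t_1, ..., t_r of F [:: t_1; ...; t_r], as an iterated integral
   with t_r innermost; by Fubini this is the multiple integral when F is
   absolutely integrable. *)
Fixpoint line_integrals eps (r : nat) (F : seq R[i] -> R[i]) : R[i] :=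
  if r is r'.+1
  then line_integral eps (fun t => line_integrals eps r' (fun ts => F (t :: ts)))
  else F [::].

Definition two_pi_i : R[i] := 0 +i* (2 * pi).

Context (omega : R).

Definition hval : R[i] := two_pi_i * omega%:C.

(* The action of Qh on complex numbers. *)
Definition evalC (c : Qh) : R[i] := (map_poly ratr c).[hval].

Definition I_omega (k : nat) t : R[i] :=
  if k is 0%N then hval else (hval / (expC (- hval * t) - 1)) ^+ k.

Definition Z_word eps (u : seq nat) : R[i] :=
  let r := size u in
  line_integrals eps r (fun ts : seq R[i] =>
    (\prod_(a < r) (expC (two_pi_i * ts`_a) - 1)^-1) *
    (\prod_(a < r) I_omega (nth 0%N u a) (\sum_(j < a.+1) ts`_j))).

(* Only meaningful on hatH0. [eps r] is the parameter epsilon used for the words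
   of length r. *)
Definition Z_omega (eps : nat -> R) (x : frakH) : R[i] :=
  let v := coordA x in
  \sum_(u <- msupp v) evalC v@_u * Z_word (eps (size u)) u.

End Zomega.

(* Main.v *)
(* Put t = t_1 + ... + t_r.  On words in a and b, reading b as convolution with
   the kernel 1/(e^{2 pi i t} - 1) on the line Re t = - eps and a as
   multiplication by G(t) = hbar / (e^{- hbar t} - 1) turns every word into a
   density on a vertical line.  The identity
   G(s) G(s') = G(s + s') (G(s) + G(s') + hbar) says that convolution of densities
   is the product shuffle_hbar, so that the integral EE of the density is
   multiplicative on words b...a.
   The Fourier transform of the kernel is again G up to hbar, so a Fubini exchange
   between the line variable and its dual shows that EE is invariant, up to powers
   of hbar, under the anti-automorphism exchanging a and b.  It maps the image of a
   word in the letters hbar b, g_k to the product of the b^k a in reverse order,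
   with a power of hbar (phi below), and phi sends harmonicA to
   shuffle_hbar.  Hence Z_omega = EE o phi is multiplicative for the harmonic
   product and, by duality, for shuffle_hbar. *)
Require Import Defs.
From HB Require Import structures.
From mathcomp Require Import all_boot all_order all_algebra.
From mathcomp Require Import finmap complex monalg.
From mathcomp Require Import all_classical all_reals all_analysis.
From mathcomp Require Import measurable_realfun ring lra.

Set Implicit Arguments.
Unset Strict Implicit.
Unset Printing Implicit Defensive.

Import Order.TTheory GRing.Theory Num.Theory.
Import numFieldNormedType.Exports.
Local Open Scope ring_scope.

(** * Complex-valued Lebesgue integrals on the line *)

(** The kernel tends to -1 at one end of its line, so densities cannot live in L^1. They are
    required to be bounded and integrable after multiplication by e^{-b y}, for every 0 < b < 2 pi;
    these weights are characters, so convolution passes through them. G decays at the end where the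
    kernel does not, which is why a word is integrated only when it ends in a. The Fourier transform
    of the kernel is computed by real-variable means: the integral is constant across lines because
    its derivative there is the integral of a total derivative, and splitting 2/(E^2 - 1) into
    partial fractions gives a functional equation under halving of the frequency, which a limit at 0
    resolves. Independence of epsilon is a by-product of duality: its two sides may use unrelated
    parameters, so fixing one frees the other. A single parameter can then serve all words occurring
    in a product. *)

Section ComplexIntegral.
Context {R : realType}.
Import ComplexField.Normc.
Local Open Scope complex_scope.
Local Notation mu := (@lebesgue_measure R).
Local Notation Re := complex.Re.
Local Notation Im := complex.Im.

Lemma normcE2 (z : R[i]) : normc z = Num.sqrt (Re z ^+ 2 + Im z ^+ 2).
Proof. by case: z. Qed.

Lemma normc_ge0 (z : R[i]) : 0 <= normc z.
Proof. by rewrite normcE2 sqrtr_ge0. Qed.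

Lemma Re_le_normc (z : R[i]) : `|Re z| <= normc z.
Proof. by rewrite normcE2 -sqrtr_sqr ler_wsqrtr// lerDl sqr_ge0. Qed.

Lemma Im_le_normc (z : R[i]) : `|Im z| <= normc z.
Proof. by rewrite normcE2 -sqrtr_sqr ler_wsqrtr// lerDr sqr_ge0. Qed.

Lemma normc_real (a : R) : normc (a%:C) = `|a|.
Proof. by rewrite normcE2 /= expr0n addr0 sqrtr_sqr. Qed.

Lemma normc_le_ReIm (z : R[i]) : normc z <= `|Re z| + `|Im z|.
Proof.
have -> : z = (Re z)%:C + 'i * (Im z)%:C by case: z => a b; simpc.
apply: (le_trans (le_normcD _ _)).
rewrite normcM !normc_real [normc 'i]normcE2 /= expr0n expr1n add0r sqrtr1 mul1r.
by simpc.
Qed.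

Lemma ReD (z w : R[i]) : Re (z + w) = Re z + Re w.
Proof. by case: z w => [a b] [c d]. Qed.

Lemma ImD (z w : R[i]) : Im (z + w) = Im z + Im w.
Proof. by case: z w => [a b] [c d]. Qed.

Lemma ReM (z w : R[i]) : Re (z * w) = Re z * Re w - Im z * Im w.
Proof. by case: z w => [a b] [c d]. Qed.

Lemma ImM (z w : R[i]) : Im (z * w) = Re z * Im w + Im z * Re w.
Proof. by case: z w => [a b] [c d]. Qed.

Definition cmeas d (T : measurableType d) (f : T -> R[i]) :=
  measurable_fun setT (fun x => Re (f x)) /\
  measurable_fun setT (fun x => Im (f x)).

Section Measurability.
Context d (T : measurableType d).
Implicit Types f g : T -> R[i].

Lemma cmeas_cst (c : R[i]) : cmeas (fun _ : T => c).
Proof. by split; exact: measurable_cst. Qed.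

Lemma cmeasD f g : cmeas f -> cmeas g -> cmeas (fun x => f x + g x).
Proof.
move=> [f1 f2] [g1 g2]; split.
  rewrite [X in measurable_fun _ X](_ : _ = (fun x => Re (f x)) \+ (fun x => Re (g x))).
    exact: measurable_funD.
  by apply/funext => x; rewrite /= ReD.
rewrite [X in measurable_fun _ X](_ : _ = (fun x => Im (f x)) \+ (fun x => Im (g x))).
  exact: measurable_funD.
by apply/funext => x; rewrite /= ImD.
Qed.

Lemma cmeasM f g : cmeas f -> cmeas g -> cmeas (fun x => f x * g x).
Proof.
move=> [f1 f2] [g1 g2]; split.
  rewrite [X in measurable_fun _ X](_ : _ = (fun x => Re (f x)) \* (fun x => Re (g x))
     \- (fun x => Im (f x)) \* (fun x => Im (g x))).
    by apply: measurable_funB; exact: measurable_funM.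
  by apply/funext => x; rewrite /= ReM.
rewrite [X in measurable_fun _ X](_ : _ = (fun x => Re (f x)) \* (fun x => Im (g x))
     \+ (fun x => Im (f x)) \* (fun x => Re (g x))).
  by apply: measurable_funD; exact: measurable_funM.
by apply/funext => x; rewrite /= ImM.
Qed.

Lemma cmeas_real (f : T -> R) : measurable_fun setT f -> cmeas (fun x => (f x)%:C).
Proof. by move=> mf; split => //; exact: measurable_cst. Qed.

Lemma cmeas_normc f : cmeas f -> measurable_fun setT (fun x => normc (f x)).
Proof.
move=> [f1 f2].
rewrite [X in measurable_fun _ X](_ : _ =
  (@Num.sqrt R) \o (((fun x => Re (f x)) \* (fun x => Re (f x))) \+
     ((fun x => Im (f x)) \* (fun x => Im (f x))))).
  have ms : measurable_fun setT (@Num.sqrt R).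
    by apply: continuous_measurable_fun => x; apply: sqrt_continuous.
  have mp : measurable_fun setT (((fun x => Re (f x)) \* (fun x => Re (f x))) \+
     ((fun x => Im (f x)) \* (fun x => Im (f x)))).
    by apply: measurable_funD; exact: measurable_funM.
  exact: (measurableT_comp ms mp).
by apply/funext => x; rewrite /= normcE2 !expr2.
Qed.
End Measurability.

Lemma cmeas_comp d d' (T : measurableType d) (U : measurableType d') (f : T -> R[i])
  (p : U -> T) : cmeas f -> measurable_fun setT p -> cmeas (fun x => f (p x)).
Proof.
by move=> [f1 f2] mp; split; [exact: (measurableT_comp f1 mp)|exact: (measurableT_comp f2 mp)].
Qed.

(** Taken componentwise, so that [line_integral] is ['i * cint] by conversion. *)
Definition cint (f : R -> R[i]) : R[i] :=
  (Rintegral mu setT (fun y => Re (f y))) +i* (Rintegral mu setT (fun y => Im (f y))).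

Definition intble (g : R -> R) := mu.-integrable setT (EFin \o g).

Definition cintble (f : R -> R[i]) :=
  intble (fun y => Re (f y)) /\ intble (fun y => Im (f y)).

Lemma intble_meas g : intble g -> measurable_fun setT g.
Proof. by move/measurable_int/measurable_EFinP. Qed.

Lemma le_intble (f g : R -> R) : measurable_fun setT f -> intble g ->
  (forall x, `|f x| <= g x) -> intble f.
Proof.
move=> mf ig fg; apply: le_integrable ig => //.
- exact/measurable_EFinP.
- by move=> x _ /=; rewrite lee_fin (le_trans (fg x)) // ler_norm.
Qed.

Lemma intbleD (f g : R -> R) : intble f -> intble g -> intble (fun x => f x + g x).
Proof. by move=> If Ig; exact: (integrableD measurableT If Ig). Qed.

Lemma intbleZ (c : R) (f : R -> R) : intble f -> intble (fun x => c * f x).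
Proof. by move=> If; exact: (integrableZl measurableT c If). Qed.

Lemma cintble_meas f : cintble f -> cmeas f.
Proof. by move=> [/intble_meas ? /intble_meas ?]. Qed.

Lemma cintble_dom f g : cmeas f -> intble g -> (forall x, normc (f x) <= g x) ->
  cintble f.
Proof.
move=> [m1 m2] ig fg; split; apply: (le_intble _ ig) => // x.
  exact: le_trans (Re_le_normc _) (fg x).
exact: le_trans (Im_le_normc _) (fg x).
Qed.

Lemma cintbleP f : cmeas f -> intble (fun x => normc (f x)) -> cintble f.
Proof. by move=> mf If; apply: (cintble_dom mf If). Qed.

Lemma cintble_normc f : cintble f -> intble (fun x => normc (f x)).
Proof.
move=> If; have mf := cintble_meas If; case: If => I1 I2.
apply: (le_intble (cmeas_normc mf) (intbleD (integrable_norm I1) (integrable_norm I2))).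
by move=> x /=; rewrite ger0_norm ?normc_ge0// normc_le_ReIm.
Qed.

Lemma cintbleD f g : cintble f -> cintble g -> cintble (fun x => f x + g x).
Proof.
move=> If Ig; have mf := cintble_meas If; have mg := cintble_meas Ig.
apply: (cintble_dom (cmeasD mf mg) (intbleD (cintble_normc If) (cintble_normc Ig))).
by move=> x; exact: le_normcD.
Qed.

Lemma cintbleZ c f : cintble f -> cintble (fun x => c * f x).
Proof.
move=> If; have mf := cintble_meas If.
apply: (cintble_dom (cmeasM (cmeas_cst _ c) mf) (intbleZ (normc c) (cintble_normc If))).
by move=> x; rewrite normcM.
Qed.

Lemma eq_cint f g : (forall x, f x = g x) -> cint f = cint g.
Proof. by move=> fg; congr cint; apply/funext. Qed.

Lemma cintD f g : cintble f -> cintble g ->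
  cint (fun x => f x + g x) = cint f + cint g.
Proof.
move=> [f1 f2] [g1 g2]; rewrite /cint.
rewrite (_ : (fun y => Re _) = (fun y => Re (f y) + Re (g y))); last first.
  by apply/funext => x; rewrite ReD.
rewrite (_ : (fun y => Im _) = (fun y => Im (f y) + Im (g y))); last first.
  by apply/funext => x; rewrite ImD.
by rewrite !RintegralD.
Qed.

Lemma cintZ c f : cintble f -> cint (fun x => c * f x) = c * cint f.
Proof.
move=> [f1 f2]; rewrite /cint.
rewrite (_ : (fun y => Re _) = (fun y => Re c * Re (f y) - Im c * Im (f y))); last first.
  by apply/funext => x; rewrite ReM.
rewrite (_ : (fun y => Im _) = (fun y => Re c * Im (f y) + Im c * Re (f y))); last first.
  by apply/funext => x; rewrite ImM.
have I1 := intbleZ (Re c) f1; have I2 := intbleZ (Im c) f2.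
have I3 := intbleZ (Re c) f2; have I4 := intbleZ (Im c) f1.
by rewrite RintegralB// RintegralD// !RintegralZl//; case: c {I1 I2 I3 I4} => a b.
Qed.

Lemma cintZr c f : cintble f -> cint (fun x => f x * c) = cint f * c.
Proof. by move=> If; rewrite mulrC -cintZ//; apply: eq_cint => x; rewrite mulrC. Qed.

(** * Affine changes of variable *)

Section Affine.
Variables (a b : R).
Hypothesis a0 : a != 0.
Let phi (x : R) : R := a * x + b.

Lemma measurable_affine : measurable_fun setT phi.
Proof. by apply: measurable_funD => //; apply: measurable_funM. Qed.

(** Lebesgue measure is characterised by its values on half-open intervals, and [|a|] times the
    pushforward along [phi] has the same values. *)
Lemma ge0_integral_affine (f : R -> \bar R) : measurable_fun setT f ->
  (forall x, 0 <= f x)%E ->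
  (\int[mu]_x f x = `|a|%:E * \int[mu]_x f (phi x))%E.
Proof.
move=> mf f0; have mphi := measurable_affine.
pose k : {nonneg R} := NngNum (normr_ge0 a).
have [pf pfE] : exists pf : {measure set (measurableTypeR R) -> \bar R},
    (pf : set R -> \bar R) = pushforward mu phi.
  unshelve (eexists (pushforward mu (phi : measurableTypeR R -> measurableTypeR R)
     : {measure set _ -> \bar R})); last reflexivity.
  exact: mphi.
pose m2 := @mscale _ (measurableTypeR R) R k pf.
transitivity (\int[m2]_x f x)%E; last first.
  rewrite ge0_integral_mscale//; congr (_ * _)%E.
  have := @ge0_integral_pushforward _ _ (measurableTypeR R) (measurableTypeR R) R phi mphi
    mu setT f measurableT mf (fun x _ => f0 x).
  rewrite preimage_setT => <-.
  by apply: eq_measure_integral => A mA _; rewrite pfE.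
apply: eq_measure_integral => A mA _; apply: lebesgue_measure_unique => //.
move=> X /ocitvP[->|[[u v] /= uv ->]]; first by rewrite !measure0.
rewrite /m2 /mscale /= pfE /pushforward /= lebesgue_measure_itv/= lte_fin uv.
(* For negative [a] the preimage of a left-open interval is right-open, so the two signs give
   intervals of different kinds. *)
have [ap|an|/eqP] := ltrgtP a 0; last by rewrite (negbTE a0).
- have -> : (phi @^-1` `]u, v])%classic = `[(v - b) / a, (u - b) / a[%classic.
    apply/seteqP; split => x /=; rewrite !in_itv/= /phi => /andP[h1 h2];
      apply/andP; split.
    + by rewrite ler_ndivrMr// mulrC; lra.
    + by rewrite ltr_ndivlMr// mulrC; lra.
    + by move: h2; rewrite ltr_ndivlMr// mulrC; lra.
    + by move: h1; rewrite ler_ndivrMr// mulrC; lra.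
  rewrite lebesgue_measure_itv/= lte_fin ltr_nM2r ?invr_lt0//.
  rewrite ltrD2r uv -EFinB -EFinM; congr EFin.
  by rewrite ltr0_norm//; field.
- have -> : (phi @^-1` `]u, v])%classic = `](u - b) / a, (v - b) / a]%classic.
    apply/seteqP; split => x /=; rewrite !in_itv/= /phi => /andP[h1 h2];
      apply/andP; split.
    + by rewrite ltr_pdivrMr// mulrC; lra.
    + by rewrite ler_pdivlMr// mulrC; lra.
    + by move: h1; rewrite ltr_pdivrMr// mulrC; lra.
    + by move: h2; rewrite ler_pdivlMr// mulrC; lra.
  rewrite lebesgue_measure_itv/= lte_fin ltr_pM2r ?invr_gt0//.
  rewrite ltrD2r uv -EFinB -EFinM; congr EFin.
  by rewrite gtr0_norm//; field.
Qed.

Lemma intble_affine g : intble g -> intble (fun x => g (a * x + b)).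
Proof.
move=> Ig; have mg := intble_meas Ig; apply/integrableP; split.
  apply/measurable_EFinP; exact: (measurableT_comp mg measurable_affine).
move/integrableP : Ig => [_].
rewrite (@ge0_integral_affine (fun x => `|(g x)%:E|%E)) //; last first.
  by apply: measurableT_comp => //; exact/measurable_EFinP.
set I := (X in (_ * X < _)%E -> _) => h.
change (I < +oo)%E; move: h; case: I => // [r _|]; first by rewrite ltry.
by rewrite mulry gtr0_sg ?normr_gt0// mul1e.
Qed.

Lemma Rintegral_affine g : intble g ->
  Rintegral mu setT (fun x => g (a * x + b)) = `|a|^-1 * Rintegral mu setT g.
Proof.
move=> Ig; have mg := intble_meas Ig.
have Iga := intble_affine Ig.
have mE : measurable_fun setT (EFin \o g) by exact/measurable_EFinP.
have H : (\int[mu]_x (g x)%:E = `|a|%:E * \int[mu]_x (g (phi x))%:E)%E.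
  have Hp := ge0_integral_affine (measurable_funepos mE) (fun x => funepos_ge0 _ x).
  have Hn := ge0_integral_affine (measurable_funeneg mE) (fun x => funeneg_ge0 _ x).
  have fp : (\int[mu]_x (EFin \o (g \o phi))^\+ x)%E \is a fin_num.
    exact: integrable_pos_fin_num.
  have E1 : (\int[mu]_x (g (phi x))%:E = \int[mu]_x (EFin \o (g \o phi))^\+ x
      - \int[mu]_x (EFin \o (g \o phi))^\- x)%E := integralE _ _ _.
  have E2 : (\int[mu]_x (g x)%:E = \int[mu]_x (EFin \o g)^\+ x
      - \int[mu]_x (EFin \o g)^\- x)%E := integralE _ _ _.
  have pE : (EFin \o (g \o phi))^\+%E = (fun x => (EFin \o g)^\+%E (phi x)).
    by apply/funext => x; rewrite !funeposE.
  have nE : (EFin \o (g \o phi))^\-%E = (fun x => (EFin \o g)^\-%E (phi x)).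
    by apply/funext => x; rewrite !funenegE.
  rewrite pE in fp E1; rewrite nE in E1.
  by rewrite E2 E1 Hp Hn; apply/esym/muleBr => //; exact: fin_num_adde_defr.
rewrite /Rintegral H fineM//; last exact: integrable_fin_num.
by rewrite mulKf// normr_eq0.
Qed.

Lemma cintble_affine f : cintble f -> cintble (fun x => f (a * x + b)).
Proof. by case=> h1 h2; split; exact: (@intble_affine (fun y => _ (f y))). Qed.

Lemma cint_affine f : cintble f ->
  cint (fun x => f (a * x + b)) = (`|a|^-1)%:C * cint f.
Proof.
move=> [h1 h2]; rewrite /cint.
rewrite (@Rintegral_affine (fun y => Re (f y)))// (@Rintegral_affine (fun y => Im (f y)))//.
by simpc.
Qed.
End Affine.

End ComplexIntegral.

(** * Fubini and convolution of complex-valued functions *)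

Section Convolution.
Context {R : realType}.
Import ComplexField.Normc.
Local Open Scope complex_scope.
Local Notation mu := (@lebesgue_measure R).
Local Notation Re := complex.Re.
Local Notation Im := complex.Im.

(** The factor 2 comes from bounding real and imaginary parts separately; it is harmless for the
    boundedness of convolutions. *)
Lemma normc_cint (f : R -> R[i]) : cintble f ->
  normc (cint f) <= 2 * Rintegral mu setT (fun x => normc (f x)).
Proof.
move=> If; have In := cintble_normc If; case: If => I1 I2.
apply: (le_trans (normc_le_ReIm _)); rewrite mulrDl mul1r.
by apply: lerD => /=; apply: (le_trans (le_normr_Rintegral measurableT _)) => //;
  apply: le_Rintegral => //; try exact: integrable_norm; move=> x _;
  [exact: Re_le_normc|exact: Im_le_normc].
Qed.

Lemma measurable_fstR : measurable_fun setT (fst : R * R -> R).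
Proof. exact: measurable_fst. Qed.

Lemma measurable_sndR : measurable_fun setT (snd : R * R -> R).
Proof. exact: measurable_snd. Qed.

Section FubiniReal.
Variable f : R * R -> R.
Hypothesis If : (mu \x mu)%E.-integrable setT (EFin \o f).
Hypothesis I1 : forall x, intble (fun y => f (x, y)).
Hypothesis I2 : forall y, intble (fun x => f (x, y)).

(** Every section is assumed integrable, not just almost every one, so real and extended inner
    integrals agree at each point. *)
Let E1 x : (Rintegral mu setT (fun y => f (x, y)))%:E = (\int[mu]_y (f (x, y))%:E)%E.
Proof. by rewrite fineK//; exact: (integrable_fin_num measurableT (I1 x)). Qed.

Let E2 y : (Rintegral mu setT (fun x => f (x, y)))%:E = (\int[mu]_x (f (x, y))%:E)%E.
Proof. by rewrite fineK//; exact: (integrable_fin_num measurableT (I2 y)). Qed.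

Lemma intble_fubini1 : intble (fun x => Rintegral mu setT (fun y => f (x, y))).
Proof.
apply: eq_integrable (integrable_fubini_F If) => // x _.
by rewrite /= E1.
Qed.

Lemma intble_fubini2 : intble (fun y => Rintegral mu setT (fun x => f (x, y))).
Proof.
have mf := measurable_int _ If.
pose swap (z : R * R) := (z.2, z.1).
have mswap : measurable_fun setT swap.
  by apply/measurable_fun_pairP; split; [exact: measurable_sndR|exact: measurable_fstR].
have Is : (mu \x mu)%E.-integrable setT (EFin \o (f \o swap)).
  apply/integrable12ltyP; first exact: (measurableT_comp mf mswap).
  exact: (integrable21ltyP mu mu mf).1.
apply: eq_integrable (integrable_fubini_F Is) => // y _.
by rewrite /= E2.
Qed.

Lemma Rintegral_fubini :
  Rintegral mu setT (fun x => Rintegral mu setT (fun y => f (x, y))) =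
  Rintegral mu setT (fun y => Rintegral mu setT (fun x => f (x, y))).
Proof.
rewrite {1}/Rintegral; under eq_integral do rewrite E1.
rewrite [in RHS]/Rintegral; under [in RHS]eq_integral do rewrite E2.
congr fine; exact: (Fubini If).
Qed.
End FubiniReal.

(** The shear serves two cases: [k = -1] dominates a convolution kernel, [k = 0] a product of
    independent factors. *)
Lemma prod_intble (k : R) (a b : R -> R) : intble a -> intble b ->
  (mu \x mu)%E.-integrable setT (fun z => (a z.1 * b (k * z.1 + z.2))%:E).
Proof.
move=> Ia Ib; have ma := intble_meas Ia; have mb := intble_meas Ib.
have mF : measurable_fun setT (fun z : R * R => a z.1 * b (k * z.1 + z.2)).
  apply: measurable_funM; first exact: (measurableT_comp ma measurable_fst).
  have mk : measurable_fun setT (fun z : R * R => k * z.1 + z.2).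
    by apply: measurable_funD measurable_sndR; apply: measurable_funM measurable_fstR.
  exact: (measurableT_comp mb mk).
apply/integrable12ltyP; first exact/measurable_EFinP.
have mb1 : measurable_fun setT (fun y => `|b y|%:E).
  by apply/measurable_EFinP; exact: (measurableT_comp (@normr_measurable R setT) mb).
have ma1 : measurable_fun setT (fun y => `|a y|%:E).
  by apply/measurable_EFinP; exact: (measurableT_comp (@normr_measurable R setT) ma).
pose B := (\int[mu]_y `|b y|%:E)%E.
have Bfin : (B < +oo)%E by case/integrableP : Ib.
have Afin : (\int[mu]_y `|a y|%:E < +oo)%E by case/integrableP : Ia.
have B0 : (0 <= B)%E by exact: integral_ge0.
have inner x : (\int[mu]_y `|(a x * b (k * x + y))%:E| = `|a x|%:E * B)%E.
  rewrite /B (ge0_integral_affine (k * x) (oner_neq0 R) mb1)// normr1 mul1e.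
  rewrite -ge0_integralZl//; last first.
    by apply: (measurableT_comp mb1); exact: measurable_affine.
  by apply: eq_integral => y _; rewrite /= normrM EFinM mul1r (addrC y).
under eq_integral do rewrite inner.
by rewrite ge0_integralZr// lte_mul_pinfty// ?integral_ge0// ge0_fin_numE ?integral_ge0.
Qed.

Section FubiniComplex.
Variables (F : R * R -> R[i]) (k M : R) (a b : R -> R).
Hypothesis mF : cmeas F.
Hypotheses (Ia : intble a) (Ib : intble b).
Hypothesis bM : forall y, `|b y| <= M.
Hypothesis Fab : forall x y, normc (F (x, y)) <= a x * b (k * x + y).

Lemma cintble_section1 x : cintble (fun y => F (x, y)).
Proof.
apply: (cintble_dom (g := fun y => a x * b (1 * y + k * x))).
- exact: (cmeas_comp mF (measurable_pair1 x)).
- by apply: intbleZ; apply: (intble_affine _ (oner_neq0 R)).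
- by move=> y; rewrite mul1r addrC; exact: Fab.
Qed.

(** Boundedness of [b] gives integrability at every [y], where Fubini alone would give it at almost
    every [y]. *)
Lemma cintble_section2 y : cintble (fun x => F (x, y)).
Proof.
apply: (cintble_dom (g := fun x => M * `|a x|)).
- exact: (cmeas_comp mF (measurable_pair2 y)).
- by apply: intbleZ; exact: (integrable_norm Ia).
- move=> x; apply: (le_trans (Fab x y)); apply: (le_trans (ler_norm _)).
  by rewrite normrM mulrC ler_wpM2r.
Qed.

Let Iab := prod_intble k Ia Ib.

Let IRe : (mu \x mu)%E.-integrable setT (EFin \o (fun z => Re (F z))).
Proof.
apply: le_integrable Iab => //; first by apply/measurable_EFinP; case: mF.
move=> [x y] _ /=; rewrite lee_fin; apply: (le_trans (Re_le_normc _)).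
exact: (le_trans (Fab x y) (ler_norm _)).
Qed.

Let IIm : (mu \x mu)%E.-integrable setT (EFin \o (fun z => Im (F z))).
Proof.
apply: le_integrable Iab => //; first by apply/measurable_EFinP; case: mF.
move=> [x y] _ /=; rewrite lee_fin; apply: (le_trans (Im_le_normc _)).
exact: (le_trans (Fab x y) (ler_norm _)).
Qed.

Lemma cfubini :
  cint (fun x => cint (fun y => F (x, y))) = cint (fun y => cint (fun x => F (x, y))).
Proof.
rewrite /cint; congr (_ +i* _).
  exact: (Rintegral_fubini IRe (fun x => (cintble_section1 x).1)
    (fun y => (cintble_section2 y).1)).
exact: (Rintegral_fubini IIm (fun x => (cintble_section1 x).2)
    (fun y => (cintble_section2 y).2)).
Qed.

Lemma cintble_fubini1 : cintble (fun x => cint (fun y => F (x, y))).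
Proof.
split; first exact: (intble_fubini1 IRe (fun x => (cintble_section1 x).1)).
exact: (intble_fubini1 IIm (fun x => (cintble_section1 x).2)).
Qed.

Lemma cintble_fubini2 : cintble (fun y => cint (fun x => F (x, y))).
Proof.
split; first exact: (intble_fubini2 IRe (fun y => (cintble_section2 y).1)).
exact: (intble_fubini2 IIm (fun y => (cintble_section2 y).2)).
Qed.
End FubiniComplex.

(** Boundedness is added to integrability so that convolutions converge at every point and are again
    of this kind. *)
Definition bL1 (f : R -> R[i]) :=
  [/\ cmeas f, exists M, forall x, normc (f x) <= M & intble (fun x => normc (f x))].

Lemma bL1_cintble f : bL1 f -> cintble f.
Proof. by case=> mf _ If; exact: cintbleP. Qed.

Lemma bL1D f g : bL1 f -> bL1 g -> bL1 (fun x => f x + g x).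
Proof.
move=> bf bg; have If := cintbleD (bL1_cintble bf) (bL1_cintble bg).
case: bf bg => _ [M fM] _ [_ [N gN] _]; split; [exact: cintble_meas| |exact: cintble_normc].
by exists (M + N) => x; apply: (le_trans (le_normcD _ _)); apply: lerD.
Qed.

Lemma bL1Z c f : bL1 f -> bL1 (fun x => c * f x).
Proof.
move=> bf; have If := cintbleZ c (bL1_cintble bf).
case: bf => _ [M fM] _; split; [exact: cintble_meas| |exact: cintble_normc].
by exists (normc c * M) => x; rewrite normcM ler_wpM2l ?normc_ge0.
Qed.

Lemma bL1M f g M : cmeas g -> (forall x, normc (g x) <= M) -> bL1 f ->
  bL1 (fun x => g x * f x).
Proof.
move=> mg gM [mf [N fN] If]; have m := cmeasM mg mf.
have M0 : 0 <= M by apply: le_trans (gM 0); exact: normc_ge0.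
split => //.
  exists (M * N) => x; rewrite normcM; apply: ler_pM; rewrite ?normc_ge0//.
apply: (le_intble (cmeas_normc m) (intbleZ M If)) => x.
by rewrite ger0_norm ?normc_ge0// normcM ler_wpM2r ?normc_ge0.
Qed.

Definition cconv (f g : R -> R[i]) (y : R) : R[i] := cint (fun x => f x * g (y - x)).

Lemma cmeas_conv_kernel f g : cmeas f -> cmeas g ->
  cmeas (fun z : R * R => f z.1 * g (z.2 - z.1) : R[i]).
Proof.
move=> mf mg; apply: cmeasM; first exact: (cmeas_comp mf measurable_fstR).
have mk : measurable_fun setT (fun z : R * R => z.2 - z.1).
  exact: measurable_funB measurable_sndR measurable_fstR.
exact: (cmeas_comp mg mk).
Qed.

Section ConvTheory.
Variables f g : R -> R[i].
Hypotheses (bf : bL1 f) (bg : bL1 g).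

Let mfg : cmeas (fun z : R * R => f z.1 * g (z.2 - z.1) : R[i]).
Proof. by case: bf bg => mf _ _ [mg _ _]; exact: cmeas_conv_kernel. Qed.

Let dom x y : normc (f x * g (y - x)) <= normc (f x) * normc (g (-1 * x + y)).
Proof. by rewrite normcM mulN1r (addrC _ y). Qed.

Lemma cintble_conv_kernel y : cintble (fun x => f x * g (y - x)).
Proof.
case: bf bg => _ _ If [_ [M gM] Ig].
have gM' y' : `|normc (g y')| <= M by rewrite ger0_norm ?normc_ge0.
exact: (cintble_section2 mfg If gM' dom).
Qed.

Lemma bL1_conv : bL1 (cconv f g).
Proof.
have Ik := cintble_conv_kernel.
case: bf bg => _ _ If [_ [M gM] Ig].
have gM' y' : `|normc (g y')| <= M by rewrite ger0_norm ?normc_ge0.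
have H : cintble (cconv f g) := cintble_fubini2 mfg If Ig gM' dom.
split; [exact: cintble_meas| |exact: cintble_normc].
exists (2 * Rintegral mu setT (fun x => M * normc (f x))) => y.
apply: (le_trans (normc_cint (Ik y))); rewrite ler_pM2l//.
apply: le_Rintegral => //; [exact: cintble_normc|exact: intbleZ|].
by move=> x _; rewrite normcM mulrC ler_wpM2r ?normc_ge0.
Qed.

Lemma cint_conv : cint (cconv f g) = cint f * cint g.
Proof.
have [Cf Cg] := (bL1_cintble bf, bL1_cintble bg).
case: bf bg => _ _ If [_ [M gM] Ig].
have gM' y' : `|normc (g y')| <= M by rewrite ger0_norm ?normc_ge0.
have := cfubini mfg If Ig gM' dom => /= <-.
rewrite -cintZr//; apply: eq_cint => x.
have Ca := cintble_affine (- x) (oner_neq0 R) Cg.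
transitivity (f x * cint (fun y => g (1 * y + - x))).
  by rewrite -cintZ//; apply: eq_cint => y; rewrite mul1r.
by rewrite cint_affine ?oner_neq0// normr1 invr1 mul1r.
Qed.

Lemma cconvC y : cconv f g y = cconv g f y.
Proof.
have := cint_affine y (_ : -1 != 0) (cintble_conv_kernel y).
rewrite oppr_eq0 oner_neq0 normrN1 invr1 mul1r => /(_ isT) E; rewrite [LHS]/cconv -E.
by apply: eq_cint => x; rewrite mulN1r addrC opprB addrCA subrr addr0 mulrC.
Qed.
End ConvTheory.

Lemma cconvA f g k y : bL1 f -> bL1 g -> bL1 k ->
  cconv (cconv k f) g y = cconv k (cconv f g) y.
Proof.
move=> bf bg bk.
transitivity (cint (fun w => cint (fun x => k x * f (w - x) * g (y - w)))).
  apply: eq_cint => w; rewrite -cintZr//; exact: cintble_conv_kernel.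
have [mf _ If] := bf; have [mg [M gM] Ig] := bg; have [mk _ Ik] := bk.
have [_ [N fN] _] := bf.
have M0 : 0 <= M by apply: le_trans (gM 0); exact: normc_ge0.
have mF : cmeas (fun z : R * R => k z.1 * f (z.2 - z.1) * g (y - z.2) : R[i]).
  apply: cmeasM; first exact: cmeas_conv_kernel.
  have my : measurable_fun setT (fun z : R * R => y - z.2).
    by apply: measurable_funB measurable_sndR.
  exact: (cmeas_comp mg my).
have := @cfubini _ (-1) (M * N) (fun x => normc (k x)) (fun x => M * normc (f x)) mF Ik
  (intbleZ M If).
move=> /= <-; first last.
- move=> x w /=; rewrite !normcM mulN1r (addrC _ w) -mulrA.
  by rewrite ler_wpM2l ?normc_ge0// mulrC ler_wpM2r ?normc_ge0.
- by move=> x; rewrite ger0_norm ?mulr_ge0 ?normc_ge0// ler_wpM2l.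
apply: eq_cint => x.
have C := cintble_conv_kernel bf bg (y - x).
transitivity (k x * cint (fun w => f (1 * w + - x) * g (y - x - (1 * w + - x)))).
  rewrite -cintZ; first by apply: eq_cint => w; rewrite mul1r opprB addrA subrK mulrA.
  exact: (cintble_affine (- x) (oner_neq0 R) C).
congr (_ * _).
rewrite (cint_affine (f := fun z => f z * g (y - x - z)) (- x) (oner_neq0 R))//.
by rewrite normr1 invr1 mul1r.
Qed.

(** A character splits over the two factors because y = x + (y - x). This carries the convolution
    theory over to functions that are integrable only after multiplication by an exponential. *)
Lemma cconv_twist (chi f g : R -> R[i]) y :
  (forall x, chi x != 0) -> {morph chi : x x' / x + x' >-> x * x'} ->
  bL1 (fun x => chi x * f x) -> bL1 (fun x => chi x * g x) ->
  chi y * cconv f g y = cconv (fun x => chi x * f x) (fun x => chi x * g x) y.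
Proof.
move=> chi0 chiD bf bg.
have E x : f x * g (y - x) = (chi y)^-1 * (chi x * f x * (chi (y - x) * g (y - x))).
  have -> : chi y = chi x * chi (y - x) by rewrite -chiD addrC subrK.
  by have := chi0 x; have := chi0 (y - x) => ? ?; field; apply/andP.
rewrite -cintZ; first by apply: eq_cint => x; rewrite E mulVKf.
have := cintbleZ (chi y)^-1 (cintble_conv_kernel bf bg y).
by congr cintble; apply/funext => x; rewrite E.
Qed.
End Convolution.

(** * The complex exponential and the kernel *)

Section Kernel.
Context {R : realType}.
Import ComplexField.Normc.
Local Open Scope complex_scope.
Local Notation mu := (@lebesgue_measure R).
Local Notation Re := complex.Re.
Local Notation Im := complex.Im.
Local Notation tpi := (@two_pi_i R).

Lemma complex_ext (z w : R[i]) : Re z = Re w -> Im z = Im w -> z = w.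
Proof. by case: z w => [a b] [c d] /= -> ->. Qed.

Lemma expCE (z : R[i]) : expC z = (expR (Re z) * cos (Im z)) +i* (expR (Re z) * sin (Im z)).
Proof. by case: z. Qed.

Lemma expCD : {morph @expC R : z w / z + w >-> z * w}.
Proof.
move=> [a b] [c d]; rewrite !expCE /= expRD cosD sinD; apply: complex_ext.
  by rewrite ReM /=; ring.
by rewrite ImM /=; ring.
Qed.

Lemma expC0 : expC (0 : R[i]) = 1.
Proof. by rewrite expCE /= expR0 cos0 sin0 !mul1r. Qed.

Lemma normc_expC (z : R[i]) : normc (expC z) = expR (Re z).
Proof.
rewrite expCE normcE2 /= !exprMn -mulrDr cos2Dsin2 mulr1 sqrtr_sqr.
by rewrite ger0_norm// expR_ge0.
Qed.

Lemma normc_eq0 (z : R[i]) : (normc z == 0) = (z == 0).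
Proof. by apply/eqP/eqP => [/eq0_normc //|->]; rewrite normc0. Qed.

Lemma expC_neq0 (z : R[i]) : expC z != 0.
Proof. by rewrite -normc_eq0 normc_expC gt_eqF// expR_gt0. Qed.

Lemma expC_tpi : expC tpi = 1.
Proof. by rewrite /two_pi_i expCE /= expR0 mulr_natl cos2pi sin2pi !mul1r. Qed.

Lemma expC_pi_i : expC (0 +i* pi : R[i]) = -1.
Proof.
by rewrite expCE /= expR0 !mul1r cospi sinpi; apply: complex_ext; rewrite /= ?oppr0.
Qed.

Definition ker (t : R[i]) : R[i] := (expC (tpi * t) - 1)^-1.

Lemma kerD1 t : ker (t + 1) = ker t.
Proof. by rewrite /ker mulrDr mulr1 expCD expC_tpi mulr1. Qed.

Lemma tpi_pt (c y : R) : tpi * (c +i* y) = (- (2 * pi * y)) +i* (2 * pi * c).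
Proof. by apply: complex_ext; rewrite ?ReM ?ImM /=; ring. Qed.

(** The poles of the kernel are the integers, and this keeps a closed band between -1 and 0
    uniformly away from them. Uniformity in [c] serves the later differentiation across lines. *)
Lemma cos2pi_lt1 (c1 c2 : R) : -1 < c1 -> c1 <= c2 -> c2 < 0 ->
  exists2 e, 0 < e & forall c, c1 <= c <= c2 -> cos (2 * pi * c) <= 1 - e.
Proof.
move=> h1 h12 h2.
have pi0 := pi_gt0 R.
have L (x : R) : 0 < x <= 1 / 2 -> forall c, x <= c <= 1 / 2 ->
    cos (2 * pi * c) <= cos (2 * pi * x) < 1.
  move=> /andP[x0 x2] c /andP[xc c2'].
  have I (z : R) : 0 <= z <= 1 / 2 -> 2 * pi * z \in `[0, pi].
    by rewrite in_itv/= => /andP[z0 z2]; apply/andP; split; nra.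
  have Ix := I x (ltac:(lra)); have Ic := I c (ltac:(lra)); have I0 := I 0 (ltac:(lra)).
  apply/andP; split.
    by rewrite leNgt (ltr_cos Ic Ix) ltr_pM2l ?mulr_gt0// -leNgt.
  by have E := ltr_cos I0 Ix; rewrite mulr0 cos0 in E; rewrite E !mulr_gt0.
(* The distances from [c1] to -1 and from [c2] to 0, capped at 1/2 because the cosine decreases on
   [0, pi]. *)
pose m1 := Num.min (1 + c1) (1 / 2).
pose m2 := Num.min (- c2) (1 / 2).
have hm1 : 0 < m1 <= 1 / 2 by rewrite /m1 lt_min ge_min; apply/andP; split; [apply/andP; split; lra|apply/orP; right].
have hm2 : 0 < m2 <= 1 / 2 by rewrite /m2 lt_min ge_min; apply/andP; split; [apply/andP; split; lra|apply/orP; right].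
have /andP[_ l1] := L _ hm1 m1 (ltac:(by rewrite lexx; case/andP: hm1)).
have /andP[_ l2] := L _ hm2 m2 (ltac:(by rewrite lexx; case/andP: hm2)).
exists (Num.min (1 - cos (2 * pi * m1)) (1 - cos (2 * pi * m2))).
  by rewrite lt_min !subr_gt0 l1 l2.
move=> c /andP[cc1 cc2]; rewrite lerBrDr -lerBrDl ge_min.
have [c_le|c_gt] := leP c (- (1 / 2)).
  apply/orP; left; rewrite lerD2l lerN2.
  have -> : cos (2 * pi * c) = cos (2 * pi * (1 + c)).
    by rewrite (_ : 2 * pi * (1 + c) = 2 * pi * c + pi *+ 2) ?cosD2pi//; ring.
  have hc : m1 <= 1 + c <= 1 / 2.
    by apply/andP; split; [rewrite /m1 ge_min; apply/orP; left|]; lra.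
  by case/andP: (L _ hm1 _ hc).
apply/orP; right; rewrite lerD2l lerN2.
have -> : cos (2 * pi * c) = cos (2 * pi * - c) by rewrite mulrN cosN.
have hc : m2 <= - c <= 1 / 2.
  by apply/andP; split; [rewrite /m2 ge_min; apply/orP; left|]; lra.
by case/andP: (L _ hm2 _ hc).
Qed.

(** With r = e^{-2 pi y} and k = cos(2 pi c), the squared modulus r^2 - 2 r k + 1 equals (1 + k)/2
    (r - 1)^2 + (1 - k)/2 (1 + r)^2. *)
Lemma normc_exp_sub1 (e c y : R) : 0 < e -> cos (2 * pi * c) <= 1 - e ->
  e / 2 * (1 + expR (- (2 * pi * y))) ^+ 2 <=
  normc (expC (tpi * (c +i* y)) - 1) ^+ 2.
Proof.
move=> e0 he; rewrite tpi_pt normcE2 sqr_sqrtr ?addr_ge0 ?sqr_ge0//.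
set k := cos (2 * pi * c) in he *.
set r := expR (- (2 * pi * y)); have r0 : 0 < r by exact: expR_gt0.
have sk : sin (2 * pi * c) ^+ 2 = 1 - k ^+ 2 by rewrite sin2cos2.
have -> : Re (expC (- (2 * pi * y) +i* (2 * pi * c)) - 1) = r * k - 1.
  by rewrite ReD expCE.
have -> : Im (expC (- (2 * pi * y) +i* (2 * pi * c)) - 1) = r * sin (2 * pi * c).
  by rewrite ImD expCE /= oppr0 addr0.
rewrite exprMn sk.
have k1 : -1 <= k by exact: cos_geN1.
have h1 : 0 <= (1 + k) / 2 * (r - 1) ^+ 2 by rewrite mulr_ge0 ?sqr_ge0//; lra.
have h2 : 0 <= (1 - k - e) / 2 * (1 + r) ^+ 2.
  by rewrite mulr_ge0 ?sqr_ge0// divr_ge0// subr_ge0 lerBrDl -lerBrDr.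
rewrite -subr_ge0 (_ : _ - _ = (1 + k) / 2 * (r - 1) ^+ 2 + (1 - k - e) / 2 * (1 + r) ^+ 2).
  exact: addr_ge0.
by field.
Qed.

Lemma exp_sub1_neq0 (c y : R) : -1 < c < 0 -> expC (tpi * (c +i* y)) - 1 != 0.
Proof.
move=> /andP[h1 h2]; have [e e0 he] := cos2pi_lt1 h1 (lexx c) h2.
have h := normc_exp_sub1 y e0 (he c _); move: h; rewrite lexx => /(_ isT) h.
apply/eqP => E; move: h; rewrite E normc0 expr0n/= => h.
have : 0 < e / 2 * (1 + expR (- (2 * pi * y))) ^+ 2.
  by rewrite mulr_gt0 ?divr_gt0 ?exprn_gt0 ?addr_gt0 ?expR_gt0.
by rewrite ltNge h.
Qed.

(** The majorant records both ends of the line: bounded as y tends to +oo, of order e^{2 pi y} as y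
    tends to -oo. *)
Lemma normc_ker (c1 c2 : R) : -1 < c1 -> c1 <= c2 -> c2 < 0 ->
  exists2 M, 0 < M & forall c y, c1 <= c <= c2 ->
    normc (ker (c +i* y)) <= M / (1 + expR (- (2 * pi * y))).
Proof.
move=> h1 h12 h2; have [e e0 he] := cos2pi_lt1 h1 h12 h2.
have s0 : 0 < Num.sqrt (e / 2) by rewrite sqrtr_gt0 divr_gt0.
exists (Num.sqrt (e / 2))^-1; first by rewrite invr_gt0.
move=> c y hc; have n0 : 0 < normc (expC (tpi * (c +i* y)) - 1).
  rewrite lt0r normc_ge0 andbT normc_eq0; apply: exp_sub1_neq0.
  by case/andP: hc => ? ?; apply/andP; split; lra.
rewrite /ker normcV -invfM lef_pV2 ?posrE// ?mulr_gt0 ?addr_gt0 ?expR_gt0//.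
rewrite -(ler_pXn2r (_ : (0 < 2)%N)) ?nnegrE ?normc_ge0 ?mulr_ge0 ?sqrtr_ge0 ?addr_ge0 ?expR_ge0//.
rewrite exprMn sqr_sqrtr ?divr_ge0 ?(ltW e0)//.
exact: (normc_exp_sub1 y e0 (he c hc)).
Qed.

Lemma inv1exp_le (b y : R) : 0 <= b <= 2 * pi ->
  (1 + expR (- (2 * pi * y)))^-1 <= expR (b * y).
Proof.
move=> /andP[b0 b2]; have p0 : 0 < 1 + expR (- (2 * pi * y)) by rewrite addr_gt0 ?expR_gt0.
rewrite -[leLHS]mul1r ler_pdivrMr// mulrDr mulr1 -expRD.
have [y0|y0] := leP 0 y.
  by rewrite -[leLHS]addr0 lerD ?expR_ge0// -[leLHS]expR0 ler_expR mulr_ge0.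
rewrite -[leLHS]add0r lerD ?expR_ge0// -[leLHS]expR0 ler_expR -mulrBl.
by apply: mulr_le0; [rewrite subr_le0|exact: ltW].
Qed.

(** A weight strictly between the two ends turns one-sided decay into two-sided decay; the rate is
    the distance from [b] to the endpoints 0 and 2 pi. *)
Lemma inv1exp_decay (b y : R) : 0 < b < 2 * pi ->
  expR (- (b * y)) / (1 + expR (- (2 * pi * y))) <=
  expR (- (Num.min b (2 * pi - b) * `|y|)).
Proof.
move=> /andP[b0 b2]; have p0 : 0 < 1 + expR (- (2 * pi * y)) by rewrite addr_gt0 ?expR_gt0.
set k := Num.min _ _.
have kb : k <= b by rewrite ge_min lexx.
have kb' : k <= 2 * pi - b by rewrite ge_min lexx orbT.
rewrite ler_pdivrMr// mulrDr mulr1 -expRD.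
have [y0|y0] := leP 0 y.
  by rewrite -[leLHS]addr0 lerD ?expR_ge0// ler_expR ger0_norm// lerN2 ler_wpM2r.
rewrite -[leLHS]add0r lerD ?expR_ge0// ler_expR ltr0_norm//.
rewrite -subr_ge0 [X in 0 <= X](_ : _ = (2 * pi - b - k) * - y); last by ring.
by rewrite mulr_ge0 ?subr_ge0// oppr_ge0 ltW.
Qed.

Lemma intble_expabs (k : R) : 0 < k -> intble (fun y : R => expR (- (k * `|y|))).
Proof.
move=> k0; have Ip := integrable_exponential_pdf k0.
have In : intble (fun y => exponential_pdf k (-1 * y + 0)).
  by apply: intble_affine; rewrite ?oppr_eq0 ?oner_neq0.
apply: (le_intble _ (intbleZ k^-1 (intbleD Ip In))).
  have m1 : measurable_fun setT (fun y : R => - (k * `|y|)).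
    have mk : measurable_fun setT (fun y : R => (- k) * `|y|).
      by apply: measurable_funM => //; exact: normr_measurable.
    by apply: (eq_measurable_fun _ _ mk) => x _; rewrite mulNr.
  exact: (measurableT_comp (@measurable_expR R) m1).
move=> y; rewrite ger0_norm ?expR_ge0// mulN1r addr0 ler_pdivlMl//.
have [y0|y0] := leP 0 y.
  rewrite exponential_pdfE// ger0_norm// -mulNr lerDl; exact/exponential_pdf_ge0/ltW.
rewrite [X in _ + X]exponential_pdfE ?oppr_ge0 ?(ltW y0)// ltr0_norm// -mulNr lerDr.
exact/exponential_pdf_ge0/ltW.
Qed.

End Kernel.

(** * Derivatives of complex-valued functions of a real variable *)

Section Differentiation.
Context {R : realType}.
Import ComplexField.Normc.
Local Open Scope classical_set_scope.
Local Open Scope ring_scope.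
Local Open Scope complex_scope.
Local Notation mu := (@lebesgue_measure R).
Local Notation Re := complex.Re.
Local Notation Im := complex.Im.
Local Notation tpi := (@two_pi_i R).

Definition cder (f : R -> R[i]) (x : R) (d : R[i]) :=
  is_derive x 1 (fun y => Re (f y)) (Re d) /\ is_derive x 1 (fun y => Im (f y)) (Im d).

Lemma cder_eq f x d d' : cder f x d -> d = d' -> cder f x d'.
Proof. by move=> h <-. Qed.

Lemma eq_cder f g x d : (forall y, f y = g y) -> cder f x d -> cder g x d.
Proof. by move=> /funext ->. Qed.

Lemma cder_cst c x : cder (fun _ => c) x 0.
Proof. by split; exact: is_derive_cst. Qed.

Lemma cderD f g x d e : cder f x d -> cder g x e -> cder (fun y => f y + g y) x (d + e).
Proof.
move=> [f1 f2] [g1 g2]; split.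
  rewrite (_ : (fun y => Re _) = (fun y => Re (f y)) + (fun y => Re (g y))).
    by apply: is_derive_eq; rewrite ReD.
  by apply/funext => y; rewrite ReD.
rewrite (_ : (fun y => Im _) = (fun y => Im (f y)) + (fun y => Im (g y))).
  by apply: is_derive_eq; rewrite ImD.
by apply/funext => y; rewrite ImD.
Qed.

Lemma cderM f g x d e : cder f x d -> cder g x e ->
  cder (fun y => f y * g y) x (d * g x + f x * e).
Proof.
move=> [f1 f2] [g1 g2]; split.
  rewrite (_ : (fun y => Re _) = (fun y => Re (f y)) * (fun y => Re (g y)) +
     - ((fun y => Im (f y)) * (fun y => Im (g y)))).
    apply: is_derive_eq; rewrite ReD !ReM -![_ *: _]/(_ * _); ring.
  by apply/funext => y; rewrite ReM.
rewrite (_ : (fun y => Im _) = (fun y => Re (f y)) * (fun y => Im (g y)) +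
   (fun y => Im (f y)) * (fun y => Re (g y))).
  apply: is_derive_eq; rewrite ImD !ImM -![_ *: _]/(_ * _); ring.
by apply/funext => y; rewrite ImM.
Qed.

Lemma cderZ c f x d : cder f x d -> cder (fun y => c * f y) x (c * d).
Proof. by move=> h; apply: (cder_eq (cderM (cder_cst c x) h)); rewrite mul0r add0r. Qed.

Lemma invCE (z : R[i]) : z^-1 =
  (Re z / (Re z * Re z + Im z * Im z)) +i* (- (Im z / (Re z * Re z + Im z * Im z))).
Proof. by case: z. Qed.

Lemma ReN (z : R[i]) : Re (- z) = - Re z. Proof. by case: z. Qed.

Lemma ImN (z : R[i]) : Im (- z) = - Im z. Proof. by case: z. Qed.

Lemma cderV f x d : f x != 0 -> cder f x d ->
  cder (fun y => (f y)^-1) x (- (d / (f x * f x))).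
Proof.
move=> fx0 [f1 f2]; set u := fun y => Re (f y) in f1; set v := fun y => Im (f y) in f2.
have n0 : u x * u x + v x * v x != 0.
  have : normc (f x) != 0 by rewrite normc_eq0.
  apply: contraNneq => /= E; rewrite normcE2 !expr2 -/(u x) -/(v x) E sqrtr0.
  by [].
have dn : is_derive x 1 (u * u + v * v) (2 * (u x * Re d + v x * Im d)).
  by apply: is_derive_eq; rewrite -![_ *: _]/(_ * _); ring.
have dV := is_deriveV (n0 : (u * u + v * v) x != 0) dn.
have E : - (d / (f x * f x)) =
   (((Re d) * (v x * v x - u x * u x) - 2 * u x * v x * Im d) / (u x * u x + v x * v x) ^+ 2) +i*
   ((2 * u x * v x * Re d + (v x * v x - u x * u x) * Im d) / (u x * u x + v x * v x) ^+ 2).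
  have -> : f x = u x +i* v x by apply: complex_ext.
  by apply: complex_ext; rewrite invfM -mulNr !(ReM, ImM, invCE, ReN, ImN) /=; field.
split.
  rewrite (_ : (fun y => Re _) = u * (fun y => ((u * u + v * v) y)^-1)).
    apply: is_derive_eq; rewrite E /= -![_ *: _]/(_ * _).
    by rewrite -![(_ + _) x]/(u x * u x + v x * v x); field.
  by apply/funext => y; rewrite invCE.
rewrite (_ : (fun y => Im _) = - (v * (fun y => ((u * u + v * v) y)^-1))).
  apply: is_derive_eq; rewrite E /= -![_ *: _]/(_ * _).
  by rewrite -![(_ + _) x]/(u x * u x + v x * v x); field.
by apply/funext => y; rewrite invCE.
Qed.

Lemma is_derive_affine (a b x : R) : is_derive x 1 (fun y => a * y + b) a.
Proof.
rewrite (_ : (fun y => _) = (a \*: id) + cst b); last by apply/funext.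
by apply: is_derive_eq; rewrite addr0 -[_ *: _]/(_ * _) mulr1.
Qed.

Lemma cder_expC (a b : R[i]) x :
  cder (fun y => expC (a * y%:C + b)) x (a * expC (a * x%:C + b)).
Proof.
pose u (y : R) := Re a * y + Re b; pose v (y : R) := Im a * y + Im b.
have Eu y : Re (a * y%:C + b) = u y by rewrite ReD ReM /= mulr0 subr0.
have Ev y : Im (a * y%:C + b) = v y by rewrite ImD ImM /= mulr0 add0r.
have du : is_derive x 1 u (Re a) := is_derive_affine _ _ _.
have dv : is_derive x 1 v (Im a) := is_derive_affine _ _ _.
have de := @is_derive1_comp _ expR u x _ _ (is_derive_expR (u x)) du.
have dc := @is_derive1_comp _ cos v x _ _ (is_derive_cos (v x)) dv.
have ds := @is_derive1_comp _ sin v x _ _ (is_derive_sin (v x)) dv.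
split.
  rewrite (_ : (fun y => Re _) = (expR \o u) * (cos \o v)).
    apply: is_derive_eq; rewrite -![_ *: _]/(_ * _) /= ReM expCE Eu Ev /=; ring.
  by apply/funext => y; rewrite expCE Eu Ev.
rewrite (_ : (fun y => Im _) = (expR \o u) * (sin \o v)).
  apply: is_derive_eq; rewrite -![_ *: _]/(_ * _) /= ImM expCE Eu Ev /=; ring.
by apply/funext => y; rewrite expCE Eu Ev.
Qed.

(** Since E/(E - 1)^2 = ker (1 + ker), the derivative is a polynomial in the kernel and inherits its
    bounds. *)
Lemma cder_ker (a b : R[i]) x : expC (tpi * (a * x%:C + b)) - 1 != 0 ->
  cder (fun y => ker (a * y%:C + b)) x
    (a * - (tpi * ker (a * x%:C + b) * (1 + ker (a * x%:C + b)))).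
Proof.
set t := a * x%:C + b => t0.
have h : cder (fun y => expC (tpi * (a * y%:C + b)) - 1) x (tpi * a * expC (tpi * t) + 0).
  apply: cderD; last exact: cder_cst.
  apply: (@eq_cder (fun y => expC ((tpi * a) * y%:C + tpi * b))).
    by move=> y; rewrite mulrDr mulrA.
  by apply: (cder_eq (cder_expC _ _ _)); rewrite /t [tpi * (_ + _)]mulrDr mulrA.
apply: (cder_eq (cderV t0 h)); rewrite /ker; set E := expC _ in t0 *.
by field.
Qed.

Lemma cder_continuous f : (forall x, exists d, cder f x d) ->
  continuous (fun y => Re (f y)) /\ continuous (fun y => Im (f y)).
Proof.
move=> h; split => x; have [d [d1 d2]] := h x;
  by apply: differentiable_continuous; apply/derivable1_diffP; exact: ex_derive.
Qed.

End Differentiation.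

(** * The Fourier transform of the kernel *)

Section FourierTransform.
Context {R : realType}.
Import ComplexField.Normc.
Local Open Scope classical_set_scope.
Local Open Scope ring_scope.
Local Open Scope complex_scope.
Local Notation mu := (@lebesgue_measure R).
Local Notation Re := complex.Re.
Local Notation Im := complex.Im.
Local Notation tpi := (@two_pi_i R).

(** The fundamental theorem of calculus on growing intervals, followed by dominated convergence. *)
Lemma Rintegral_derive (F f : R -> R) (l m : R) :
  (forall x : R, is_derive x 1 F (f x)) -> continuous f -> intble f ->
  F x @[x --> +oo] --> l -> F x @[x --> -oo] --> m ->
  Rintegral mu setT f = l - m.
Proof.
move=> dF cf If Fl Fm.
have mf := intble_meas If.
(* The successor keeps the interval nondegenerate at [n = 0], as the fundamental theorem
   requires. *)
pose I n := `[- (n.+1%:R : R), n.+1%:R]%classic.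
pose g n x := ((f \_ (I n)) x)%:E.
have mI n : measurable (I n) by exact: measurable_itv.
have mg n : measurable_fun setT (g n).
  apply/measurable_EFinP; apply/(measurable_restrictT _ (mI n)).
  exact: measurable_funTS.
have cvg_g x : g n x @[n --> \oo] --> (f x)%:E.
  apply: cvg_near_cst; near=> n; rewrite /g patchE mem_set// /I /= in_itv/= -ler_norml.
  apply: (@le_trans _ _ n%:R); last by rewrite ler_nat.
  by near: n; exact: nbhs_infty_ger.
have dom x n : (`|g n x| <= `|(f x)%:E|)%E.
  by rewrite /g patchE; case: ifPn => // _; rewrite lee_fin normr0 normr_ge0.
have H := @dominated_cvg _ _ _ mu setT measurableT g (EFin \o f) (fun x => `|(f x)%:E|%E) mg
   (fun x _ => cvg_g x) (fun x _ => erefl) (integrable_abse If) (fun n x _ => dom x n).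
have E n : (\int[mu]_x g n x = (F n.+1%:R - F (- n.+1%:R))%:E)%E.
  transitivity (\int[mu]_(x in I n) (f x)%:E)%E.
    by rewrite [RHS]integral_mkcond /=; apply: eq_integral => x _; rewrite restrict_EFin.
  have cF : continuous F.
    by move=> x; apply: differentiable_continuous; apply/derivable1_diffP; exact: ex_derive.
  rewrite (@continuous_FTC2 _ f F)//.
  - by rewrite -subr_gt0 opprK addr_gt0.
  - exact: continuous_subspaceT.
  - split; first by move=> x _; exact: ex_derive.
      by apply: cvg_at_right_filter; exact: cF.
    by apply: cvg_at_left_filter; exact: cF.
  - by move=> x _; rewrite derive1E derive_val.
have L : (F n.+1%:R - F (- n.+1%:R))%:E @[n --> \oo] --> (l - m)%:E.
  apply: cvg_EFin; first exact: nearW.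
  have nn : (n.+1%:R : R) @[n --> \oo] --> +oo.
    apply/cvgryPge => A; near=> n; apply: (@le_trans _ _ n%:R); last by rewrite ler_nat.
    by near: n; exact: nbhs_infty_ger.
  apply: cvgB; first exact: (cvg_comp _ _ nn Fl).
  apply: (@cvg_comp _ _ _ (fun n => - (n.+1%:R : R)) F \oo (ninfty_nbhs R)); last exact: Fm.
  by apply/cvgNry; rewrite (_ : - _ = (fun n : nat => n.+1%:R : R))//; apply/funext => n /=; rewrite opprK.
rewrite /Rintegral; suff -> : (\int[mu]_x (f x)%:E = (l - m)%:E)%E by [].
have HE : (fun n => \int[mu]_x g n x)%E = (fun n => (F n.+1%:R - F (- n.+1%:R))%:E).
  by apply/funext.
rewrite HE in H; apply: (cvg_unique _ H L); exact: ereal_hausdorff.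
Unshelve. all: by end_near. Qed.

Lemma cvg_expabs (C k : R) : 0 < k ->
  C * expR (- (k * `|x|)) @[x --> +oo] --> (0 : R) /\
  C * expR (- (k * `|x|)) @[x --> -oo] --> (0 : R).
Proof.
move=> k0.
have L (F : set_system R) (FF : Filter F) : (`|x| @[x --> F] --> +oo) ->
    C * expR (- (k * `|x|)) @[x --> F] --> (0 : R).
  move=> h; rewrite -[X in _ --> X](mulr0 C); apply: cvgMr.
  apply: (@cvg_comp _ _ _ (fun x : R => k * `|x|) (fun x => expR (- x)) F (pinfty_nbhs R));
    last exact: cvgr_expR.
  exact: gt0_cvgMry.
split; apply: L; apply/cvgryPge => A; near=> x; last first.
  by rewrite -normrN; apply: (le_trans _ (ler_norm _)); rewrite lerNr; near: x; apply: nbhs_ninfty_le; exact: num_real.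
by apply: (le_trans _ (ler_norm _)); near: x; apply: nbhs_pinfty_ge; exact: num_real.
Unshelve. all: by end_near. Qed.

Lemma cint_derive (F f : R -> R[i]) (C k : R) : 0 < k ->
  (forall x : R, cder F x (f x)) -> (forall x : R, exists d, cder f x d) ->
  (forall x, normc (F x) <= C * expR (- (k * `|x|))) ->
  (forall x, normc (f x) <= C * expR (- (k * `|x|))) -> cintble f /\ cint f = 0.
Proof.
move=> k0 dF df FC fC; have [cf1 cf2] := cder_continuous df.
have [l1 l2] := cvg_expabs C k0.
have If : cintble f.
  apply: (cintble_dom _ (intbleZ C (intble_expabs k0)) fC).
  by split; exact: continuous_measurable_fun.
have sq (p : R[i] -> R) (G : set_system R) (FG : Filter G) : (forall z, `|p z| <= normc z) ->
    C * expR (- (k * `|x|)) @[x --> G] --> (0 : R) -> p (F x) @[x --> G] --> (0 : R).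
  move=> hp hG; apply: norm_cvg0.
  apply: (@squeeze_cvgr _ _ _ _ (cst 0) (fun x => C * expR (- (k * `|x|)))) => //; last exact: cvg_cst.
  by apply: nearW => x; rewrite normr_ge0 (le_trans (hp _)).
split=> //; rewrite /cint; case: If => I1 I2.
have E1 : Rintegral mu setT (fun y => Re (f y)) = 0 - 0.
  apply: (@Rintegral_derive (fun y => Re (F y))) => //.
  - by move=> x; case: (dF x).
  - by apply: sq => //; exact: Re_le_normc.
  - by apply: sq => //; exact: Re_le_normc.
have E2 : Rintegral mu setT (fun y => Im (f y)) = 0 - 0.
  apply: (@Rintegral_derive (fun y => Im (F y))) => //.
  - by move=> x; case: (dF x).
  - by apply: sq => //; exact: Im_le_normc.
  - by apply: sq => //; exact: Im_le_normc.
by rewrite E1 E2 subrr.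
Qed.

(** The integrand of the Fourier transform of the kernel at frequency [z]; [dQf z] is its derivative
    in the complex variable [t]. *)
Definition Qf (z t : R[i]) : R[i] := expC (t * z) * ker t.
Definition dQf (z t : R[i]) : R[i] := Qf z t * (z - tpi * (1 + ker t)).

Lemma cder_Q z a b x : expC (tpi * (a * x%:C + b)) - 1 != 0 ->
  cder (fun y => Qf z (a * y%:C + b)) x (a * dQf z (a * x%:C + b)).
Proof.
move=> h; have d1 : cder (fun y => expC ((a * y%:C + b) * z)) x
    (a * z * expC ((a * x%:C + b) * z)).
  have E y : (a * y%:C + b) * z = a * z * y%:C + b * z by ring.
  by apply: (@eq_cder _ (fun y => expC (a * z * y%:C + b * z))) => [y|]; rewrite E//; exact: cder_expC.
apply: (cder_eq (cderM d1 (cder_ker h))).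
by rewrite /dQf /Qf; ring.
Qed.

Lemma ptE1 (c y : R) : c +i* y = 'i * y%:C + c%:C.
Proof. by apply: complex_ext; rewrite ?ReD ?ImD ?ReM ?ImM /=; ring. Qed.

Lemma ptE2 (c y : R) : c +i* y = 1 * c%:C + 0 +i* y.
Proof. by apply: complex_ext; rewrite ?ReD ?ImD ?ReM ?ImM /=; ring. Qed.

Lemma cder_Qy z c x : -1 < c < 0 ->
  cder (fun y => Qf z (c +i* y)) x ('i * dQf z (c +i* x)).
Proof.
move=> hc; rewrite ptE1; under [X in cder X]funext do rewrite ptE1.
by apply: cder_Q; rewrite -ptE1 exp_sub1_neq0.
Qed.

Lemma cder_Qc z c y : -1 < c < 0 ->
  cder (fun x => Qf z (x +i* y)) c (dQf z (c +i* y)).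
Proof.
move=> hc; rewrite ptE2; under [X in cder X]funext do rewrite ptE2.
by rewrite -[dQf _ _]mul1r; apply: cder_Q; rewrite -ptE2 exp_sub1_neq0.
Qed.

Lemma cder_kery c x : -1 < c < 0 ->
  cder (fun y => ker (c +i* y)) x (- 'i * (tpi * ker (c +i* x) * (1 + ker (c +i* x)))).
Proof.
move=> hc; rewrite ptE1; under [X in cder X]funext do rewrite ptE1.
apply: (cder_eq (cder_ker _)); last by ring.
by rewrite -ptE1 exp_sub1_neq0.
Qed.

Lemma cder_dQy z c x : -1 < c < 0 -> exists d, cder (fun y => dQf z (c +i* y)) x d.
Proof.
move=> hc; eexists; apply: cderM; first exact: cder_Qy.
apply: cderD; first exact: cder_cst.
apply: (@eq_cder _ (fun y => - tpi * (1 + ker (c +i* y)))) => [y|]; first by rewrite mulNr.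
by apply: cderZ; apply: cderD; [exact: cder_cst|exact: cder_kery].
Qed.

Lemma normc_tpi : normc tpi = 2 * pi.
Proof.
rewrite normcE2 /= expr0n add0r sqrtr_sqr ger0_norm//.
by rewrite mulr_ge0 ?pi_ge0.
Qed.

Lemma normc_pt_exp (z : R[i]) (c y : R) :
  normc (expC ((c +i* y) * z)) = expR (c * Re z - y * Im z).
Proof. by rewrite normc_expC ReM. Qed.

(** The exponential contributes e^{-y Im z}. For 0 < Im z < 2 pi it decays where the kernel is
    merely bounded, and grows more slowly than the kernel decays at the other end. *)
Lemma Q_bound z c1 c2 : 0 < Im z < 2 * pi -> -1 < c1 -> c1 <= c2 -> c2 < 0 ->
  exists2 C, 0 < C & forall c y, c1 <= c <= c2 ->
    normc (Qf z (c +i* y)) <= C * expR (- (Num.min (Im z) (2 * pi - Im z) * `|y|)) /\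
    normc (dQf z (c +i* y)) <= C * expR (- (Num.min (Im z) (2 * pi - Im z) * `|y|)).
Proof.
move=> hz h1 h12 h2; have [M M0 hM] := normc_ker h1 h12 h2.
pose E (y : R) := expR (- (Num.min (Im z) (2 * pi - Im z) * `|y|)).
have kM c y : c1 <= c <= c2 -> normc (ker (c +i* y)) <= M.
  move=> hc; apply: (le_trans (hM c y hc)); rewrite ler_pdivrMr ?addr_gt0 ?expR_gt0//.
  by rewrite mulrDr mulr1 lerDl mulr_ge0 ?expR_ge0// ltW.
have Qb c y : c1 <= c <= c2 -> normc (Qf z (c +i* y)) <= expR `|Re z| * M * E y.
  move=> hc; rewrite /Qf normcM normc_pt_exp expRD -!mulrA ler_pM ?expR_ge0 ?mulr_ge0 ?normc_ge0 ?expR_ge0//.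
    rewrite ler_expR; apply: (le_trans (ler_norm _)); rewrite normrM.
    rewrite -[leRHS]mul1r ler_wpM2r// ler_norml.
    by case/andP: hc => ? ?; apply/andP; split; lra.
  apply: (le_trans (ler_wpM2l (expR_ge0 _) (hM c y hc))).
  rewrite mulrCA ler_wpM2l ?(ltW M0)// mulrC (mulrC _ (Im z)).
  by rewrite mulrC; exact: inv1exp_decay.
(* [N] bounds the factor z - 2 pi i (1 + ker) by which [dQf] differs from [Qf]. *)
pose N := normc z + 2 * pi * (1 + M).
have N0 : 0 <= N by rewrite addr_ge0 ?normc_ge0// mulr_ge0 ?mulr_ge0 ?pi_ge0 ?addr_ge0// ltW.
have EM0 : 0 < expR `|Re z| * M by rewrite mulr_gt0 ?expR_gt0.
exists (expR `|Re z| * M * (1 + N)); first by rewrite mulr_gt0// ltr_pwDl.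
move=> c y hc; rewrite -/(E y); have Q1 := Qb c y hc.
have E0 : 0 <= E y by exact: expR_ge0.
split.
  apply: (le_trans Q1); rewrite ler_wpM2r// ler_peMr ?(ltW EM0)//.
  by rewrite lerDl.
rewrite /dQf normcM; apply: (@le_trans _ _ (expR `|Re z| * M * E y * N)).
  apply: ler_pM; rewrite ?normc_ge0//.
  apply: (le_trans (le_normcD _ _)); rewrite lerD2l normcN normcM normc_tpi.
  rewrite ler_wpM2l ?mulr_ge0 ?pi_ge0//.
  by apply: (le_trans (le_normcD _ _)); rewrite normc1 lerD2l kM.
rewrite -mulrA [E y * N]mulrC mulrA ler_wpM2r// ler_wpM2l ?(ltW EM0)//.
by rewrite lerDr.
Qed.

Lemma kappa_gt0 (z : R[i]) : 0 < Im z < 2 * pi -> 0 < Num.min (Im z) (2 * pi - Im z).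
Proof. by move=> /andP[h1 h2]; rewrite lt_min h1 subr_gt0. Qed.

Lemma cintble_Q z c : 0 < Im z < 2 * pi -> -1 < c < 0 -> cintble (fun y => Qf z (c +i* y)).
Proof.
move=> hz hc; have [C C0 h] : _ := Q_bound hz (proj1 (andP hc)) (lexx c) (proj2 (andP hc)).
apply: (cintble_dom _ (intbleZ C (intble_expabs (kappa_gt0 hz)))); last first.
  by move=> y; case: (h c y (ltac:(by rewrite lexx))).
have [c1 c2] : _ := cder_continuous (fun x => ex_intro _ _ (cder_Qy z x hc)).
by split; exact: continuous_measurable_fun.
Qed.

(** ['i * dQf] is the derivative of [Qf] along the line, and [Qf] vanishes at both ends. *)
Lemma cint_dQ z c : 0 < Im z < 2 * pi -> -1 < c < 0 ->
  cintble (fun y => dQf z (c +i* y)) /\ cint (fun y => dQf z (c +i* y)) = 0.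
Proof.
move=> hz hc; have [C C0 h] : _ := Q_bound hz (proj1 (andP hc)) (lexx c) (proj2 (andP hc)).
have hcc : c <= c <= c by rewrite lexx.
have ni : normc ('i : R[i]) = 1 by rewrite normcE2 /= expr0n expr1n add0r sqrtr1.
have [I1 I2] : _ := @cint_derive (fun y => Qf z (c +i* y)) (fun y => 'i * dQf z (c +i* y)) C _
  (kappa_gt0 hz) (fun x => cder_Qy z x hc)
  (fun x => let: ex_intro d hd := cder_dQy z x hc in ex_intro _ _ (cderZ 'i hd))
  (fun y => (h c y hcc).1)
  (fun y => ltac:(by rewrite normcM ni mul1r; exact: (h c y hcc).2)).
have i0 : ('i : R[i]) != 0 by rewrite -normc_eq0 ni oner_neq0.
have E : (fun y => dQf z (c +i* y)) = (fun y => 'i^-1 * ('i * dQf z (c +i* y))).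
  by apply/funext => y; rewrite mulKf.
by rewrite E; split; [exact: cintbleZ|rewrite cintZ// I2 mulr0].
Qed.

(** By holomorphy the derivative in the abscissa is, up to ['i], the derivative along the line, so
    its integral vanishes. Differentiation under the integral and the mean value theorem then give
    constancy. *)
Lemma cint_Q_const z a b : 0 < Im z < 2 * pi -> -1 < a -> a < b -> b < 0 ->
  cint (fun y => Qf z (a +i* y)) = cint (fun y => Qf z (b +i* y)).
Proof.
move=> hz ha hab hb.
(* Midpoints between -1 and [a] and between [b] and 0: an open neighbourhood of [a, b] whose closure
   stays inside the strip. *)
pose c1 := (a - 1) / 2; pose c2 := b / 2.
have k1 : -1 < c1 by rewrite /c1; lra.
have k2 : c1 <= c2 by rewrite /c1 /c2; lra.
have k3 : c2 < 0 by rewrite /c2; lra.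
have [C C0 h] := Q_bound hz k1 k2 k3.
have {}h c y : c \in `]c1, c2[ -> _ := fun hc => h c y
  (ltac:(by move: hc; rewrite in_itv/= /c1 /c2 => /andP[/ltW -> /ltW ->])).
have hI c : c \in `]c1, c2[ -> -1 < c < 0.
  by rewrite in_itv/= /c1 /c2 => /andP[? ?]; apply/andP; split; lra.
have G0 (y : R) : 0 <= C * expR (- (Num.min (Im z) (2 * pi - Im z) * `|y|)).
  by rewrite mulr_ge0 ?expR_ge0// ltW.
have IG := intbleZ C (intble_expabs (kappa_gt0 hz)).
(* [p] stands for the real or the imaginary part, so that one argument covers both. *)
have key (p : R[i] -> R) : (forall z, `|p z| <= normc z) ->
    (forall f, cintble f -> intble (fun y => p (f y))) ->
    (forall f x d, cder f x d -> is_derive x 1 (fun y => p (f y)) (p d)) ->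
    (forall c, -1 < c < 0 -> Rintegral mu setT (fun y => p (dQf z (c +i* y))) = 0) ->
    Rintegral mu setT (fun y => p (Qf z (a +i* y))) =
    Rintegral mu setT (fun y => p (Qf z (b +i* y))).
  move=> pn pI pd p0.
  pose f c y := p (Qf z (c +i* y)).
  have df c y : c \in `]c1, c2[ -> is_derive c 1 (f ^~ y) (p (dQf z (c +i* y))).
    by move=> hc; apply: pd; apply: cder_Qc; exact: hI.
  have pE c y : c \in `]c1, c2[ -> partial1of2 f c y = p (dQf z (c +i* y)).
    by move=> hc; have := @derive_val _ _ _ _ _ _ _ (df c y hc); by rewrite partial1of2E.
  have If c : c \in `]c1, c2[ -> intble (f c).
    by move=> hc; apply: pI; apply: cintble_Q => //; exact: hI.
  have dub c y : c \in `]c1, c2[ -> `|partial1of2 f c y| <=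
      C * expR (- (Num.min (Im z) (2 * pi - Im z) * `|y|)).
    by move=> hc; rewrite pE//; apply: (le_trans (pn _)); case: (h c y hc).
  have dfd c y : c \in `]c1, c2[ -> derivable (f ^~ y) c 1.
    by move=> /df hc; exact: (@ex_derive _ _ _ _ _ _ _ (hc y)).
  pose F c := Rintegral mu setT (f c).
  have dF c : c \in `]c1, c2[ -> is_derive c 1 F 0.
    move=> hc; have := @differentiation_under_integral R _ _ mu f setT measurableT c c1 c2 hc
      If (fun c y hc _ => dfd c y hc) _ G0 IG (fun c y hc _ => dub c y hc).
    have := @derivable_under_integral R _ _ mu f setT measurableT c c1 c2 hc
      If (fun c y hc _ => dfd c y hc) _ G0 IG (fun c y hc _ => dub c y hc).
    move=> D E; apply: DeriveDef => //; rewrite -derive1E E.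
    rewrite -[RHS](p0 c (hI c hc)); apply: eq_Rintegral => y _; exact: pE.
  have sub c : c \in `[a, b] -> c \in `]c1, c2[.
    by rewrite !in_itv/= /c1 /c2 => /andP[? ?]; apply/andP; split; lra.
  have [|c _ ] := @MVT R F (cst 0) a b hab (fun c hc => dF c (sub c (subset_itv_oo_cc hc))).
    apply: derivable_within_continuous => c /sub /dF hc; exact: (@ex_derive _ _ _ _ _ _ _ hc).
  by rewrite /cst mul0r => /eqP; rewrite subr_eq0 => /eqP.
have p0 c (hc : -1 < c < 0) := (cint_dQ hz hc).2.
rewrite /cint; congr (_ +i* _); apply: key.
- exact: Re_le_normc.
- by move=> f [].
- by move=> f x d [].
- by move=> c /p0 /(congr1 (@complex.Re R)).
- exact: Im_le_normc.
- by move=> f [].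
- by move=> f x d [].
- by move=> c /p0 /(congr1 (@complex.Im R)).
Qed.

End FourierTransform.

(** * Evaluation of the Fourier integral by halving the frequency *)

Section FourierFormula.
Context {R : realType}.
Import ComplexField.Normc.
Local Open Scope classical_set_scope.
Local Open Scope ring_scope.
Local Open Scope complex_scope.
Local Notation mu := (@lebesgue_measure R).
Local Notation Re := complex.Re.
Local Notation Im := complex.Im.
Local Notation tpi := (@two_pi_i R).

Definition ccvg (u : nat -> R[i]) (l : R[i]) :=
  (Re (u n) @[n --> \oo] --> Re l) /\ (Im (u n) @[n --> \oo] --> Im l).

Lemma ccvgM u v l m : ccvg u l -> ccvg v m -> ccvg (fun n => u n * v n) (l * m).
Proof.
move=> [u1 u2] [v1 v2]; split.
  rewrite ReM (_ : (fun n => Re _) = (fun n => Re (u n) * Re (v n) - Im (u n) * Im (v n))).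
    by apply: cvgB; exact: cvgM.
  by apply/funext => n; rewrite ReM.
rewrite ImM (_ : (fun n => Im _) = (fun n => Re (u n) * Im (v n) + Im (u n) * Re (v n))).
  by apply: cvgD; exact: cvgM.
by apply/funext => n; rewrite ImM.
Qed.

Lemma ccvg_cst c : ccvg (fun _ => c) c.
Proof. by split; exact: cvg_cst. Qed.

Lemma ccvg_unique u l m : ccvg u l -> ccvg u m -> l = m.
Proof.
move=> [u1 u2] [v1 v2]; apply: complex_ext.
  by apply: (cvg_unique _ u1 v1); exact: Rhausdorff.
by apply: (cvg_unique _ u2 v2); exact: Rhausdorff.
Qed.

Lemma eq_ccvg u v l : (forall n, u n = v n) -> ccvg u l -> ccvg v l.
Proof. by move=> /funext ->. Qed.

Lemma Rintegral_dct (f : nat -> R -> R) (g h : R -> R) :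
  (forall n, measurable_fun setT (f n)) -> intble h ->
  (forall x, f n x @[n --> \oo] --> g x) -> (forall n x, `|f n x| <= h x) ->
  Rintegral mu setT (f n) @[n --> \oo] --> Rintegral mu setT g.
Proof.
move=> mf Ih fg fh.
have mE n : measurable_fun setT (EFin \o f n) by exact/measurable_EFinP.
have c x : setT x -> (EFin \o f n) x @[n --> \oo] --> (EFin \o g) x.
  by move=> _; apply: cvg_EFin; [exact: nearW|exact: fg].
have mg : measurable_fun setT (EFin \o g) by apply: emeasurable_fun_cvg c => n; exact: mE.
have d n x : setT x -> (`|(EFin \o f n) x| <= (EFin \o h) x)%E.
  by move=> _ /=; rewrite lee_fin.
have Ig : intble g.
  apply: (le_intble _ Ih) => [|x]; first exact/measurable_EFinP.
  apply: (ler_cvg_to (cvg_norm (fg x)) (cvg_cst (h x))).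
  by apply: nearW => n; exact: fh.
have H := @dominated_cvg _ _ _ mu setT measurableT (fun n => EFin \o f n)
  (EFin \o g) (EFin \o h) mE c (fun x _ => erefl) Ih d.
apply: fine_cvg; rewrite fineK; first exact: H.
exact: (integrable_fin_num measurableT Ig).
Qed.

Lemma cint_dct (F : nat -> R -> R[i]) (f : R -> R[i]) (h : R -> R) :
  (forall n, cmeas (F n)) -> intble h ->
  (forall x, ccvg (F ^~ x) (f x)) -> (forall n x, normc (F n x) <= h x) ->
  ccvg (fun n => cint (F n)) (cint f).
Proof.
move=> mF Ih Ff Fh; split => /=; apply: (Rintegral_dct _ Ih).
- by move=> n; case: (mF n).
- by move=> x; case: (Ff x).
- by move=> n x; exact: le_trans (Re_le_normc _) (Fh n x).
- by move=> n; case: (mF n).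
- by move=> x; case: (Ff x).
- by move=> n x; exact: le_trans (Im_le_normc _) (Fh n x).
Qed.

(** On the middle line of the strip the kernel is real, which makes the limiting integral
    explicit. *)
Let h : R := - (1 / 2).

Let hh : -1 < h < 0.
Proof. by rewrite /h; apply/andP; split; lra. Qed.

Definition Jf (z : R[i]) : R[i] := 'i * cint (fun y => Qf z (h +i* y)).

Lemma cint_QE z c : 0 < Im z < 2 * pi -> -1 < c < 0 ->
  cint (fun y => Qf z (c +i* y)) = cint (fun y => Qf z (h +i* y)).
Proof.
move=> hz /andP[c1 c2]; have /andP[h1 h2] := hh.
have [ch|hc|->//] := ltgtP c h; first exact: cint_Q_const.
by apply/esym; apply: cint_Q_const.
Qed.

Lemma realcE (a b : R) : a%:C * b%:C = (a * b)%:C.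
Proof. by rewrite -rmorphM. Qed.

Lemma Im_scale (a : R) (z : R[i]) : Im (a%:C * z) = a * Im z.
Proof. by rewrite ImM /= mul0r addr0. Qed.

Lemma Re_scale (a : R) (z : R[i]) : Re (a%:C * z) = a * Re z.
Proof. by rewrite ReM /= mul0r subr0. Qed.

(** Partial fractions 2/(E^2 - 1) = 1/(E - 1) - 1/(E + 1), where translating [t] by 1/2 replaces E
    by -E. *)
Lemma ker_half (t : R[i]) : expC (tpi * t) - 1 != 0 ->
  expC (tpi * (t + (1 / 2)%:C)) - 1 != 0 ->
  2 * ker (2 * t) = ker t + ker (t + (1 / 2)%:C).
Proof.
have -> : expC (tpi * (t + (1 / 2)%:C)) = - expC (tpi * t).
  rewrite mulrDr expCD; have -> : tpi * (1 / 2)%:C = 0 +i* pi.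
    by apply: complex_ext; rewrite ?ReM ?ImM /=; field.
  by rewrite expC_pi_i mulrN1.
move=> n1 n2; rewrite /ker.
have -> : expC (tpi * (t + (1 / 2)%:C)) = - expC (tpi * t).
  rewrite mulrDr expCD; have -> : tpi * (1 / 2)%:C = 0 +i* pi.
    by apply: complex_ext; rewrite ?ReM ?ImM /=; field.
  by rewrite expC_pi_i mulrN1.
have -> : expC (tpi * (2 * t)) = expC (tpi * t) * expC (tpi * t).
  by rewrite -expCD; congr expC; ring.
set E := expC _ in n1 n2 *.
have n3 : E * E - 1 != 0.
  by rewrite (_ : E * E - 1 = - ((E - 1) * (- E - 1))) ?oppr_eq0 ?mulf_neq0//; ring.
by field; rewrite n1 n2 n3.
Qed.

(** Substituting t -> 2t and applying [ker_half] splits the integral into integrals over two other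
    lines of the strip, each with the value of the middle line. The resulting equation is the one
    satisfied by 1/(e^z - 1). *)
Lemma Jf_half z : 0 < Im z < 2 * pi ->
  Jf ((1 / 2)%:C * z) = Jf z * (1 + expC ((1 / 2)%:C * z)).
Proof.
move=> hz; set z2 := _ * z; have z2E : z = 2 * z2.
  by apply: complex_ext; rewrite ?ReM ?ImM ?Re_scale ?Im_scale /=; field.
have hz2 : 0 < Im z2 < 2 * pi by rewrite Im_scale; apply/andP; split; case/andP: hz => ? ?; lra.
pose c1 : R := - (1 / 4); pose c3 : R := - (3 / 4).
have hc1 : -1 < c1 < 0 by rewrite /c1; apply/andP; split; lra.
have hc3 : -1 < c3 < 0 by rewrite /c3; apply/andP; split; lra.
(* The middle line is twice the line at -1/4, and the translate -1/4 + 1/2 is brought back to -3/4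
   by the period 1; that last move produces the factor e^{z/2}. *)
have P y : 2 * Qf z2 (h +i* (2 * y + 0)) = Qf z (c1 +i* y) + expC z2 * Qf z (c3 +i* y).
  set t := c1 +i* y.
  have E1 : h +i* (2 * y + 0) = 2 * t.
    by rewrite /h /t /c1; apply: complex_ext; rewrite ?ReM ?ImM /=; field.
  have E3 : t + (1 / 2)%:C = (c3 +i* y) + 1.
    by rewrite /t /c1 /c3; apply: complex_ext; rewrite ?ReD ?ImD /=; field.
  have n1 : expC (tpi * t) - 1 != 0 by exact: exp_sub1_neq0.
  have n3 : expC (tpi * (t + (1 / 2)%:C)) - 1 != 0.
    by rewrite E3 mulrDr mulr1 expCD expC_tpi mulr1; exact: exp_sub1_neq0.
  have K := ker_half n1 n3; rewrite E3 kerD1 in K.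
  rewrite /Qf E1 mulrCA K mulrDr; congr (_ * _ + _).
    by congr expC; rewrite z2E; ring.
  rewrite mulrA -expCD; congr (expC _ * _).
  have -> : c3 +i* y = t - (1 / 2)%:C.
    by rewrite /t /c1 /c3; apply: complex_ext; rewrite ?ReD ?ImD ?ReN ?ImN /=; field.
  by rewrite /z2; apply: complex_ext; rewrite !(ReD, ImD, ReM, ImM, ReN, ImN) /=; field.
have I1 := cintble_Q hz hc1; have I3 := cintble_Q hz hc3; have I2 := cintble_Q hz2 hh.
have n2 : (2 : R) != 0 by rewrite pnatr_eq0.
have := cintD I1 (cintbleZ (expC z2) I3).
rewrite cintZ// !cint_QE// => E.
have : cint (fun y => 2 * Qf z2 (h +i* (2 * y + 0))) = cint (fun y => Qf z2 (h +i* y)).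
  have Ia := cintble_affine (f := fun y => Qf z2 (h +i* y)) 0 n2 I2.
  rewrite cintZ// (cint_affine (f := fun y => Qf z2 (h +i* y)) 0 n2 I2) mulrA.
  rewrite (_ : 2 * _ = 1) ?mul1r// ger0_norm//.
  by rewrite (_ : 2 = (2 : R)%:C) ?realcE ?mulfV// rmorph_nat.
rewrite (eq_cint P) E /Jf => <-; ring.
Qed.

(** Because (e^{z/2} - 1)(e^{z/2} + 1) = e^z - 1, the product (e^z - 1) J(z) is unchanged by halving
    z, so its behaviour at 0 determines it. *)
Lemma Jf_psi_half z n : 0 < Im z < 2 * pi ->
  (expC z - 1) * Jf z = (expC (((1 / 2) ^+ n)%:C * z) - 1) * Jf (((1 / 2) ^+ n)%:C * z).
Proof.
move=> hz; elim: n => [|n IH]; first by rewrite expr0 mul1r.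
rewrite {}IH; set w := _ * z; rewrite exprS -realcE -mulrA -/w.
have hw : 0 < Im w < 2 * pi.
  rewrite Im_scale; case/andP: hz => z1 z2; apply/andP; split.
    by rewrite mulr_gt0// exprn_gt0//; lra.
  apply: le_lt_trans z2; rewrite ler_piMl ?(ltW z1)// exprn_ile1//; lra.
rewrite (Jf_half hw); set w2 := _ * w; have -> : expC w = expC w2 * expC w2.
  by rewrite -expCD; congr expC; apply: complex_ext; rewrite !(ReD, ImD, Re_scale, Im_scale); field.
ring.
Qed.

Let Hf (z : R[i]) (y : R) : R[i] := tpi * (1 + ker (h +i* y)) * Qf z (h +i* y).

(** Integration by parts. The new integrand has a dominated limit as z tends to 0, since 1 + ker
    decays at the end where ker does not. *)
Lemma cint_QH z : 0 < Im z < 2 * pi ->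
  z * cint (fun y => Qf z (h +i* y)) = cint (Hf z).
Proof.
move=> hz; have [I0 E] := cint_dQ hz hh; have IQ := cintble_Q hz hh.
have HE y : Hf z y = z * Qf z (h +i* y) + (-1) * dQf z (h +i* y).
  by rewrite /Hf /dQf; ring.
rewrite (eq_cint HE) cintD ?cintZ ?E ?mulr0 ?addr0//; exact: cintbleZ.
Qed.

Lemma ker_h y : ker (h +i* y) = (- (1 + expR (- (2 * pi * y)))^-1)%:C.
Proof.
rewrite /ker tpi_pt expCE /= (_ : 2 * pi * h = - pi); last by rewrite /h; field.
rewrite cosN sinN cospi sinpi.
have p0 : 1 + expR (- (2 * pi * y)) != 0 by rewrite gt_eqF// addr_gt0 ?expR_gt0.
set r := expR _ in p0 *.
rewrite (_ : _ - 1 = (- (1 + r))%:C); last by apply: complex_ext; rewrite ?ReD ?ImD /=; ring.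
by rewrite -fmorphV invrN.
Qed.

Lemma ker_h_bound y : normc (tpi * (1 + ker (h +i* y)) * ker (h +i* y)) <=
  2 * pi * expR (- (2 * pi * `|y|)).
Proof.
rewrite !normcM normc_tpi -mulrA ler_wpM2l ?mulr_ge0 ?pi_ge0// ker_h.
have r0 : 0 < expR (- (2 * pi * y)) by exact: expR_gt0.
set r := expR _ in r0 *.
have -> : 1 + (- (1 + r)^-1)%:C = (r / (1 + r))%:C :> R[i].
  rewrite -[1]/((1 : R)%:C) -rmorphD; congr (_%:C); field; rewrite gt_eqF//; lra.
have a1 : 0 <= r / (1 + r) by rewrite divr_ge0 ?addr_ge0 ?(ltW r0).
have a2 : 0 <= (1 + r)^-1 by rewrite invr_ge0 addr_ge0 ?(ltW r0).
rewrite !normc_real normrN (ger0_norm a1) (ger0_norm a2).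
have q0 : 0 < (1 + r) * (1 + r) by rewrite mulr_gt0// addr_gt0.
rewrite [leLHS](_ : _ = r / ((1 + r) * (1 + r))); last first.
  by field; rewrite gt_eqF// addr_gt0.
rewrite ler_pdivrMr//.
have [y0|y0] := leP 0 y.
  rewrite ger0_norm// -/r ler_peMr ?(ltW r0)//; nra.
rewrite ltr0_norm// mulrN opprK -[2 * pi * y]opprK expRN -/r ler_pdivlMl//; nra.
Qed.

(** Up to the factor [- 'i] the integrand is the logistic density, the derivative of [F], of total
    mass 1. *)
Lemma cint_H0 : cint (fun y => tpi * (1 + ker (h +i* y)) * ker (h +i* y)) = - 'i.
Proof.
pose f y : R := 2 * pi * (expR (- (2 * pi * y)) / (1 + expR (- (2 * pi * y))) ^+ 2).
have p0 (y : R) : 0 < 1 + expR (- (2 * pi * y)) by rewrite addr_gt0 ?expR_gt0.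
have E y : tpi * (1 + ker (h +i* y)) * ker (h +i* y) = (- 'i) * (f y)%:C.
  rewrite ker_h /f; set r := expR _.
  have r0 : 1 + r != 0 by rewrite gt_eqF ?p0.
  by apply: complex_ext; rewrite !(ReM, ImM, ReD, ImD, ReN, ImN) /=; field.
pose F y : R := (1 + expR (- (2 * pi * y)))^-1.
have dE (x : R) : is_derive x 1 (fun y : R => 1 + expR (- (2 * pi * y)))
   (- (2 * pi) * expR (- (2 * pi * x))).
  have da : is_derive x 1 (fun y : R => - (2 * pi) * y + 0) (- (2 * pi)) := is_derive_affine _ _ _.
  have de := @is_derive1_comp _ expR _ x _ _ (is_derive_expR _) da.
  rewrite (_ : (fun y => _) = cst 1 + (expR \o (fun y : R => - (2 * pi) * y + 0))).
    by apply: is_derive_eq; rewrite add0r addr0 (mulNr (2 * pi) x) mulrC.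
  by apply/funext => y /=; rewrite -[RHS]/(1 + expR (- (2 * pi) * y + 0)) addr0 mulNr.
have dF (x : R) : is_derive x 1 F (f x).
  apply: is_derive_eq (is_deriveV _ (dE x)) _; first by rewrite gt_eqF ?p0.
  rewrite /f -[_ *: _]/(_ * _); set r := expR _.
  by have r0 : 1 + r != 0 by [rewrite gt_eqF ?p0]; field.
have f0 y : 0 <= f y.
  by rewrite mulr_ge0 ?mulr_ge0 ?pi_ge0// divr_ge0 ?expR_ge0// sqr_ge0.
have k0 : 0 < 2 * pi :> R by rewrite mulr_gt0 ?pi_gt0.
have fb y : `|f y| <= 2 * pi * expR (- (2 * pi * `|y|)).
  have := ker_h_bound y; rewrite E normcM normcN normc_real.
  by rewrite (_ : normc 'i = 1) ?mul1r// normcE2 /= expr0n expr1n add0r sqrtr1.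
have cf : continuous f.
  move=> x; apply: differentiable_continuous; apply/derivable1_diffP.
  have dV := @ex_derive _ _ _ _ _ _ _ (dF x).
  (* The logistic equation gives differentiability of [f] from that of [F]. *)
  rewrite (_ : f = (2 * pi) \*: (F - F * F)).
    by apply: derivableZ; apply: derivableB => //; exact: derivableM.
  apply/funext => y; rewrite -[RHS]/((2 * pi) * (F y - F y * F y)) /f /F.
  by have := p0 y; set r := expR _ => r0; field; rewrite gt_eqF.
have If : intble f.
  apply: (le_intble _ (intbleZ (2 * pi) (intble_expabs k0)) fb).
  exact: continuous_measurable_fun.
have Fy : F x @[x --> +oo] --> (1 : R).
  rewrite -[X in _ --> X]invr1; apply: cvgV; rewrite ?oner_neq0//.
  rewrite -[X in _ --> X]addr0; apply: cvgD; first exact: cvg_cst.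
  apply: (@cvg_comp _ _ _ (fun x : R => 2 * pi * x) (fun x => expR (- x)) _ (pinfty_nbhs R));
    last exact: cvgr_expR.
  by apply: gt0_cvgMry => //; exact: cvg_id.
have FNy : F x @[x --> -oo] --> (0 : R).
  have [_ l2] := cvg_expabs 1 k0.
  apply: norm_cvg0.
  apply: (@squeeze_cvgr _ _ _ _ (cst 0) (fun x => 1 * expR (- (2 * pi * `|x|)))); last exact: l2.
    near=> x; rewrite normr_ge0 /= mul1r ger0_norm ?invr_ge0 ?(ltW (p0 _))// ltr0_norm; last first.
      by near: x; apply: nbhs_ninfty_lt; exact: num_real.
    rewrite mulrN opprK -[2 * pi * x]opprK expRN lef_pV2 ?posrE ?expR_gt0//.
    by rewrite lerDr.
  exact: cvg_cst.
have V := Rintegral_derive dF cf If Fy FNy.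
have Ic : cintble (fun y => (f y)%:C) by split => //=; exact: integrable0.
rewrite (eq_cint E) cintZ// /cint /= V subr0.
by rewrite /Rintegral integral0 /=; apply: complex_ext; rewrite !(ReM, ImM, ReN, ImN) /=; ring.
Unshelve. all: by end_near. Qed.

Lemma cvg_half : ((1 / 2 : R) ^+ n) @[n --> \oo] --> (0 : R).
Proof. by apply: cvg_expr; rewrite ger0_norm; lra. Qed.

Lemma ccvg_expC (w : R[i]) : ccvg (fun n => expC (((1 / 2) ^+ n)%:C * w)) 1.
Proof.
have [c1 c2] := cder_continuous (fun x => ex_intro _ _ (cder_expC w 0 x)).
have E (x : R) : x%:C * w = w * x%:C + 0 by rewrite addr0 mulrC.
have E0 : (1 : R[i]) = expC (w * (0 : R)%:C + 0) by rewrite mulr0 addr0 expC0.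
split; rewrite E0.
  under eq_fun do rewrite E.
  exact: (cvg_comp _ _ cvg_half (c1 0)).
under eq_fun do rewrite E.
exact: (cvg_comp _ _ cvg_half (c2 0)).
Qed.

Lemma ccvg_expC_quot (z : R[i]) :
  ccvg (fun n => (expC (((1 / 2) ^+ n)%:C * z) - 1) * (((1 / 2) ^+ n)^-1)%:C) z.
Proof.
have [d1 d2] := cder_expC z 0 0.
have s0 n : (1 / 2 : R) ^+ n != 0 by rewrite expf_neq0//; lra.
have E (x : R) : x%:C * z = z * x%:C + 0 by rewrite addr0 mulrC.
have E0 : expC (z * (0 : R)%:C + 0) = 1 by rewrite mulr0 addr0 expC0.
have key (p : R[i] -> R) : (forall a b, p (a - b) = p a - p b) ->
   (forall a (b : R), p (a * b%:C) = p a * b) ->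
   is_derive (0 : R) 1 (fun y : R => p (expC (z * y%:C + 0))) (p (z * expC (z * 0%:C + 0))) ->
   p ((expC (((1 / 2) ^+ n)%:C * z) - 1) * (((1 / 2) ^+ n)^-1)%:C) @[n --> \oo] --> p z.
  move=> pB pZ [D V]; rewrite E0 mulr1 in V.
  have /cvg_ex[l Hl] := D.
  have lV : l = p z by rewrite -V; apply/esym/cvg_lim.
  rewrite lV in Hl.
  have A : (forall n, (1 / 2 : R) ^+ n != 0) /\ ((1 / 2 : R) ^+ n @[n --> \oo] --> (0 : R)).
    by split; [exact: s0|exact: cvg_half].
  move/cvgr_dnbhsP : Hl => /(_ _ A); apply: cvg_trans; apply: near_eq_cvg; near=> n.
  rewrite /= pZ pB E addr0 scaler1 -[_ *: _]/(_ * _) mulrC -E0.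
  by rewrite !addr0.
split; [apply: key d1|apply: key d2].
- by move=> a b; rewrite ReD ReN.
- by move=> a b; rewrite ReM /= mulr0 subr0.
- by move=> a b; rewrite ImD ImN.
- by move=> a b; rewrite ImM /= mulr0 add0r.
Unshelve. all: by end_near. Qed.

Lemma Jf_limit z : 0 < Im z < 2 * pi ->
  ccvg (fun n => ((1 / 2) ^+ n)%:C * z * Jf (((1 / 2) ^+ n)%:C * z)) 1.
Proof.
move=> hz; have s1 n : 0 < (1 / 2 : R) ^+ n <= 1.
  by rewrite exprn_gt0 ?exprn_ile1//; lra.
have hzn n : 0 < Im (((1 / 2) ^+ n)%:C * z) < 2 * pi.
  rewrite Im_scale; case/andP: hz => z1 z2; have /andP[a1 a2] := s1 n; apply/andP; split.
    by rewrite mulr_gt0.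
  by apply: le_lt_trans z2; rewrite ler_piMl ?(ltW z1).
have E n : ((1 / 2) ^+ n)%:C * z * Jf (((1 / 2) ^+ n)%:C * z) =
   'i * cint (Hf (((1 / 2) ^+ n)%:C * z)).
  by rewrite -(cint_QH (hzn n)) /Jf mulrCA.
apply: (eq_ccvg (fun n => esym (E n))).
have -> : 1 = 'i * (- 'i) :> R[i] by apply: complex_ext; rewrite !(ReM, ImM, ReN, ImN) /=; ring.
apply: ccvgM; first exact: ccvg_cst.
rewrite -cint_H0.
(* The kernel factor decays at rate 2 pi and the exponential grows at rate at most Im z, uniformly
   in [n] because the scaling is at most 1. *)
pose k := 2 * pi - Im z.
have k0 : 0 < k by rewrite subr_gt0; case/andP: hz.
pose M := 2 * pi * expR `|Re z|.
apply: (cint_dct (h := fun y => M * expR (- (k * `|y|)))).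
- move=> n; have [_ _] := cint_dQ (hzn n) hh.
  apply: cmeasM; last exact: cintble_meas (cintble_Q (hzn n) hh).
  apply: cmeasM; first exact: cmeas_cst.
  apply: cmeasD; first exact: cmeas_cst.
  have [c1 c2] := cder_continuous (fun x => ex_intro _ _ (cder_kery x hh)).
  by split; exact: continuous_measurable_fun.
- exact: intbleZ (intble_expabs k0).
- move=> y; rewrite /Hf /Qf.
  apply: (@eq_ccvg (fun n => expC (((1 / 2) ^+ n)%:C * ((h +i* y) * z)) *
    (tpi * (1 + ker (h +i* y)) * ker (h +i* y)))).
    by move=> n; rewrite [in RHS]mulrCA [((1 / 2) ^+ n)%:C * _]mulrCA.
  by rewrite -[X in ccvg _ X]mul1r; apply: ccvgM; [exact: ccvg_expC|exact: ccvg_cst].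
- move=> n y; rewrite /Hf /Qf mulrCA normcM.
  have /andP[a1 a2] := s1 n.
  have B := ker_h_bound y.
  apply: (le_trans (ler_wpM2l (normc_ge0 _) B)); rewrite normc_pt_exp Re_scale Im_scale.
  rewrite /M mulrCA -[leRHS]mulrA ler_wpM2l ?mulr_ge0 ?pi_ge0//.
  rewrite -!expRD ler_expR.
  set s := (1 / 2) ^+ n in a1 a2 *.
  have b1 : h * (s * Re z) <= `|Re z|.
    apply: (le_trans (ler_norm _)); rewrite !normrM.
    rewrite mulrA -[leRHS]mul1r ler_wpM2r// (gtr0_norm a1).
    by rewrite /h normrN ger0_norm; [nra|lra].
  have b2 : - (y * (s * Im z)) <= `|y| * Im z.
    apply: (le_trans (ler_norm _)); rewrite normrN !normrM ler_wpM2l//.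
    case/andP: hz => z1 _; rewrite (gtr0_norm a1) (gtr0_norm z1).
    by rewrite ler_piMl ?(ltW z1).
  rewrite /k mulrBl opprB; move: b1 b2; lra.
Qed.

Theorem fourier_ker (z : R[i]) (c : R) : 0 < Im z < 2 * pi -> -1 < c < 0 ->
  'i * cint (fun y => expC ((c +i* y) * z) * ker (c +i* y)) = (expC z - 1)^-1.
Proof.
move=> hz hc.
have z0 : z != 0 by apply/eqP => E; move: hz; rewrite E /= ltxx.
have -> : 'i * cint (fun y => expC ((c +i* y) * z) * ker (c +i* y)) = Jf z.
  by rewrite /Jf -(cint_QE hz hc).
(* The extra [z] makes the product split, for s = 2^{-n}, into (e^{s z} - 1)/s, which tends to z,
   and s z J(s z), which tends to 1. *)
suff : z * ((expC z - 1) * Jf z) = z.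
  by rewrite -[RHS]mulr1 => /(mulfI z0) /mulr1_eq.
apply: (ccvg_unique (ccvg_cst _)).
rewrite -[X in ccvg _ X]mulr1.
apply: eq_ccvg (ccvgM (ccvg_expC_quot z) (Jf_limit hz)) => n.
rewrite (Jf_psi_half n hz).
have s0 : ((1 / 2 : R) ^+ n)%:C != 0.
  by rewrite fmorph_eq0 expf_neq0//; lra.
rewrite fmorphV; field.
exact: s0.
Qed.

End FourierFormula.

(** * Weighted convolution algebra of densities *)

Section LineFunctions.
Context {R : realType}.
Import ComplexField.Normc.
Local Open Scope complex_scope.
Local Notation mu := (@lebesgue_measure R).
Local Notation Re := complex.Re.
Local Notation Im := complex.Im.
Local Notation tpi := (@two_pi_i R).

Definition wt (b y : R) : R[i] := (expR (- (b * y)))%:C.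

Lemma expC_real (x : R) : expC x%:C = (expR x)%:C.
Proof. by rewrite expCE /= cos0 sin0 mulr1 mulr0. Qed.

Lemma wtD b : {morph wt b : x y / x + y >-> x * y}.
Proof. by move=> x y; rewrite /wt realcE -expRD mulrDr opprD. Qed.

Lemma wt_neq0 b x : wt b x != 0.
Proof. by rewrite fmorph_eq0 gt_eqF// expR_gt0. Qed.

Lemma normc_wt b x : normc (wt b x) = expR (- (b * x)).
Proof. by rewrite normc_real ger0_norm// expR_ge0. Qed.

Lemma cmeas_cder (f : R -> R[i]) : (forall x, exists d, cder f x d) -> cmeas f.
Proof.
by move=> h; have [c1 c2] := cder_continuous h; split; exact: continuous_measurable_fun.
Qed.

Lemma cmeas_expC_lin (a : R[i]) : cmeas (fun y : R => expC (a * y%:C)).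
Proof.
apply: cmeas_cder => x; eexists; apply: (@eq_cder _ (fun y => expC (a * y%:C + 0))).
  by move=> y; rewrite addr0.
exact: cder_expC.
Qed.

(** All weights are required at once: a convolution is controlled at each fixed weight, while
    transforms use the whole range as their argument runs through the strip. *)
Definition Wt (f : R -> R[i]) :=
  cmeas f /\ forall b, 0 < b < 2 * pi -> bL1 (fun y => wt b y * f y).

Lemma bL1_normE (f g : R -> R[i]) : cmeas f -> bL1 g ->
  (forall x, normc (f x) = normc (g x)) -> bL1 f.
Proof.
move=> mf [mg [M gM] Ig] E; split => //; first by exists M => x; rewrite E.
by rewrite (_ : (fun x => _) = (fun x => normc (g x)))//; apply/funext.
Qed.

Lemma two_pi_gt0 : 0 < 2 * (pi : R).
Proof. by rewrite mulr_gt0 ?pi_gt0. Qed.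

Lemma Wt_bL1_exp f (a : R[i]) : Wt f -> 0 < - Re a < 2 * pi ->
  bL1 (fun y => expC (a * y%:C) * f y).
Proof.
move=> [mf Wf] ha; apply: bL1_normE (Wf _ ha) _.
  exact: cmeasM (cmeas_expC_lin a) mf.
by move=> x; rewrite !normcM normc_wt normc_expC ReM /= mulr0 subr0 mulNr opprK.
Qed.

Lemma one_lt_2pi : (0 : R) < 1 < 2 * (pi : R).
Proof. by rewrite ltr01 /=; have := pi_ge2 R; lra. Qed.

Lemma WtD f g : Wt f -> Wt g -> Wt (fun y => f y + g y).
Proof.
move=> [mf Wf] [mg Wg]; split; first exact: cmeasD.
move=> b hb; have := bL1D (Wf b hb) (Wg b hb).
by congr bL1; apply/funext => y; rewrite mulrDr.
Qed.

Lemma WtZ c f : Wt f -> Wt (fun y => c * f y).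
Proof.
move=> [mf Wf]; split; first exact: cmeasM (cmeas_cst _ c) mf.
move=> b hb; have := bL1Z c (Wf b hb).
by congr bL1; apply/funext => y; rewrite mulrCA.
Qed.

Lemma WtM f g M : cmeas g -> (forall x, normc (g x) <= M) -> Wt f -> Wt (fun x => g x * f x).
Proof.
move=> mg gM [mf Wf]; split; first exact: cmeasM.
move=> b hb; have := bL1M mg gM (Wf b hb).
by congr bL1; apply/funext => y; rewrite mulrCA.
Qed.

Lemma wt_conv b f g y : 0 < b < 2 * pi -> Wt f -> Wt g ->
  wt b y * cconv f g y = cconv (fun x => wt b x * f x) (fun x => wt b x * g x) y.
Proof.
move=> hb [_ Wf] [_ Wg].
exact: (cconv_twist y (wt_neq0 b) (wtD b) (Wf b hb) (Wg b hb)).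
Qed.

Lemma cintble_convW f g y : Wt f -> Wt g -> cintble (fun x => f x * g (y - x)).
Proof.
move=> [_ Wf] [_ Wg]; have := cintble_conv_kernel (Wf 1 one_lt_2pi) (Wg 1 one_lt_2pi) y.
move=> /(cintbleZ (wt 1 y)^-1); congr cintble; apply/funext => x.
rewrite (_ : wt 1 y = wt 1 x * wt 1 (y - x)); last by rewrite -wtD addrC subrK.
have n1 := wt_neq0 1 x; have n2 := wt_neq0 1 (y - x).
by field; apply/andP.
Qed.

Lemma Wt_conv f g : Wt f -> Wt g -> Wt (cconv f g).
Proof.
move=> Wf Wg.
have B b : 0 < b < 2 * pi -> bL1 (fun y => wt b y * cconv f g y).
  move=> hb; have := bL1_conv (Wf.2 b hb) (Wg.2 b hb).
  by congr bL1; apply/funext => y; rewrite wt_conv.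
split => //; have [mB _ _] := B 1 one_lt_2pi.
(* Multiplying back by e^y, the inverse of the weight with b = 1, recovers measurability of the
   unweighted convolution. *)
have := cmeasM (cmeas_expC_lin 1) mB; congr cmeas; apply/funext => y.
rewrite mulrA (_ : _ * wt 1 y = 1) ?mul1r//.
by rewrite ?mul1r expC_real /wt realcE mul1r -expRD subrr expR0.
Qed.

Lemma wt_inj b (y : R) (z w : R[i]) : wt b y * z = wt b y * w -> z = w.
Proof. exact: (mulfI (wt_neq0 b y)). Qed.

Lemma cconvCW f g y : Wt f -> Wt g -> cconv f g y = cconv g f y.
Proof.
move=> Wf Wg; apply: (@wt_inj 1 y); rewrite !wt_conv ?one_lt_2pi//.
by apply: cconvC; [exact: (Wf.2 _ one_lt_2pi)|exact: (Wg.2 _ one_lt_2pi)].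
Qed.

Lemma cconvAW k f g y : Wt k -> Wt f -> Wt g ->
  cconv (cconv k f) g y = cconv k (cconv f g) y.
Proof.
move=> Wk Wf Wg; have h := one_lt_2pi; apply: (@wt_inj 1 y).
rewrite !wt_conv//; try exact: Wt_conv.
have E f' g' : Wt f' -> Wt g' -> (fun x => wt 1 x * cconv f' g' x) =
    cconv (fun x => wt 1 x * f' x) (fun x => wt 1 x * g' x).
  by move=> Wf' Wg'; apply/funext => x; rewrite wt_conv.
rewrite !E//; apply: cconvA; [exact: (Wf.2 _ h)|exact: (Wg.2 _ h)|exact: (Wk.2 _ h)].
Qed.

(** * The function G, its strip of regularity, and the transform of densities *)

Variable omega : R.
Hypothesis om0 : 0 < omega.

Local Notation h := (hval omega).

Lemma hvalE : h = 0 +i* (2 * pi * omega).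
Proof. by rewrite /hval; apply: complex_ext; rewrite !(ReM, ImM) /=; ring. Qed.

Lemma hval_neq0 : h != 0.
Proof.
apply/eqP => /(congr1 (@complex.Im R)); rewrite hvalE /= => /eqP.
by rewrite gt_eqF// mulr_gt0 ?two_pi_gt0.
Qed.

Definition Gf (s : R[i]) : R[i] := h / (expC (- h * s) - 1).

(** Since -hbar s = 2 pi i (-omega s), G is the kernel rescaled and reversed, with the abscissa
    moved into (-1, 0) by the period 1. The reversal puts the decay of G at +oo, opposite to that of
    the kernel. *)
Lemma Gf_ker (a y : R) : Gf ((- a) +i* y) = h * ker ((omega * a - 1) +i* (- (omega * y))).
Proof.
rewrite /Gf; congr (_ * _); rewrite -(kerD1 ((omega * a - 1) +i* _)) /ker.
congr ((expC _ - 1)^-1); rewrite hvalE; apply: complex_ext; rewrite !(ReM, ImM, ReD, ImD, ReN, ImN) /=; ring.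
Qed.

(** Here [Gf] has no pole, and the transform [Tf] of a weighted density converges. *)
Definition strip (s : R[i]) := -1 < omega * Re s < 0.

Lemma stripE (a y : R) : strip ((- a) +i* y) = (0 < omega * a < 1).
Proof.
rewrite /strip /= mulrN; apply/andP/andP => -[h1 h2]; split; lra.
Qed.

Lemma exp_strip_neq0 s : strip s -> expC (- h * s) - 1 != 0.
Proof.
move=> /andP[h1 h2]; have := @exp_sub1_neq0 R (- (omega * Re s) - 1) (- (omega * Im s)).
have -> : expC (tpi * ((- (omega * Re s) - 1) +i* (- (omega * Im s)))) = expC (- h * s).
  rewrite -[LHS]mulr1 -expC_tpi -expCD; congr expC.
  by rewrite hvalE; apply: complex_ext; rewrite !(ReM, ImM, ReD, ImD, ReN, ImN) /=; ring.
by apply; apply/andP; split; lra.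
Qed.

(** With A and B the two exponentials, AB - 1 = (A - 1) + (B - 1) + (A - 1)(B - 1). *)
Lemma GfM s s' : strip s -> strip s' -> strip (s + s') ->
  Gf s * Gf s' = Gf (s + s') * (Gf s + Gf s' + h).
Proof.
move=> /exp_strip_neq0 h1 /exp_strip_neq0 h2 /exp_strip_neq0.
rewrite /Gf mulrDr expCD => h3; set A := expC _ in h1 h3 *; set B := expC _ in h2 h3 *.
by field; rewrite h1 h2 h3.
Qed.

Lemma Gf_bound (a : R) : 0 < omega * a < 1 ->
  exists M, forall y, normc (Gf ((- a) +i* y)) <= M / (1 + expR (- (2 * pi * - (omega * y)))).
Proof.
move=> /andP[a0 a1]; have l1 : -1 < omega * a - 1 by lra.
have l2 : omega * a - 1 < 0 by lra.
have [M M0 hM] := normc_ker l1 (lexx _) l2.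
exists (normc h * M) => y; rewrite Gf_ker normcM -[leRHS]mulrA ler_wpM2l ?normc_ge0//.
by apply: hM; rewrite lexx.
Qed.

Lemma cmeas_Gf (a : R) : 0 < omega * a < 1 -> cmeas (fun y => Gf ((- a) +i* y)).
Proof.
move=> /andP[a0 a1].
have hc : -1 < omega * a - 1 < 0 by apply/andP; split; lra.
have mk : cmeas (fun y => ker ((omega * a - 1) +i* y)).
  by apply: cmeas_cder => x; eexists; exact: cder_kery.
have mp : measurable_fun setT (fun y : R => - (omega * y)).
  have := measurable_affine (- omega) 0; apply: eq_measurable_fun => y _.
  by rewrite addr0 mulNr.
have := cmeasM (cmeas_cst _ h) (cmeas_comp mk mp).
by congr cmeas; apply/funext => y; rewrite Gf_ker.
Qed.

Lemma div1exp_le (M y : R) : 0 <= M -> M / (1 + expR y) <= M.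
Proof.
move=> M0; rewrite ler_pdivrMr ?addr_gt0 ?expR_gt0//.
by rewrite mulrDr mulr1 lerDl mulr_ge0 ?expR_ge0.
Qed.

Lemma Wt_Gf (a : R) f : 0 < omega * a < 1 -> Wt f -> Wt (fun y => Gf ((- a) +i* y) * f y).
Proof.
move=> ha Wf; have [M hM] := Gf_bound ha.
have M0 : 0 <= M.
  have := le_trans (normc_ge0 _) (hM 0); rewrite pmulr_lge0// invr_gt0 addr_gt0 ?expR_gt0//.
apply: (WtM (cmeas_Gf ha) _ Wf) => y; apply: (le_trans (hM y)); exact: div1exp_le.
Qed.

(** A factor G absorbs a small growth e^{b y}, hence removes the weight from the density. This
    provides the integrability of words ending in a. *)
Lemma bL1_Gf (a : R) f : 0 < omega * a < 1 -> Wt f -> bL1 (fun y => Gf ((- a) +i* y) * f y).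
Proof.
move=> ha Wf; have [M hM] := Gf_bound ha.
have M0 : 0 <= M.
  have := le_trans (normc_ge0 _) (hM 0); rewrite pmulr_lge0// invr_gt0 addr_gt0 ?expR_gt0//.
(* The bound 1 keeps the weight below 2 pi, and the bound [omega] keeps e^{b y} within the decay of
   G. *)
pose b := Num.min omega 1.
have hb : 0 < b < 2 * pi.
  rewrite lt_min om0 ltr01 /=; apply: (@le_lt_trans _ _ 1); first by rewrite ge_min lexx orbT.
  by case/andP: one_lt_2pi.
have mG : cmeas (fun y => Gf ((- a) +i* y) * expC (b%:C * y%:C)).
  by apply: cmeasM; [exact: cmeas_Gf|exact: cmeas_expC_lin].
have nG y : normc (Gf ((- a) +i* y) * expC (b%:C * y%:C)) <= M.
  rewrite normcM normc_expC realcE /=.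
  apply: (le_trans (ler_wpM2r (expR_ge0 _) (hM y))).
  rewrite -[leLHS]mulrA -[leRHS]mulr1 ler_wpM2l//.
  have hc : 0 <= b / omega <= 2 * pi.
    rewrite divr_ge0 ?(ltW om0) ?(ltW (proj1 (andP hb)))//=.
    apply: (@le_trans _ _ 1); last by apply: ltW; case/andP: one_lt_2pi.
    by rewrite ler_pdivrMr// mul1r ge_min lexx.
  apply: (le_trans (ler_wpM2r (expR_ge0 _) (inv1exp_le (- (omega * y)) hc))).
  rewrite -expRD -[leRHS]expR0 ler_expR mulrN mulrA divfK ?addNr// gt_eqF//.
have := bL1M mG nG (Wf.2 b hb); congr bL1; apply/funext => y.
rewrite -[LHS]mulrA; congr (_ * _); rewrite [LHS]mulrA.
rewrite (_ : _ * wt b y = 1) ?mul1r//.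
by rewrite realcE expC_real /wt realcE -expRD subrr expR0.
Qed.

Lemma Wt_ker (eps : R) : 0 < eps < 1 -> Wt (fun y => 'i * ker ((- eps) +i* y)).
Proof.
move=> /andP[e0 e1]; have l1 : -1 < - eps by lra. have l2 : - eps < 0 by lra.
have hc : -1 < - eps < 0 by rewrite l1 l2.
have [M M0 hM] := normc_ker l1 (lexx _) l2.
have mk : cmeas (fun y => 'i * ker ((- eps) +i* y)).
  apply: cmeasM; first exact: cmeas_cst.
  by apply: cmeas_cder => x; eexists; exact: cder_kery.
have ni : normc ('i : R[i]) = 1 by rewrite normcE2 /= expr0n expr1n add0r sqrtr1.
split=> // b hb.
have mw : cmeas (fun y => wt b y * ('i * ker ((- eps) +i* y))).
  apply: cmeasM => //; apply: cmeas_real.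
  have m1 : measurable_fun setT (fun y : R => - (b * y)).
    have := measurable_affine (- b) 0; apply: eq_measurable_fun => y _.
    by rewrite addr0 mulNr.
  exact: (measurableT_comp (@measurable_expR R) m1).
have k0 : 0 < Num.min b (2 * pi - b).
  by case/andP: hb => b0 b2; rewrite lt_min b0 subr_gt0.
have D y : normc (wt b y * ('i * ker ((- eps) +i* y))) <=
   M * expR (- (Num.min b (2 * pi - b) * `|y|)).
  rewrite !normcM ni mul1r normc_wt.
  apply: (le_trans (ler_wpM2l (expR_ge0 _) (hM (- eps) y _))); first by rewrite lexx.
  by rewrite mulrCA ler_wpM2l ?(ltW M0)//; exact: inv1exp_decay.
split => //.
  exists M => y; apply: (le_trans (D y)); rewrite -[leRHS]mulr1 ler_wpM2l ?(ltW M0)//.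
  by rewrite -[leRHS]expR0 ler_expR oppr_le0 mulr_ge0// ltW.
apply: (le_intble (cmeas_normc mw) (intbleZ M (intble_expabs k0))) => y.
by rewrite ger0_norm ?normc_ge0.
Qed.

(** Fourier-Laplace transform of a density on the line Re t = -b at frequency -hbar s, whose
    imaginary part runs through (0, 2 pi) on the strip. At [s = 0] it is the plain integral. *)
Definition Tf (b : R) (g : R -> R[i]) (s : R[i]) : R[i] :=
  cint (fun y => expC (- h * s * ((- b) +i* y)) * g y).

Lemma expC_lineE (s : R[i]) (b y : R) : expC (- h * s * ((- b) +i* y)) =
  expC (h * s * b%:C) * expC ((2 * pi * omega)%:C * s * y%:C).
Proof.
rewrite -expCD; congr expC; rewrite hvalE.
by apply: complex_ext; rewrite !(ReM, ImM, ReD, ImD, ReN, ImN) /=; ring.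
Qed.

Lemma strip_weight s : strip s -> 0 < - Re ((2 * pi * omega)%:C * s) < 2 * pi.
Proof.
move=> /andP[h1 h2]; rewrite Re_scale -mulrA -mulrN.
have p0 := two_pi_gt0; rewrite pmulr_rgt0// oppr_gt0 h2 /=.
by rewrite -[ltRHS]mulr1 ltr_pM2l// ltrNl.
Qed.

Lemma bL1_Tf (b : R) g s : strip s -> Wt g ->
  bL1 (fun y => expC (- h * s * ((- b) +i* y)) * g y).
Proof.
move=> hs Wg; have := bL1Z (expC (h * s * b%:C)) (Wt_bL1_exp Wg (strip_weight hs)).
by congr bL1; apply/funext => y; rewrite expC_lineE mulrA.
Qed.

Lemma Tf_conv (a b : R) f g s : strip s -> Wt f -> Wt g ->
  Tf (a + b) (cconv f g) s = Tf a f s * Tf b g s.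
Proof.
move=> hs Wf Wg; pose chi y := expC ((2 * pi * omega)%:C * s * y%:C).
have cD : {morph chi : x x' / x + x' >-> x * x'}.
  by move=> x x'; rewrite /chi rmorphD mulrDr expCD.
have c0 x : chi x != 0 by exact: expC_neq0.
have Bf := Wt_bL1_exp Wf (strip_weight hs).
have Bg := Wt_bL1_exp Wg (strip_weight hs).
have E (c : R) k : bL1 (fun y => chi y * k y) ->
   Tf c k s = expC (h * s * c%:C) * cint (fun y => chi y * k y).
  move=> Bk; rewrite -cintZ; last exact: bL1_cintble.
  by apply: eq_cint => y; rewrite expC_lineE mulrA.
have Ec : (fun y => chi y * cconv f g y) = cconv (fun y => chi y * f y) (fun y => chi y * g y).
  by apply/funext => y; rewrite (cconv_twist y c0 cD Bf Bg).
rewrite !E//; last by rewrite Ec; exact: bL1_conv.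
by rewrite Ec (cint_conv Bf Bg) rmorphD mulrDr expCD; ring.
Qed.

Lemma Tf_ker (eps : R) s : strip s -> 0 < eps < 1 ->
  Tf eps (fun y => 'i * ker ((- eps) +i* y)) s = Gf s / h.
Proof.
move=> hs /andP[e0 e1].
have hz : 0 < Im (- h * s) < 2 * pi.
  have := strip_weight hs; rewrite Re_scale hvalE !(ImM, ReN, ImN) /=.
  by rewrite (_ : - 0 * _ + _ = - (2 * pi * omega * Re s)); last ring.
have hc : -1 < - eps < 0 by apply/andP; split; lra.
have := fourier_ker hz hc; rewrite /Gf mulrAC mulfV ?hval_neq0// mul1r => <-.
rewrite -cintZ; last exact: (cintble_Q hz hc).
by apply: eq_cint => y; rewrite mulrCA; congr (_ * (expC _ * _)); rewrite mulrC.
Qed.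

(** Both sides integrate e^{-hbar (s0 + t) t'} against the two densities; apart from [s0] this
    factor is symmetric in t and t', so the transform can be moved from [g] to [f]. *)
Lemma Tf_fubini (a b : R) f g s0 : Wt f -> Wt g ->
  strip ((- a)%:C + s0) -> 0 < omega * b < 1 ->
  cintble (fun y => f y * Tf b g (s0 + ((- a) +i* y))) /\
  cint (fun y => f y * Tf b g (s0 + ((- a) +i* y))) =
  cint (fun y => expC (- h * s0 * ((- b) +i* y)) * (Tf a f ((- b) +i* y)) * g y).
Proof.
move=> Wf Wg ha hb.
have sb : strip (- b)%:C by rewrite /strip /= mulrN; move/andP: hb => [? ?]; apply/andP; split; lra.
have Bf : bL1 (fun y => expC ((2 * pi * omega)%:C * (- b)%:C * y%:C) * f y).
  exact: Wt_bL1_exp Wf (strip_weight sb).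
have Bg : bL1 (fun y => expC ((2 * pi * omega)%:C * ((- a)%:C + s0) * y%:C) * g y).
  exact: Wt_bL1_exp Wg (strip_weight ha).
have [mf _] := Wf; have [mg _] := Wg.
pose c0 := expC (h * ((- a)%:C + s0) * b%:C).
(* With t = -a + i x and t' = -b + i y the exponential factors into a part in x, a part in y and
   e^{hbar x y}. The last has modulus 1 because hbar is imaginary, so [F] is dominated by a
   product. *)
pose F (z : R * R) : R[i] := c0 * (expC ((2 * pi * omega)%:C * (- b)%:C * z.1%:C) * f z.1) *
   (expC ((2 * pi * omega)%:C * ((- a)%:C + s0) * z.2%:C) * g z.2) *
   expC (h * (z.1 * z.2)%:C).
have FE x y : F (x, y) = f x * (expC (- h * (s0 + ((- a) +i* x)) * ((- b) +i* y)) * g y).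
  pose e1 := expC ((2 * pi * omega)%:C * (- b)%:C * x%:C).
  pose e2 := expC ((2 * pi * omega)%:C * ((- a)%:C + s0) * y%:C).
  pose e3 := expC (h * (x * y)%:C).
  have -> : expC (- h * (s0 + ((- a) +i* x)) * ((- b) +i* y)) = c0 * e1 * e2 * e3.
    rewrite /c0 /e1 /e2 /e3 -!expCD; congr expC; rewrite hvalE.
    by apply: complex_ext; rewrite !(ReM, ImM, ReD, ImD, ReN, ImN) /=; ring.
  rewrite -[LHS]/(c0 * (e1 * f x) * (e2 * g y) * e3); ring.
have mF : cmeas F.
  have mxy : measurable_fun setT (fun z : R * R => z.1 * z.2).
    exact: measurable_funM (@measurable_fstR R) (@measurable_sndR R).
  apply: cmeasM; last exact: (cmeas_comp (cmeas_expC_lin h) mxy).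
  have [mBf _ _] := Bf; have [mBg _ _] := Bg.
  apply: cmeasM; last exact: (cmeas_comp mBg (@measurable_sndR R)).
  apply: cmeasM; first exact: cmeas_cst.
  exact: (cmeas_comp mBf (@measurable_fstR R)).
have [_ _ If] := Bf; have [_ [M gM] Ig] := Bg.
have nF x y : normc (F (x, y)) <=
   normc c0 * normc (expC ((2 * pi * omega)%:C * (- b)%:C * x%:C) * f x) *
   normc (expC ((2 * pi * omega)%:C * ((- a)%:C + s0) * (0 * x + y)%:C) * g (0 * x + y)).
  have e3 : normc (expC (h * (x * y)%:C)) = 1.
    by rewrite normc_expC hvalE ReM /= mul0r mulr0 subrr expR0.
  rewrite mul0r add0r -[F (x, y)]/(c0 * (_ * f x) * (_ * g y) * expC (h * (x * y)%:C)).
  by rewrite normcM e3 mulr1 !normcM.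
have gM' y : `|normc (expC ((2 * pi * omega)%:C * ((- a)%:C + s0) * y%:C) * g y)| <= M.
  by rewrite ger0_norm ?normc_ge0.
have := cfubini mF (intbleZ (normc c0) If) Ig gM' nF => /= H.
have I1 := cintble_section1 mF Ig nF.
have I2 := cintble_section2 mF (intbleZ (normc c0) If) gM' nF.
have I3 := cintble_fubini1 (k := 0) mF (intbleZ (normc c0) If) Ig nF.
have E : (fun y => f y * Tf b g (s0 + ((- a) +i* y))) = (fun x => cint (fun y => F (x, y))).
  apply/funext => x; rewrite /Tf.
  have sx : strip (s0 + ((- a) +i* x)) by move: ha; rewrite /strip !ReD /= addrC.
  rewrite -cintZ; last exact/bL1_cintble/bL1_Tf.
  by apply: eq_cint => y; rewrite FE.
rewrite E; split; first exact: I3.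
rewrite H; apply: eq_cint => y; rewrite /Tf.
have sy : strip ((- b) +i* y) by rewrite stripE.
have Cy := bL1_cintble (bL1_Tf a sy Wf).
rewrite [RHS]mulrAC -cintZ; last exact: Cy.
apply: eq_cint => x; rewrite FE mulrDr mulrDl expCD.
rewrite [- h * ((- a) +i* x) * _]mulrAC; ring.
Qed.

End LineFunctions.

(** * The two products and the duality on words *)

Section FreeScaling.
Context (T : choiceType).
Implicit Types (c : Qh) (x y : {malg Qh[{fmonom T}]}).

Lemma malgC_comm c x : c%:MP * x = x * c%:MP.
Proof.
elim/free_ind: x => [u|d x y IHx IHy].
  rewrite wd_malgC /wd -[LHS]/(fgmul _ _) fgmulUU mulr1 mul1m.
  exact: (scale_wd c (FMonom u)).
rewrite mulrDr IHy linM -IHx; congr (_ + _).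
rewrite [LHS]mul_malgC [c%:MP * x]mul_malgC [LHS]scalerA [RHS]scalerA mulrC; reflexivity.
Qed.

Lemma free_scalerAr c x y : c *: (x * y) = x * (c *: y).
Proof. rewrite -!mul_malgC !mulrA malgC_comm; reflexivity. Qed.

Lemma free_linr z c x y : z * (c *: x + y) = c *: (z * x) + z * y.
Proof. by rewrite mulrDr free_scalerAr. Qed.
End FreeScaling.

Section ShuffleStep.
Context (A : lalgType Qh) (sh : A -> A -> A) (a b : A).
Implicit Types (c : Qh) (x y z : A).
Hypotheses (sAr : forall c x y, c *: (x * y) = x * (c *: y))
  (shZl : forall c x y, sh (c *: x) y = c *: sh x y)
  (shZr : forall c x y, sh y (c *: x) = c *: sh y x)
  (shbl : forall x y, sh (x * b) y = sh x y * b)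
  (shbr : forall x y, sh x (y * b) = sh x y * b)
  (shaa : forall x y, sh (x * a) (y * a) =
     (sh (x * a) y + sh x (y * a) + hbar *: sh x y) * a).

(** One use of [shaa] strips the final a of both factors, after which all letters b move out to the
    right. The three summands are those of the harmonic recursion. *)
Lemma shuffle_step k l x y :
  sh x (y * (hbar ^+ l.-1 *: (b ^+ l * a))) * (hbar ^+ k.-1 *: (b ^+ k * a)) +
  sh (x * (hbar ^+ k.-1 *: (b ^+ k * a))) y * (hbar ^+ l.-1 *: (b ^+ l * a)) +
  hbar ^+ (k.-1 + l.-1).+1 *: (sh x y * (b ^+ (k + l) * a)) =
  sh (x * (hbar ^+ k.-1 *: (b ^+ k * a))) (y * (hbar ^+ l.-1 *: (b ^+ l * a))).
Proof.
have bXl j z t : sh (z * b ^+ j) t = sh z t * b ^+ j.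
  by elim: j => [|j IH]; rewrite ?expr0 ?mulr1// exprSr !mulrA shbl IH.
have bXr j z t : sh t (z * b ^+ j) = sh t z * b ^+ j.
  by elim: j => [|j IH]; rewrite ?expr0 ?mulr1// exprSr !mulrA shbr IH.
rewrite -!sAr !shZl !shZr -!scalerAl !mulrA shaa !bXl !bXr.
rewrite !scalerA -exprD exprSr !mulrDl !scalerDr -scalerAl scalerA.
rewrite -!mulrA [b ^+ l * (b ^+ k * a)]mulrA -!exprD (addnC l k) (addnC l.-1).
by congr (_ + _); rewrite addrC.
Qed.
End ShuffleStep.

Section MonomialSums.
Context (T : choiceType) (V : zmodType) (G : {fmonom T} -> Qh -> V).
Hypothesis GD : forall m c d, G m (c + d) = G m c + G m d.

Let G0 m : G m 0 = 0.
Proof. by apply: (addrI (G m 0)); rewrite -GD !addr0. Qed.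

(** Common extension behind [phi], valued in an algebra over Q[hbar], and [EE], valued in the
    complex numbers. In [msum_lin], [tau] is the scalar action on the target. *)
Definition msum (x : {malg Qh[{fmonom T}]}) : V := \sum_(m <- msupp x) G m x@_m.

Lemma msumEw (d : {fset {fmonom T}}) (x : {malg Qh[{fmonom T}]}) :
  (msupp x `<=` d)%fset -> msum x = \sum_(m <- d) G m x@_m.
Proof.
by move=> s; rewrite /msum (big_fset_incl _ s) // => m _ /mcoeff_outdom ->.
Qed.

Lemma msum_lin (tau : V -> V) (c : Qh) (x y : {malg Qh[{fmonom T}]}) :
  (forall m d, G m (c * d) = tau (G m d)) -> {morph tau : a b / a + b} ->
  msum (c *: x + y) = tau (msum x) + msum y.
Proof.
move=> Gt tD; have t0 : tau 0 = 0 by apply: (addrI (tau 0)); rewrite -tD !addr0.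
pose d := (msupp x `|` msupp y `|` msupp (c *: x + y))%fset.
have s1 : (msupp x `<=` d)%fset by rewrite /d -fsetUA fsubsetUl.
have s2 : (msupp y `<=` d)%fset by rewrite /d [(msupp x `|` _)%fset]fsetUC -fsetUA fsubsetUl.
have s3 : (msupp (c *: x + y) `<=` d)%fset by rewrite /d fsubsetUr.
rewrite (msumEw s1) (msumEw s2) (msumEw s3) (big_morph tau tD t0) -big_split /=.
by apply: eq_bigr => m _; rewrite mcoeffD mcoeffZ GD Gt.
Qed.

Lemma msum_wd u : msum (wd u) = G (FMonom u) 1.
Proof. by rewrite /msum msuppU1 big_seq_fset1 mcoeffUU. Qed.
End MonomialSums.

Lemma addr_transpose3 (V : zmodType) (x1 x2 x3 y1 y2 y3 z1 z2 z3 : V) :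
  x1 + x2 + x3 + (y1 + y2 + y3) + (z1 + z2 + z3) =
  x1 + y1 + z1 + (x2 + y2 + z2) + (x3 + y3 + z3).
Proof.
rewrite (addrACA (x1 + x2)) (addrACA x1 x2) (addrACA (x1 + y1 + _)).
by rewrite (addrACA (x1 + y1)).
Qed.

(** * The harmonic product by recursion on first letters *)

Section LeftRecursion.
Context (A : pzRingType).
Implicit Types (k l a b c d x h : A).

Lemma leftrec_nil k l c : l * k + k * l + 1 * c = k * l + l * k + c * 1.
Proof. by rewrite mul1r mulr1; congr (_ + _); exact: addrC. Qed.

Lemma leftrec_l k l b c d x h :
  l * x * b * k + (k * (l * x) + l * h + c * x) * b + l * x * d =
  k * (l * x * b) + l * (x * b * k + h * b + x * d) + c * (x * b).
Proof.
rewrite !mulrDl !mulrDr !mulrA -!addrA addrCA; congr (_ + (_ + (_ + _))); exact: addrC.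
Qed.

Lemma leftrec_r k l a c d x h :
  (k * h + l * (k * x) + c * x) * a + k * x * a * l + k * x * d =
  k * (h * a + x * a * l + x * d) + l * (k * x * a) + c * (x * a).
Proof.
rewrite !mulrDl !mulrDr !mulrA -!addrA; congr (_ + _).
by rewrite addrA addrC -!addrA; congr (_ + _).
Qed.

Lemma leftrec k l a b c d (x1 x2 x3 x4 x5 x6 x7 x8 x9 : A) :
  (k * x1 + l * x2 + c * x3) * a + (k * x4 + l * x5 + c * x6) * b + (k * x7 + l * x8 + c * x9) * d =
  k * (x1 * a + x4 * b + x7 * d) + l * (x2 * a + x5 * b + x8 * d) + c * (x3 * a + x6 * b + x9 * d).
Proof. rewrite !mulrDl !mulrDr !mulrA; exact: addr_transpose3. Qed.
End LeftRecursion.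

Section Harmonic.
Implicit Types (u v : seq nat) (k l : nat).

Definition harm u v : frakA := harmonic_rev (rev u) (rev v).

Lemma harm0w v : harm [::] v = wd v.
Proof. by rewrite /harm harmonic_revE revK. Qed.

Lemma harmw0 u : harm u [::] = wd u.
Proof. by rewrite /harm harmonic_rev0 revK. Qed.

Lemma harm_rcons u v a b : harm (rcons u a) (rcons v b) =
  harm u (rcons v b) * wd [:: a] + harm (rcons u a) v * wd [:: b] + harm u v * circ a b.
Proof. by rewrite /harm !rev_rcons [LHS]harmonic_revE. Qed.

Lemma wd_cons (k : nat) u : wd (k :: u) = wd [:: k] * wd u.
Proof. by rewrite wdM. Qed.

Lemma wd_rcons u (k : nat) : wd (rcons u k) = wd u * wd [:: k].
Proof. by rewrite wdM cats1. Qed.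

(** The definition recurses on last letters, but [phi] reverses words and so needs first letters.
    Expanding by last letters and using induction gives the same nine terms, grouped the other
    way. *)
Lemma harm_cons k u l v : harm (k :: u) (l :: v) =
  wd [:: k] * harm u (l :: v) + wd [:: l] * harm (k :: u) v + circ k l * harm u v.
Proof.
have [n] := ubnP (size u + size v); elim: n u v => // n IH u v.
case/lastP: u => [|u a]; case/lastP: v => [|v b] hn.
- have -> : harm [:: k] [:: l] = _ := harm_rcons [::] [::] k l.
  rewrite !harm0w !harmw0 wd1; exact: leftrec_nil.
- have E1 : harm [:: k] (l :: rcons v b) = _ := harm_rcons [::] (l :: v) k b.
  have E2 : harm [:: k] (rcons v b) = _ := harm_rcons [::] v k b.
  have E3 := IH [::] v (ltac:(by move: hn; rewrite /= size_rcons addnS ltnS)).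
  rewrite E1 E2 E3 !harm0w !wd_rcons (wd_cons l v); exact: leftrec_l.
- have E1 : harm (k :: rcons u a) [:: l] = _ := harm_rcons (k :: u) [::] a l.
  have E2 : harm (rcons u a) [:: l] = _ := harm_rcons u [::] a l.
  have E3 := IH u [::] (ltac:(by move: hn; rewrite /= size_rcons addSn ltnS)).
  rewrite E1 E2 E3 !harmw0 !wd_rcons (wd_cons k u); exact: leftrec_r.
- have E1 : harm (k :: rcons u a) (l :: rcons v b) = _ := harm_rcons (k :: u) (l :: v) a b.
  have E2 : harm (rcons u a) (l :: rcons v b) = _ := harm_rcons u (l :: v) a b.
  have E3 : harm (k :: rcons u a) (rcons v b) = _ := harm_rcons (k :: u) v a b.
  have I1 := IH u (rcons v b) (ltac:(by move: hn; rewrite !size_rcons addSn ltnS)).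
  have I2 := IH (rcons u a) v (ltac:(by move: hn; rewrite !size_rcons addnS ltnS)).
  have I3 := IH u v (ltac:(by move: hn; rewrite !size_rcons addnS addSn ltnS => /ltnW)).
  rewrite E1 E2 E3 (harm_rcons u v a b); rewrite rcons_cons in I2 *.
  rewrite [harm (k :: u) (l :: rcons v b)]I1 [harm (k :: rcons u a) (l :: v)]I2 I3.
  exact: leftrec.
Qed.

End Harmonic.

(** * The dual map from harmonic to shuffle product *)

Section Dual.
Implicit Types (u v : seq nat) (k l : nat).

(** Exchanging a and b in b a^k gains hbar for each a and loses hbar for the b. For [k = 0] the hbar
    inside the letter compensates this loss, in agreement with the truncated predecessor, and leaves
    a. *)
Definition sig k : frakH := hbar ^+ k.-1 *: (gen_b ^+ k * gen_a).

Fixpoint phiw u : frakH := if u is k :: u' then phiw u' * sig k else 1.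

Definition phi : frakA -> frakH := msum (fun m c => c *: phiw m).

Let phiGD (m : {fmonom nat}) (c d : Qh) : (c + d) *: phiw m = c *: phiw m + d *: phiw m.
Proof. exact: scalerDl. Qed.

Lemma phi_lin c x y : phi (c *: x + y) = c *: phi x + phi y.
Proof.
apply: (msum_lin phiGD) => [m d|a b]; first by rewrite scalerA.
exact: scalerDr.
Qed.

Lemma phi_wd u : phi (wd u) = phiw u.
Proof. by rewrite /phi msum_wd scale1r. Qed.

Lemma phiD x y : phi (x + y) = phi x + phi y.
Proof. by have := phi_lin 1 x y; rewrite !scale1r. Qed.

Lemma phi0 : phi 0 = 0.
Proof. by apply: (addrI (phi 0)); rewrite -phiD !addr0. Qed.

Lemma phiZ c x : phi (c *: x) = c *: phi x.
Proof. by have := phi_lin c x 0; rewrite phi0 !addr0. Qed.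

Lemma phi_consM k x : phi (wd [:: k] * x) = phi x * sig k.
Proof.
elim/free_ind: x => [u|c x y IHx IHy]; first by rewrite wdM !phi_wd.
apply: etrans (congr1 phi (free_linr _ _ _ _)) _; apply: etrans (phi_lin _ _ _) _.
apply: etrans (addscale_congr c IHx IHy) _.
apply: etrans (esym (linM _ _ _ _)) _; rewrite (phi_lin c x y); reflexivity.
Qed.

Lemma shuffleDl c x y z : shuffle_hbar (c *: x + y) z = c *: shuffle_hbar x z + shuffle_hbar y z.
Proof. exact: bilinear_extDl. Qed.

Lemma shuffleDr c x y z : shuffle_hbar z (c *: x + y) = c *: shuffle_hbar z x + shuffle_hbar z y.
Proof. exact: bilinear_extDr. Qed.

Lemma shuffle0l z : shuffle_hbar 0 z = 0.
Proof.
have := shuffleDl 1 0 0 z; rewrite !scale1r addr0 => /eqP.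
rewrite -subr_eq0 opprD addrA subrr add0r oppr_eq0 => /eqP E; exact: E.
Qed.

Lemma shuffle0r z : shuffle_hbar z 0 = 0.
Proof.
have := shuffleDr 1 0 0 z; rewrite !scale1r addr0 => /eqP.
rewrite -subr_eq0 opprD addrA subrr add0r oppr_eq0 => /eqP E; exact: E.
Qed.

Lemma shuffleZl c x z : shuffle_hbar (c *: x) z = c *: shuffle_hbar x z.
Proof. have := shuffleDl c x 0 z; rewrite !addr0 shuffle0l addr0 => E; exact: E. Qed.

Lemma shuffleZr c x z : shuffle_hbar z (c *: x) = c *: shuffle_hbar z x.
Proof. have := shuffleDr c x 0 z; rewrite !addr0 shuffle0r addr0 => E; exact: E. Qed.

(** In the four cases of [circ] the scalar makes up exactly for the truncated predecessors, leaving
    one formula. *)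
Lemma phi_circM k l x : phi (circ k l * x) =
  hbar ^+ (k.-1 + l.-1).+1 *: (phi x * (gen_b ^+ (k + l) * gen_a)).
Proof.
have [c [-> cE]] : exists c : Qh, circ k l = c *: wd [:: (k + l)%N] /\
    c * hbar ^+ (k + l).-1 = hbar ^+ (k.-1 + l.-1).+1.
  case: k l => [|k] [|l] /=.
  - by exists hbar; rewrite expr0 mulr1 expr1.
  - by exists hbar; rewrite -exprS.
  - by exists hbar; rewrite addn0 -exprS addn0.
  - exists 1; split; first by rewrite scale1r.
    by rewrite mul1r addnS.
rewrite -scalerAl phiZ phi_consM /sig -free_scalerAr scalerA cE; reflexivity.
Qed.

Lemma shuffle_phiw u v : shuffle_hbar (phiw u) (phiw v) = phi (harm u v).
Proof.
have [n] := ubnP (size u + size v); elim: n u v => // n IH.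
case=> [|k u] [|l v] hn.
- rewrite harm0w phi_wd shuffle_1w; reflexivity.
- rewrite harm0w phi_wd shuffle_1w; reflexivity.
- rewrite harmw0 phi_wd shuffle_w1; reflexivity.
have I1 : (size u + size (l :: v) < n)%N by move: hn; rewrite /= !addSn !addnS !ltnS.
have I2 : (size (k :: u) + size v < n)%N by move: hn; rewrite /= !addSn !addnS !ltnS.
have I3 : (size u + size v < n)%N by move: hn; rewrite /= !addSn !addnS !ltnS => /ltnW.
rewrite harm_cons.
apply: etrans _ (esym (phiD _ _)); apply: etrans _ (congr2 +%R (esym (phiD _ _)) (erefl _)).
apply: etrans _ (congr2 +%R (congr2 +%R (esym (phi_consM _ _)) (esym (phi_consM _ _)))
  (esym (phi_circM _ _ _))).
rewrite -(IH u (l :: v) I1) -(IH (k :: u) v I2) -(IH u v I3) => {IH hn I1 I2 I3}.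
have E := @shuffle_step _ shuffle_hbar gen_a gen_b (@free_scalerAr _) shuffleZl shuffleZr
  shuffle_b_l shuffle_b_r shuffle_aa k l (phiw u) (phiw v).
rewrite -[phiw (k :: u)]/(phiw u * sig k) -[phiw (l :: v)]/(phiw v * sig l) /sig.
exact: esym E.
Qed.

Lemma shuffle_phi x y : shuffle_hbar (phi x) (phi y) = phi (harmonicA x y).
Proof.
elim/free_ind: x => [u|c x x' IHx IHx']; last first.
  rewrite phi_lin shuffleDl /harmonicA bilinear_extDl phi_lin IHx IHx'; reflexivity.
elim/free_ind: y => [v|c y y' IHy IHy']; last first.
  rewrite phi_lin shuffleDr /harmonicA bilinear_extDr phi_lin IHy IHy'; reflexivity.
rewrite !phi_wd /harmonicA bilinear_ext_wd shuffle_phiw; reflexivity.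
Qed.

Lemma gen_bX k : gen_b ^+ k = wd (nseq k true).
Proof. by elim: k => [|k IH]; rewrite ?wd1 // exprS IH wdM. Qed.

Definition dual_word (w : seq bool) := map negb (rev w).

Lemma phiwE u : phiw u = hbar ^+ (sumn (map predn u)) *: wd (dual_word (Defs.code u)).
Proof.
elim: u => [|k u IH]; first by rewrite scale1r wd1.
rewrite /= IH /sig -scalerAl -free_scalerAr scalerA -exprD addnC gen_bX !wdM; congr (_ *: wd _).
rewrite /dual_word rev_cons rev_cat rcons_cat map_cat; congr (_ ++ _).
rewrite map_rcons -cats1; congr (_ ++ _).
by rewrite rev_nseq map_nseq.
Qed.

End Dual.

(** * Stability of [hatH0] under both products *)

Section Closure.

Lemma hatH0_lin (c : Qh) (x y : frakH) : hatH0 x -> hatH0 y -> hatH0 (c *: x + y).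
Proof.
move=> [v hv <-] [w hw <-]; exists (c *: v + w); last exact: embed_lin.
move=> m; rewrite -mcoeff_neq0 mcoeffD mcoeffZ => h.
have [E|n] := eqVneq v@_m 0; last by apply: hv; rewrite -mcoeff_neq0.
by apply: hw; rewrite -mcoeff_neq0; move: h; rewrite E mulr0 add0r.
Qed.

Lemma hatH0_word u : admissible u -> hatH0 (word_prod u).
Proof.
by move=> hu; exists (wd u); rewrite ?embed_wd// => m; rewrite msuppU1 in_fset1 => /eqP ->.
Qed.

Lemma hatH0_0 : hatH0 0.
Proof.
have := hatH0_lin (-1) (hatH0_word (u := [::]) isT) (hatH0_word (u := [::]) isT).
by rewrite scaleN1r addNr.
Qed.

Lemma hatH0D (x y : frakH) : hatH0 x -> hatH0 y -> hatH0 (x + y).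
Proof. by move=> hx hy; rewrite -[x]scale1r; exact: hatH0_lin. Qed.

Lemma hatH0Z (c : Qh) (x : frakH) : hatH0 x -> hatH0 (c *: x).
Proof. by move=> hx; rewrite -[c *: x]addr0; apply: hatH0_lin => //; exact: hatH0_0. Qed.

Lemma hatH0_hatH1 x : hatH0 x -> hatH1 x.
Proof. by case=> v _ <-; exists v. Qed.

Lemma word_prod_rcons u k : word_prod (rcons u k) = word_prod u * letter k.
Proof. by rewrite /word_prod -cats1 big_cat big_seq1. Qed.

Lemma hatH0_letter x k : hatH1 x -> hatH0 (x * letter k.+1).
Proof.
case=> v <-; elim/free_ind: v => [u|c v w IHv IHw].
  rewrite embed_wd -word_prod_rcons; apply: hatH0_word.
  by rewrite /admissible last_rcons orbT.
rewrite embed_lin linM; exact: (hatH0_lin c IHv IHw).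
Qed.

Lemma hatH1_letter x k : hatH1 x -> hatH1 (x * letter k).
Proof.
case: k => [|k] hx; last exact/hatH0_hatH1/hatH0_letter.
case: hx => v <-; exists (v * wd [:: 0%N]); elim/free_ind: v => [u|c v w IHv IHw].
  rewrite wdM cats1 !embed_wd word_prod_rcons; reflexivity.
apply: etrans (congr1 embed (linM c v w _)) _; apply: etrans (embed_lin c _ _) _.
apply: etrans (addscale_congr c IHv IHw) _; rewrite (embed_lin c v w); exact: esym (linM c _ _ _).
Qed.

Lemma hatH0_ind (P : frakH -> Prop) :
  (forall u, admissible u -> P (word_prod u)) ->
  (forall c x y, P x -> P y -> P (c *: x + y)) -> forall x, hatH0 x -> P x.
Proof.
move=> Pw Pl _ [v hv <-].
have P0 : P 0 by have := Pl (-1) _ _ (Pw [::] isT) (Pw [::] isT); rewrite scaleN1r addNr.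
rewrite /embed; elim/big_rec: _ => // m y _ Py.
have [/hv hm|hm] := boolP (m \in msupp v); first exact: Pl (Pw m hm) Py.
by rewrite mcoeff_outdom// scale0r add0r.
Qed.

Section ClosureStep.
Context (A : lalgType Qh) (sh : A -> A -> A) (a b : A) (H0 H1 : A -> Prop).
Implicit Types (c : Qh) (x y z : A).
Hypotheses (shbl : forall x y, sh (x * b) y = sh x y * b)
  (shbr : forall x y, sh x (y * b) = sh x y * b)
  (shaa : forall x y, sh (x * a) (y * a) =
     (sh (x * a) y + sh x (y * a) + hbar *: sh x y) * a)
  (H0D : forall x y, H0 x -> H0 y -> H0 (x + y))
  (H0Z : forall c x, H0 x -> H0 (c *: x))
  (H0ba : forall x i, H1 x -> H0 (x * b * a ^+ i.+1))
  (H0bba : forall x i, H1 x -> H0 (hbar *: (x * b * b * a ^+ i.+1))).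

(** Each use of [shaa] lowers an exponent; when one reaches 0 a b slides out and a known shuffle
    remains. If both reach 0 a factor b b appears, which is admissible only because the recursion
    attaches hbar to that term, making hbar b a letter. *)
Lemma closure_step x y : H1 (sh x y) ->
  (forall k, H1 (sh (x * (b * a ^+ k.+1)) y)) ->
  (forall l, H1 (sh x (y * (b * a ^+ l.+1)))) ->
  forall k l, H0 (sh (x * (b * a ^+ k.+1)) (y * (b * a ^+ l.+1))).
Proof.
move=> h0 hl hr.
pose P k l := sh (x * b * a ^+ k) (y * b * a ^+ l).
(* The trailing power of a is generalised because every use of [shaa] puts another a on the
   right. *)
suff H n : forall k l j, (k + l < n)%N -> H0 (P k.+1 l.+1 * a ^+ j).
  by move=> k l; have := H _ k l 0%N (ltnSn _); rewrite /P expr0 mulr1 -!mulrA.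
elim: n => // n IH k l j hn.
have PE : P k.+1 l.+1 = (P k.+1 l + P k l.+1 + hbar *: P k l) * a.
  by rewrite /P [a ^+ k.+1]exprSr [a ^+ l.+1]exprSr !mulrA shaa.
have Pk0 i : P i.+1 0%N = sh (x * (b * a ^+ i.+1)) y * b.
  by rewrite /P expr0 mulr1 shbr mulrA.
have P0l i : P 0%N i.+1 = sh x (y * (b * a ^+ i.+1)) * b.
  by rewrite /P expr0 mulr1 shbl mulrA.
have P00 : P 0%N 0%N = sh x y * b * b by rewrite /P !expr0 !mulr1 shbl shbr.
rewrite PE -mulrA -exprS !mulrDl -scalerAl.
apply: H0D; first apply: H0D.
- case: l {PE} hn => [|l] hn; first by rewrite Pk0; apply: H0ba.
  by apply: IH; move: hn; rewrite addnS ltnS.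
- case: k {PE} hn => [|k] hn; first by rewrite P0l; apply: H0ba.
  by apply: IH; move: hn; rewrite addSn ltnS.
- case: k l {PE} hn => [|k] [|l] hn.
  + by rewrite P00; exact: H0bba.
  + by rewrite P0l; apply/H0Z/H0ba.
  + by rewrite Pk0; apply/H0Z/H0ba.
  + by apply/H0Z/IH; move: hn; rewrite addSn addnS ltnS => /ltnW.
Qed.
End ClosureStep.

Lemma letter0_insert (s d : frakH) :
  hbar *: (s * gen_b * gen_b * d) = s * letter 0 * gen_b * d.
Proof.
have E (A : lalgType Qh) (x y z : A) : x * (hbar *: y) = hbar *: (x * y) ->
    hbar *: (x * y * y * z) = x * (hbar *: y) * y * z.
  by move=> ->; rewrite -!scalerAl.
rewrite letter0; apply: E; apply: esym; exact: free_scalerAr.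
Qed.

Lemma hatH0_ba x i : hatH1 x -> hatH0 (x * gen_b * gen_a ^+ i.+1).
Proof. by move=> hx; rewrite -mulrA; exact: hatH0_letter. Qed.

Lemma hatH0_bba x i : hatH1 x -> hatH0 (hbar *: (x * gen_b * gen_b * gen_a ^+ i.+1)).
Proof. by move=> hx; rewrite letter0_insert; apply/hatH0_ba/hatH1_letter. Qed.

Lemma shuffle_core w w' : hatH1 (shuffle_hbar w w') ->
  (forall k, hatH1 (shuffle_hbar (w * letter k.+1) w')) ->
  (forall l, hatH1 (shuffle_hbar w (w' * letter l.+1))) ->
  forall k l, hatH0 (shuffle_hbar (w * letter k.+1) (w' * letter l.+1)).
Proof.
exact: (closure_step shuffle_b_l shuffle_b_r shuffle_aa hatH0D hatH0Z hatH0_ba hatH0_bba).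
Qed.

Lemma shuffle_letter0_l x y :
  shuffle_hbar (x * letter 0) y = shuffle_hbar x y * letter 0.
Proof.
rewrite letter0 -(free_scalerAr hbar) shuffleZl shuffle_b_l; exact: free_scalerAr.
Qed.

Lemma shuffle_letter0_r x y :
  shuffle_hbar x (y * letter 0) = shuffle_hbar x y * letter 0.
Proof.
rewrite letter0 -(free_scalerAr hbar) shuffleZr shuffle_b_r; exact: free_scalerAr.
Qed.

Lemma shuffle_hatH1 u v : hatH1 (shuffle_hbar (word_prod u) (word_prod v)).
Proof.
have hw w : hatH1 (word_prod w) by exists (wd w); rewrite embed_wd.
have w1 : word_prod [::] = 1 by rewrite /word_prod big_nil.
elim/last_ind: u v => [|u a IHu] v; first by rewrite w1 shuffle_1w.
elim/last_ind: v a => [|v b IHv] a; first by rewrite w1 shuffle_w1.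
case: a => [|k].
  rewrite [word_prod (rcons u _)]word_prod_rcons shuffle_letter0_l.
  apply: hatH1_letter; exact: IHu.
case: b => [|l].
  rewrite [word_prod (rcons v _)]word_prod_rcons shuffle_letter0_r.
  apply: hatH1_letter; exact: IHv.
rewrite [word_prod (rcons u _)]word_prod_rcons [word_prod (rcons v _)]word_prod_rcons.
apply: hatH0_hatH1; apply: shuffle_core => [|k'|l'].
- exact: IHu.
- rewrite -[word_prod u * _]word_prod_rcons; exact: IHv.
- rewrite -[word_prod v * _]word_prod_rcons; exact: IHu.
Qed.

Lemma shuffle_hatH0_word u v : admissible u -> admissible v ->
  hatH0 (shuffle_hbar (word_prod u) (word_prod v)).
Proof.
have w1 : word_prod [::] = 1 by rewrite /word_prod big_nil.
case/lastP: u => [|u a] hu hv; first by rewrite w1 shuffle_1w; exact: hatH0_word.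
case/lastP: v hv => [|v b] hv; first by rewrite w1 shuffle_w1; exact: hatH0_word.
move: hu hv; rewrite /admissible !last_rcons -!size_eq0 !size_rcons /=.
case: a b => [|k] [|l] // _ _.
rewrite [word_prod (rcons u _)]word_prod_rcons [word_prod (rcons v _)]word_prod_rcons.
apply: shuffle_core => [|k'|l'].
- exact: shuffle_hatH1.
- rewrite -[word_prod u * _]word_prod_rcons; exact: shuffle_hatH1.
- rewrite -[word_prod v * _]word_prod_rcons; exact: shuffle_hatH1.
Qed.

Lemma shuffle_hatH0 x y : hatH0 x -> hatH0 y -> hatH0 (shuffle_hbar x y).
Proof.
move=> hx hy; elim/hatH0_ind: x / hx => [u hu|c x x' IHx IHx']; last first.
  rewrite shuffleDl; exact: (hatH0_lin c IHx IHx').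
elim/hatH0_ind: y / hy => [v hv|c y y' IHy IHy']; last first.
  rewrite shuffleDr; exact: (hatH0_lin c IHy IHy').
exact: shuffle_hatH0_word.
Qed.

Lemma harm_hatH0 u v : admissible u -> admissible v -> hatH0 (embed (harm u v)).
Proof.
have hM (x : frakA) k : hatH0 (embed (x * wd [:: k.+1])).
  elim/free_ind: x => [w|c x y IHx IHy].
    by rewrite wdM cats1 embed_wd; apply: hatH0_word; rewrite /admissible last_rcons orbT.
  rewrite linM embed_lin; exact: (hatH0_lin c IHx IHy).
have eD x y : embed (x + y) = embed x + embed y.
  by have := embed_lin 1 x y; rewrite !scale1r.
case/lastP: u => [|u a] hu hv; first by rewrite harm0w embed_wd; exact: hatH0_word.
case/lastP: v hv => [|v b] hv; first by rewrite harmw0 embed_wd; exact: hatH0_word.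
move: hu hv; rewrite /admissible !last_rcons -!size_eq0 !size_rcons /=.
case: a b => [|k] [|l] // _ _; rewrite harm_rcons !eD.
by do 2?[apply: hatH0D]; exact: hM.
Qed.

Lemma harmonic_hatH0 x y : hatH0 x -> hatH0 y -> hatH0 (harmonic_hbar x y).
Proof.
(* The induction runs over elements of [hatH0] while [harmonicA] acts on coordinates, so coordinates
   are carried existentially and identified by [embed_inj]. *)
move=> hx hy; suff [v Ev] : exists v, embed v = x /\
    forall w, hatH0 (embed w) -> hatH0 (embed (harmonicA v w)).
  case: Ev => Ex H; rewrite -Ex; case: (hy) => w _ Ey; rewrite -Ey harmonicE.
  by apply: H; rewrite Ey.
elim/hatH0_ind: x / hx => [u hu|c x x' [v [<- IHx]] [v' [<- IHx']]]; last first.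
  exists (c *: v + v'); split; first exact: embed_lin.
  move=> w hw; rewrite /harmonicA bilinear_extDl embed_lin.
  by apply: hatH0_lin; [exact: IHx|exact: IHx'].
exists (wd u); split; first exact: embed_wd.
move=> w hw; suff [v [/embed_inj <- //]] : exists v, embed v = embed w /\
    hatH0 (embed (harmonicA (wd u) v)).
elim/hatH0_ind: (embed w) / hw => [v hv|c y1 y2 [v1 [<- h1]] [v2 [<- h2]]].
  exists (wd v); split; first exact: embed_wd.
  rewrite /harmonicA bilinear_ext_wd; exact: harm_hatH0.
exists (c *: v1 + v2); split; first exact: embed_lin.
rewrite /harmonicA bilinear_extDr embed_lin; exact: (hatH0_lin c h1 h2).
Qed.

End Closure.

(** * Words as densities *)

Section EvalHom.
Context {R : realType} (omega : R).
Implicit Types c d : Qh.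

Lemma evalCD c d : evalC omega (c + d) = evalC omega c + evalC omega d.
Proof. by rewrite /evalC rmorphD hornerD. Qed.

Lemma evalCM c d : evalC omega (c * d) = evalC omega c * evalC omega d.
Proof. by rewrite /evalC rmorphM hornerM. Qed.

Lemma evalC1 : evalC omega 1 = 1.
Proof. by rewrite /evalC rmorph1 hornerC. Qed.

Lemma evalC_hbarX n : evalC omega (hbar ^+ n) = hval omega ^+ n.
Proof. by rewrite /evalC rmorphXn /= map_polyX horner_exp hornerX. Qed.
End EvalHom.

Section Words.
Context {R : realType}.
Local Open Scope complex_scope.
Variable omega : R.
Hypothesis om0 : 0 < omega.
Implicit Types (p q : seq bool) (e : R) (s : R[i]).
Local Notation h := (hval omega).

Let h0 : h != 0. Proof. exact: hval_neq0. Qed.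

Definition nb p := count id p.
Definition na p := count negb p.
(** For a reversed word: the word begins with b. The default value excludes the empty word. *)
Definition good p := last false p.
(** Keeps the lines Re t = -n e with 1 <= n <= N inside the strip of [Gf]. *)
Definition small N e := (0 < e < 1) && (omega * (N%:R * e) < 1).

Lemma small_le n N e : (n <= N)%N -> small N e -> small n e.
Proof.
move=> hn /andP[/andP[e0 e1] h1]; rewrite /small e0 e1 /=.
by apply: le_lt_trans h1; rewrite ler_pM2l // ler_pM2r // ler_nat.
Qed.

Lemma small_01 N e : small N e -> 0 < e < 1.
Proof. by case/andP. Qed.

Lemma small_strip n e : (0 < n)%N -> small n e -> 0 < omega * (n%:R * e) < 1.
Proof. by move=> n0 /andP[/andP[e0 _] ->]; rewrite andbT !mulr_gt0 // ltr0n. Qed.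

Definition epsz N : R := (N.+2%:R * (1 + omega))^-1.

Lemma epszP N : small N (epsz N).
Proof.
have n0 : 0 <= N%:R :> R by [].
have E : N.+2%:R = N%:R + 2 :> R by rewrite -addn2 natrD.
have L (x : R) : 0 <= x -> 1 < (x + 2) * (1 + omega) /\ omega * x < (x + 2) * (1 + omega).
  move=> x0; have m0 : 0 <= x * omega by rewrite mulr_ge0 // ltW.
  have m1 : 0 < omega by [].
  by split; nra.
have [p1 p2] := L _ n0; rewrite -E in p1 p2.
have p0 : 0 < N.+2%:R * (1 + omega) by apply: lt_trans p1.
by rewrite /small /epsz invr_gt0 p0 invf_lt1 // p1 /= mulrA ltr_pdivrMr // mul1r.
Qed.

(** The factor ['i] is that of dt = i dy, so densities are integrated against dy. *)
Definition Kl e (y : R) : R[i] := 'i * ker ((- e) +i* y).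

(* p is a reversed word (its head is the last letter); dens e p lives on the line
   Re t = - (nb p) e.  A word whose first letter is a gets the junk density 0. *)
Fixpoint dens e p : R -> R[i] :=
  match p with
  | [::] => fun=> 0
  | true :: p' => if p' is [::] then Kl e else cconv (Kl e) (dens e p')
  | false :: p' => fun y => Gf omega ((- ((nb p')%:R * e)) +i* y) * dens e p' y
  end.

Lemma good_ind (P : seq bool -> Prop) : P [:: true] ->
  (forall x p, good p -> P p -> P (x :: p)) -> forall p, good p -> P p.
Proof.
move=> P1 PS; elim=> [|x [|y p] IH] // g; first by case: x g.
exact: PS (IH g).
Qed.

Lemma goodS x p : good p -> good (x :: p).
Proof. by case: p. Qed.

Lemma goodF p : good (false :: p) -> good p.
Proof. by case: p. Qed.

Lemma good_nb p : good p -> (0 < nb p)%N.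
Proof.
move: p; apply: good_ind => // x p _ hp; apply: leq_trans hp _; exact: leq_addl.
Qed.

Lemma dens_true e p : good p -> dens e (true :: p) = cconv (Kl e) (dens e p).
Proof. by case: p. Qed.

Lemma Wt_Kl e : 0 < e < 1 -> Wt (Kl e).
Proof. exact: Wt_ker. Qed.

Lemma Wt_dens e p : good p -> small (nb p) e -> Wt (dens e p).
Proof.
move: p; apply: good_ind => [/small_01|x p gp IH hs]; first exact: Wt_Kl.
have hp : small (nb p) e by apply: small_le hs; exact: leq_addl.
case: x hs => hs.
  rewrite dens_true //; apply: Wt_conv; [exact: Wt_Kl (small_01 hs)|exact: IH].
apply: Wt_Gf; [exact: small_strip (good_nb gp) hp|exact: IH].
Qed.

Lemma bL1_densF e p : good p -> small (nb p) e -> bL1 (dens e (false :: p)).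
Proof.
move=> gp hp; apply: bL1_Gf => //; [exact: small_strip (good_nb gp) hp|exact: Wt_dens].
Qed.

Definition Eint e p : R[i] := cint (dens e p).

(** * The shuffle product as convolution of densities *)

Lemma cconv_lin (k F G : R -> R[i]) (c : R[i]) y : Wt k -> Wt F -> Wt G ->
  cconv k (fun t => c * F t + G t) y = c * cconv k F y + cconv k G y.
Proof.
move=> kW FW GW; have cF := cintble_convW y kW FW; have cG := cintble_convW y kW GW.
rewrite /cconv -cintZ // -cintD //; last exact: cintbleZ.
by apply: eq_cint => x; rewrite mulrDr mulrCA.
Qed.

(** Inside the convolution at y the arguments of the two factors G add up to the constant -(a + b) +
    i y, so [GfM] applies under the integral and G(s + s') comes out. *)
Lemma conv_GfM a b (f g : R -> R[i]) y :
  0 < omega * a < 1 -> 0 < omega * b < 1 -> 0 < omega * (a + b) < 1 -> Wt f -> Wt g ->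
  cconv (fun y => Gf omega ((- a) +i* y) * f y) (fun y => Gf omega ((- b) +i* y) * g y) y =
  Gf omega ((- (a + b)) +i* y) * (h * cconv f g y +
    (1 * cconv (fun y => Gf omega ((- a) +i* y) * f y) g y +
     cconv f (fun y => Gf omega ((- b) +i* y) * g y) y)).
Proof.
move=> ha hb hab fW gW.
have FW := Wt_Gf ha fW; have GW := Wt_Gf hb gW.
have c1 := cintble_convW y fW gW; have c2 := cintble_convW y FW gW.
have c3 := cintble_convW y fW GW.
rewrite mul1r /cconv -cintZ // -(cintD c2 c3) -cintD; [|exact: cintbleZ|exact: cintbleD].
rewrite -cintZ; last by apply: cintbleD; [exact: cintbleZ|exact: cintbleD].
apply: eq_cint => x.
have SE : ((- a) +i* x) + ((- b) +i* (y - x)) = (- (a + b)) +i* y.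
  by apply/eqP; rewrite eq_complex /= opprD (addrC x) subrK !eqxx.
have := @GfM _ omega ((- a) +i* x) ((- b) +i* (y - x)).
rewrite SE !stripE ha hb hab => /(_ isT isT isT) M.
transitivity (Gf omega ((- a) +i* x) * Gf omega ((- b) +i* (y - x)) * (f x * g (y - x))).
  by rewrite mulrACA.
by rewrite M; ring.
Qed.

(* rel e n m x F: x is a combination of words of length at most m with n letters b
   each, and F is the same combination of their densities. *)
Inductive rel e : nat -> nat -> frakH -> (R -> R[i]) -> Prop :=
| rel_wd p m : good p -> (size p <= m)%N -> small (nb p) e ->
    rel e (nb p) m (wd (rev p)) (dens e p)
| rel_lin n m c x y F G : rel e n m x F -> rel e n m y G ->
    rel e n m (c *: x + y) (fun t => evalC omega c * F t + G t).

Lemma rel_Wt e n m x F : rel e n m x F -> [/\ Wt F, (0 < n)%N & small n e].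
Proof.
elim=> [p {}m gp _ sp|{}n {}m c {}x y {}F G _ [W1 n0 sn] _ [W2 _ _]].
  by split=> //; [exact: Wt_dens|exact: good_nb].
by split=> //; apply: WtD => //; exact: WtZ.
Qed.

Lemma rel_mono e n m m' x F : (m <= m')%N -> rel e n m x F -> rel e n m' x F.
Proof.
move=> hm r; elim: r hm => [p {}m gp sp np|{}n {}m c {}x y {}F G _ IH1 _ IH2] hm.
  by apply: rel_wd => //; exact: leq_trans hm.
by apply: rel_lin; [exact: IH1|exact: IH2].
Qed.

Lemma wd_rev_cons (b : bool) p : wd (rev p) * wd [:: b] = wd (rev (b :: p)).
Proof. by rewrite wdM rev_cons cats1. Qed.

Lemma rel_b e n m x F : rel e n m x F -> small n.+1 e ->
  rel e n.+1 m.+1 (x * gen_b) (cconv (Kl e) F).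
Proof.
elim=> [p {}m gp sp np|{}n {}m c {}x y {}F G r1 IH1 r2 IH2] sn.
  rewrite [wd _ * _]wd_rev_cons -dens_true //.
  by apply: (@rel_wd e (true :: p)) => //; exact: goodS.
have [W1 _ _] := rel_Wt r1; have [W2 _ _] := rel_Wt r2.
have -> : cconv (Kl e) (fun t => evalC omega c * F t + G t) =
    (fun t => evalC omega c * cconv (Kl e) F t + cconv (Kl e) G t).
  by apply/funext => t; apply: cconv_lin => //; exact: Wt_Kl (small_01 sn).
rewrite linM; apply: rel_lin; [exact: IH1|exact: IH2].
Qed.

Lemma rel_a e n m x F : rel e n m x F ->
  rel e n m.+1 (x * gen_a) (fun y => Gf omega ((- (n%:R * e)) +i* y) * F y).
Proof.
elim=> [p {}m gp sp np|{}n {}m c {}x y {}F G r1 IH1 r2 IH2].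
  rewrite [wd _ * _]wd_rev_cons.
  by apply: (@rel_wd e (false :: p)) => //; exact: goodS.
have -> : (fun y => Gf omega ((- (n%:R * e)) +i* y) * (evalC omega c * F y + G y)) =
    (fun y => evalC omega c * (Gf omega ((- (n%:R * e)) +i* y) * F y) +
              Gf omega ((- (n%:R * e)) +i* y) * G y).
  by apply/funext => t; rewrite mulrDr mulrCA.
rewrite linM; exact: rel_lin IH1 IH2.
Qed.

Lemma comb_sum3 (V : lmodType Qh) (c : Qh) (x y z : V) :
  x + y + c *: z = c *: z + (1 *: x + y).
Proof. by rewrite scale1r addrC. Qed.

(** The shuffle of two words ending in a, short of its final a. That letter is split off because it
    is what makes the density integrable in [rel_EE]. *)
Definition shuffle_pre p q : frakH :=
  shuffle_rev (false :: p) q + shuffle_rev p (false :: q) + hbar *: shuffle_rev p q.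

Lemma rel_pre e p q m : good p -> good q -> small (nb p + nb q) e ->
  rel e (nb p + nb q) m (shuffle_rev (false :: p) q) (cconv (dens e (false :: p)) (dens e q)) ->
  rel e (nb p + nb q) m (shuffle_rev p (false :: q)) (cconv (dens e p) (dens e (false :: q))) ->
  rel e (nb p + nb q) m (shuffle_rev p q) (cconv (dens e p) (dens e q)) ->
  exists2 F, rel e (nb p + nb q) m (shuffle_pre p q) F &
    (fun y => Gf omega ((- ((nb p + nb q)%:R * e)) +i* y) * F y) =
    cconv (dens e (false :: p)) (dens e (false :: q)).
Proof.
move=> gp gq sm r1 r2 r3.
have sp : small (nb p) e by apply: small_le sm; exact: leq_addr.
have sq : small (nb q) e by apply: small_le sm; exact: leq_addl.
exists (fun t => evalC omega hbar * cconv (dens e p) (dens e q) t +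
  (evalC omega 1 * cconv (dens e (false :: p)) (dens e q) t +
   cconv (dens e p) (dens e (false :: q)) t)).
  rewrite /shuffle_pre comb_sum3; exact: rel_lin r3 (rel_lin 1 r1 r2).
apply/funext => y; rewrite evalC1 -[hbar]expr1 evalC_hbarX expr1 natrD mulrDl.
apply: esym; apply: conv_GfM; [exact: small_strip (good_nb gp) sp|
  exact: small_strip (good_nb gq) sq| |exact: Wt_dens|exact: Wt_dens].
rewrite -mulrDl -natrD; apply: small_strip sm.
by rewrite addn_gt0 good_nb.
Qed.

(** Induction along [shuffle_rev]: a letter b is pulled out by associativity and commutativity of
    convolution, two letters a are resolved by [conv_GfM]. *)
Lemma rel_shuffle e p q : good p -> good q -> small (nb p + nb q) e ->
  rel e (nb p + nb q) (size p + size q) (shuffle_rev p q) (cconv (dens e p) (dens e q)).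
Proof.
have [n] := ubnP (size p + size q); elim: n p q => // n IH p q hn gp gq sm.
have sp : small (nb p) e by apply: small_le sm; exact: leq_addr.
have sq : small (nb q) e by apply: small_le sm; exact: leq_addl.
have Kw := Wt_Kl (small_01 sm).
have Wp := Wt_dens gp sp; have Wq := Wt_dens gq sq.
case: p hn gp sm sp Wp => [|x p] // hn gp sm sp Wp.
case: x hn gp sm sp Wp => hn gp sm sp Wp.
  have -> : shuffle_rev (true :: p) q = shuffle_rev p q * gen_b by case: (q) gq.
  have [p0|p0] := eqVneq p [::].
    rewrite p0 shuffle_revE; apply: rel_b; first exact: rel_wd.
    by move: sm; rewrite p0.
  have {gp} gp : good p by case: (p) p0 gp.
  have sp' : small (nb p) e by apply: small_le sp; exact: leq_addl.
  have -> : cconv (dens e (true :: p)) (dens e q) = cconv (Kl e) (cconv (dens e p) (dens e q)).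
    by apply/funext => y; rewrite dens_true // cconvAW //; exact: Wt_dens.
  by apply: rel_b => //; apply: IH => //; apply: small_le sm; rewrite leq_add2r leq_addl.
have {}gp := goodF gp.
have sp' : small (nb p) e by [].
case: q hn gq sm sq Wq => [|x q] // hn gq sm sq Wq.
case: x hn gq sm sq Wq => hn gq sm sq Wq.
  rewrite -[shuffle_rev _ _]/(shuffle_rev (false :: p) q * gen_b).
  rewrite -[size (true :: q)]/(size q).+1 addnS -[nb (true :: q)]/(nb q).+1 addnS.
  have sm' : small (nb (false :: p) + nb q).+1 e by rewrite -addnS.
  have [q0|q0] := eqVneq q [::].
    rewrite q0 shuffle_rev0 !addn0.
    have -> : cconv (dens e (false :: p)) (dens e [:: true]) = cconv (Kl e) (dens e (false :: p)).
      by apply/funext => y; rewrite cconvCW.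
    apply: rel_b; first by apply: rel_wd => //; exact: goodS.
    by move: sm'; rewrite q0 addn0.
  have {gq} gq : good q by case: (q) q0 gq.
  have sq' : small (nb q) e by apply: small_le sq; exact: leq_addl.
  have Wq' := Wt_dens gq sq'.
  have -> : cconv (dens e (false :: p)) (dens e (true :: q)) =
      cconv (Kl e) (cconv (dens e (false :: p)) (dens e q)).
    rewrite (dens_true e gq); apply/funext => y.
    transitivity (cconv (cconv (dens e (false :: p)) (Kl e)) (dens e q) y).
      exact: esym (cconvAW y Wp Kw Wq').
    have EK : cconv (dens e (false :: p)) (Kl e) = cconv (Kl e) (dens e (false :: p)).
      by apply/funext => z; exact: (cconvCW z Wp Kw).
    apply: etrans (congr1 (fun f => cconv f (dens e q) y) EK) _.
    exact: (cconvAW y Kw Wp Wq').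
  apply: rel_b => //; apply: IH => //; first by move: hn; rewrite /= addnS ltnS.
  exact: small_le (leqnSn _) sm'.
have {}gq := goodF gq.
rewrite -[shuffle_rev _ _]/(shuffle_pre p q * gen_a).
have r1 : rel e (nb p + nb q) (size p + size q).+1 (shuffle_rev (false :: p) q)
    (cconv (dens e (false :: p)) (dens e q)).
  have lt1 : (size (false :: p) + size q < n)%N by move: hn; rewrite /= addnS ltnS.
  exact: (IH (false :: p) q lt1 (goodS false gp) gq sm).
have r2 : rel e (nb p + nb q) (size p + size q).+1 (shuffle_rev p (false :: q))
    (cconv (dens e p) (dens e (false :: q))).
  rewrite -addnS; exact: (IH p (false :: q) hn gp (goodS false gq) sm).
have r3 : rel e (nb p + nb q) (size p + size q).+1 (shuffle_rev p q)
    (cconv (dens e p) (dens e q)).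
  (* The hbar term is one letter shorter than the other two, which is why [rel] only bounds the
     length. *)
  apply: (rel_mono (leqnSn _)); apply: IH => //.
  by move: hn; rewrite /= addnS !ltnS => /ltnW.
have [F rF <-] := rel_pre gp gq sm r1 r2 r3.
rewrite -[size (false :: q)]/(size q).+1 addnS; exact: rel_a rF.
Qed.

(** * Duality between the letters a and b *)

Definition Tp e p s : R[i] :=
  if p is [::] then 1 else Tf omega ((nb p)%:R * e) (dens e p) s.

Definition ok p := (p == [::]) || good p.

Lemma Tp_good e p s : good p -> Tp e p s = Tf omega ((nb p)%:R * e) (dens e p) s.
Proof. by case: p. Qed.

Lemma okT p : ok p -> good (true :: p).
Proof. by case: p. Qed.

(** Convolution becomes multiplication, and the Fourier transform of the kernel is G / hbar: b acts
    on transforms as a acts on densities, up to hbar. The empty word plays the part of a point mass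
    at 0, of transform 1. *)
Lemma Tp_true e p s : ok p -> small (nb p).+1 e -> strip omega s ->
  Tp e (true :: p) s = Gf omega s / h * Tp e p s.
Proof.
move=> okp sm ss; have e01 := small_01 sm.
case/orP: okp => [/eqP ->|gp].
  rewrite /Tp -[nb _]/1%N mul1r mulr1; exact: Tf_ker.
rewrite (Tp_good _ _ gp) (Tp_good _ _ (goodS true gp)) dens_true //.
have -> : (nb (true :: p))%:R * e = e + (nb p)%:R * e.
  by rewrite -[nb (true :: p)]/(nb p).+1 -natr1 mulrDl mul1r addrC.
rewrite Tf_conv //; [|exact: Wt_Kl|by apply: Wt_dens => //; exact: small_le sm].
by congr (_ * _); exact: Tf_ker.
Qed.

(* Moving a letter from p to q multiplies this by hbar^(+-1); the Fubini symmetry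
   handles the letter b. *)
Definition pairing e1 e2 p q : R[i] :=
  cint (fun y => dens e1 p y * Tp e2 q ((- ((nb p)%:R * e1)) +i* y)).

Lemma pairing_sym e1 e2 p q : good p -> good q -> small (nb p) e1 -> small (nb q) e2 ->
  cintble (fun y => dens e1 p y * Tp e2 q ((- ((nb p)%:R * e1)) +i* y)) /\
  pairing e1 e2 p q = pairing e2 e1 q p.
Proof.
move=> gp gq sp sq.
have S1 : strip omega ((- ((nb p)%:R * e1))%:C + 0).
  by rewrite addr0 -[_%:C]/(_ +i* 0) stripE; exact: small_strip (good_nb gp) sp.
have [I J] := Tf_fubini (Wt_dens gp sp) (Wt_dens gq sq) S1 (small_strip (good_nb gq) sq).
have Ef : (fun y => dens e1 p y * Tp e2 q ((- ((nb p)%:R * e1)) +i* y)) =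
    (fun y => dens e1 p y * Tf omega ((nb q)%:R * e2) (dens e2 q)
       (0 + ((- ((nb p)%:R * e1)) +i* y))).
  by apply/funext => y; rewrite Tp_good // add0r.
split; first by rewrite Ef.
rewrite /pairing Ef J; apply: eq_cint => y.
by rewrite mulr0 mul0r expC0 mul1r mulrC Tp_good.
Qed.

Lemma pairing_F e1 e2 p q : good p -> ok q -> small (nb p) e1 -> small (nb q).+1 e2 ->
  pairing e1 e2 (false :: p) q = h * pairing e1 e2 p (true :: q).
Proof.
move=> gp oq sp sq; have [I _] := pairing_sym gp (okT oq) sp sq.
rewrite /pairing -(cintZ h I); apply: eq_cint => y.
rewrite -[nb (false :: p)]/(nb p) Tp_true //; last first.
  by rewrite stripE; exact: small_strip (good_nb gp) sp.
rewrite -[dens e1 (false :: p) y]/(Gf omega ((- ((nb p)%:R * e1)) +i* y) * dens e1 p y).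
by field.
Qed.

Lemma Eint_pairing e1 e2 p : Eint e1 p = pairing e1 e2 p [::].
Proof. by apply: eq_cint => y; rewrite mulr1. Qed.

Lemma nb_size p : (nb p <= size p)%N. Proof. exact: count_size. Qed.

(** Each a at the head of [p] passes to [q] as a b by [pairing_F]; each b passes as an a, by the
    same move between two uses of [pairing_sym]. The letters accumulate in reverse, whence
    [catrev]. *)
Lemma dual_pairing p : good p -> forall q e1 e2, good q ->
  small (size p + size q) e1 -> small (size p + size q) e2 ->
  h ^+ nb p * pairing e1 e2 p q = h ^+ na p * Eint e2 (catrev (map negb p) q).
Proof.
have sl n q e : (size q <= n)%N -> small n e -> small (nb q) e.
  by move=> hq; apply: small_le; exact: leq_trans (nb_size q) hq.
have slS n q e : (size q < n)%N -> small n e -> small (nb q).+1 e.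
  by move=> hq; apply: small_le; exact: leq_ltn_trans (nb_size q) hq.
move: p; apply: good_ind => [|x p gp IH] q e1 e2 gq s1 s2.
  have [_ ->] := pairing_sym (p := [:: true]) isT gq (sl _ _ _ (leq_addr _ _) s1)
    (sl _ _ _ (leq_addl _ _) s2).
  rewrite /= expr1 expr0 mul1r (Eint_pairing e2 e1) pairing_F //.
    exact: sl (leq_addl _ _) s2.
  by apply: small_le s1.
case: x s1 s2 => s1 s2.
  have sq2 := sl _ _ _ (leq_addl _ _) s2.
  have sp1 : small (nb p) e1 by apply: sl s1; rewrite /= addSn -addnS leq_addr.
  have [_ ->] := pairing_sym (goodS true gp) gq (sl _ _ _ (leq_addr _ _) s1) sq2.
  rewrite -[nb (true :: p)]/(nb p).+1 exprSr -mulrA -pairing_F //; last first.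
  - by apply: slS s1; rewrite /= addSn ltnS leq_addr.
  - by rewrite /ok gp orbT.
  have [_ ->] := pairing_sym (goodS false gq) gp sq2 sp1.
  by apply: IH; rewrite ?addnS //; exact: goodS.
rewrite pairing_F //; last first.
- by apply: slS s2; rewrite /= addSn ltnS leq_addl.
- by apply: sl s1; rewrite /= addSn -addnS leq_addr.
- by rewrite /ok gq orbT.
rewrite -[nb (false :: p)]/(nb p) -[na (false :: p)]/(na p).+1 exprS mulrCA IH ?addnS ?mulrA //.
exact: goodS.
Qed.

(** The final a is moved first: it turns the empty second word, which has no density, into
    [[:: true]], from where [dual_pairing] can start. *)
Lemma dual_Eint p e1 e2 : good p -> small (size p).+1 e1 -> small (size p).+1 e2 ->
  h ^+ nb p * Eint e1 (false :: p) = h ^+ (na p).+1 * Eint e2 (rev (map negb (false :: p))).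
Proof.
move=> gp s1 s2; rewrite (Eint_pairing e1 e2) pairing_F //; last first.
- by apply: small_le s2.
- by apply: small_le s1; exact: leq_trans (nb_size p) (leqnSn _).
by rewrite mulrCA dual_pairing ?addn1 // exprS mulrA.
Qed.

(** Duality relates both sides to one integral of the dual word, taken at a third parameter. *)
Lemma Eint_indep p e1 e2 : good p -> small (size p).+1 e1 -> small (size p).+1 e2 ->
  Eint e1 (false :: p) = Eint e2 (false :: p).
Proof.
move=> gp s1 s2; apply: (mulfI (expf_neq0 (nb p) h0)).
by rewrite (dual_Eint gp s1 (epszP _)) (dual_Eint gp s2 (epszP _)).
Qed.

(** * The functional [EE] and its multiplicativity *)

Definition Ew (w : seq bool) : R[i] :=
  if w is [::] then 1 else Eint (epsz (size w)) (rev w).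

Definition EE : frakH -> R[i] := msum (fun m c => evalC omega c * Ew (fmonom_val m)).

Lemma EE_lin (c : Qh) (x y : frakH) : EE (c *: x + y) = evalC omega c * EE x + EE y.
Proof.
rewrite /EE; apply: (@msum_lin _ _ _ _ (fun z => evalC omega c * z)) => [m a b|m d|a b].
- by rewrite evalCD mulrDl.
- by rewrite evalCM mulrA.
- by rewrite mulrDr.
Qed.

Lemma EE_wd w : EE (wd w) = Ew w.
Proof. by rewrite /EE msum_wd evalC1 mul1r. Qed.

Lemma EE0 : EE 0 = 0.
Proof. by rewrite /EE /msum msupp0 big_seq_fset0. Qed.

Lemma EEZ (c : Qh) (x : frakH) : EE (c *: x) = evalC omega c * EE x.
Proof. by have := EE_lin c x 0; rewrite EE0 !addr0. Qed.

Lemma EED (x y : frakH) : EE (x + y) = EE x + EE y.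
Proof. by have := EE_lin 1 x y; rewrite scale1r evalC1 mul1r. Qed.

Lemma Ew_rev p : good p -> Ew (rev (false :: p)) = Eint (epsz (size p).+1) (false :: p).
Proof.
move=> gp; have : rev (false :: p) != [::] by rewrite -size_eq0 size_rev.
rewrite /Ew; case E : (rev (false :: p)) => [|x w] // _.
by rewrite -E revK size_rev.
Qed.

(** [EE] evaluates words of different lengths at different parameters; [Eint_indep] brings them all
    to the common [e]. *)
Lemma rel_EE e n m x F : rel e n m x F -> small m.+1 e ->
  cintble (fun y => Gf omega ((- (n%:R * e)) +i* y) * F y) /\
  EE (x * gen_a) = cint (fun y => Gf omega ((- (n%:R * e)) +i* y) * F y).
Proof.
elim=> [p {}m gp sp np|{}n {}m c {}x y {}F G r1 IH1 r2 IH2] sm.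
  split; first exact: bL1_cintble (bL1_densF gp np).
  rewrite [wd _ * _]wd_rev_cons EE_wd Ew_rev //; apply: Eint_indep => //.
    exact: epszP.
  by apply: small_le sm; rewrite ltnS.
have [I1 E1] := IH1 sm; have [I2 E2] := IH2 sm.
have -> : (fun y => Gf omega ((- (n%:R * e)) +i* y) * (evalC omega c * F y + G y)) =
    (fun y => evalC omega c * (Gf omega ((- (n%:R * e)) +i* y) * F y) +
              Gf omega ((- (n%:R * e)) +i* y) * G y).
  by apply/funext => t; rewrite mulrDr mulrCA.
split; first by apply: cintbleD => //; exact: cintbleZ.
rewrite linM EE_lin E1 E2 -(cintZ _ I1) -cintD //; exact: cintbleZ.
Qed.

Definition okw (w : seq bool) : Prop := w = [::] \/ exists2 p, good p & rev w = false :: p.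

(** The shuffle has the convolution of the two densities as its density, and the integral of a
    convolution is the product of the integrals. *)
Lemma EE_shuffle_wd w w' : okw w -> okw w' ->
  EE (shuffle_hbar (wd w) (wd w')) = EE (wd w) * EE (wd w').
Proof.
have E1 : EE (1 : frakH) = 1 by rewrite -wd1 EE_wd.
case=> [->|[p gp Ep]]; first by rewrite wd1 shuffle_1w E1 mul1r.
case=> [->|[q gq Eq]]; first by rewrite wd1 shuffle_w1 E1 mulr1.
rewrite /shuffle_hbar bilinear_ext_wd Ep Eq -(revK w) Ep -(revK w') Eq !EE_wd !Ew_rev //.
(* [N] is the total length of the two words, so one parameter suits both factors and every word of
   their product. *)
set N := (size p + size q).+2; have eN := epszP N; set e := epsz N in eN *.
have sm : small (nb p + nb q) e.
  by apply: small_le eN; rewrite /N !leqW // leq_add // nb_size.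
have sp : small (nb p) e by apply: small_le sm; exact: leq_addr.
have sq : small (nb q) e by apply: small_le sm; exact: leq_addl.
have r1 : rel e (nb p + nb q) (size p + size q).+1 (shuffle_rev (false :: p) q)
    (cconv (dens e (false :: p)) (dens e q)).
  by apply: (@rel_shuffle e (false :: p) q) => //; exact: goodS.
have r2 : rel e (nb p + nb q) (size p + size q).+1 (shuffle_rev p (false :: q))
    (cconv (dens e p) (dens e (false :: q))).
  by rewrite -addnS; apply: (@rel_shuffle e p (false :: q)) => //; exact: goodS.
have r3 : rel e (nb p + nb q) (size p + size q).+1 (shuffle_rev p q)
    (cconv (dens e p) (dens e q)).
  by apply: (rel_mono (leqnSn _)); exact: rel_shuffle.
have [F rF EF] := rel_pre gp gq sm r1 r2 r3.
rewrite -[shuffle_rev _ _]/(shuffle_pre p q * gen_a).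
have [_ ->] := rel_EE rF eN; rewrite EF cint_conv; [|exact: bL1_densF..].
congr (_ * _); apply: Eint_indep => //; try exact: epszP.
- by apply: small_le eN; rewrite /N ltnS leqW // leq_addr.
- by apply: small_le eN; rewrite /N ltnS leqW // leq_addl.
Qed.

(* The iterated integral defining Z_word with all t_j shifted by s, as a recursion on
   the word x read from the left. *)
Fixpoint V e (x : seq bool) s : R[i] :=
  match x with
  | [::] => 1
  | false :: x' => Gf omega s * V e x' s
  | true :: x' => cint (fun y => Kl e y * V e x' (s + ((- e) +i* y)))
  end.

(** * Iterated integrals as transforms of the dual word *)

Lemma Tf_kerZ e s : 0 < e < 1 -> strip omega s ->
  Tf omega e (fun y => h * Kl e y) s = Gf omega s.
Proof.
move=> e01 ss; have I := bL1_cintble (bL1_Tf e ss (Wt_Kl e01)).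
transitivity (h * Tf omega e (Kl e) s).
  by rewrite /Tf -(cintZ h I); apply: eq_cint => y; rewrite mulrCA.
have -> : Tf omega e (Kl e) s = Gf omega s / h by exact: Tf_ker.
by field.
Qed.

(** Reading a b integrates a transform over a line. By [Tf_fubini] and the Fourier formula this
    multiplies the dual density by G, that is, puts an a at the head of [q]. *)
Lemma V_step e e' (x q : seq bool) (c : R[i]) s : 0 < e < 1 -> good q -> small (nb q) e' ->
  strip omega ((- e)%:C + s) ->
  (forall y, V e x (s + ((- e) +i* y)) = c * Tp e' q (s + ((- e) +i* y))) ->
  cintble (fun y => Kl e y * V e x (s + ((- e) +i* y))) /\
  h * V e (true :: x) s = c * Tp e' (false :: q) s.
Proof.
move=> e01 gq sq ss H.
have sb := small_strip (good_nb gq) sq.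
have [I J] := Tf_fubini (WtZ h (Wt_Kl e01)) (Wt_dens gq sq) ss sb.
have Ef : (fun y => Kl e y * V e x (s + ((- e) +i* y))) =
    (fun y => c / h * (h * Kl e y * Tf omega ((nb q)%:R * e') (dens e' q) (s + ((- e) +i* y)))).
  by apply/funext => y; rewrite H Tp_good //; field.
split; first by rewrite Ef; exact: cintbleZ.
rewrite -[V e (true :: x) s]/(cint _) Ef (cintZ _ I) J.
rewrite (Tp_good e' s (goodS false gq)) -[nb (false :: q)]/(nb q).
rewrite mulrA [h * (c / h)]mulrC divfK //; congr (_ * _).
apply: eq_cint => y; rewrite Tf_kerZ ?stripE // -mulrA; congr (_ * _).
Qed.

Lemma nb_negb (x : seq bool) : nb (map negb x) = na x.
Proof. by rewrite /nb count_map. Qed.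

Lemma good_negb (x : seq bool) : last true x = false -> good (map negb x).
Proof. by rewrite /good -[false]/(negb true) last_map => ->. Qed.

(** Reading [x] from the left matches building the dual density from its last letter. Each b lowers
    the abscissa by [e], and the hypotheses keep all partial sums in the strip; abscissa 0 is
    allowed only when a leading b moves off it before any G is evaluated. *)
Lemma V_Tp e e' (x : seq bool) s : 0 < e < 1 -> last true x = false -> small (size x) e' ->
  -1 < omega * (complex.Re s - (nb x)%:R * e) -> omega * complex.Re s <= 0 ->
  head false x || (omega * complex.Re s < 0) ->
  V e x s = h ^+ na x / h ^+ nb x * Tp e' (map negb x) s.
Proof.
move=> e01; have e0 : 0 < e by case/andP: e01.
have oe : 0 < omega * e by rewrite mulr_gt0.
elim: x s => [|b x IH] // s lx sm s1 s0 hd.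
have on : 0 <= omega * ((nb x)%:R * e) by rewrite !mulr_ge0 // ltW.
have sx : small (size x) e' by apply: small_le sm.
have nbx : (nb (map negb x) <= size x)%N by rewrite nb_negb; exact: count_size.
have hb0 : h ^+ nb x != 0 by rewrite expf_neq0.
case: b lx s1 hd sm => lx s1 hd sm.
  move: s1; rewrite -[nb (true :: x)]/(nb x).+1 -natr1 mulrDl mul1r => s1.
  have {}lx : last true x = false by exact: lx.
  have gq := good_negb lx.
  have ss : strip omega ((- e)%:C + s).
    by rewrite /strip raddfD /=; apply/andP; split; nra.
  have H y : V e x (s + ((- e) +i* y)) =
      h ^+ na x / h ^+ nb x * Tp e' (map negb x) (s + ((- e) +i* y)).
    apply: IH => //; rewrite raddfD /=; first by nra.
    - by nra.
    - by apply/orP; right; nra.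
  have sq : small (nb (map negb x)) e' by apply: small_le sx.
  have [_ E] := V_step e01 gq sq ss H.
  apply: (mulfI h0); rewrite [LHS]E -[map negb (true :: x)]/(false :: map negb x).
  rewrite -[na (true :: x)]/(na x) exprS.
  move: (h ^+ na x) (h ^+ nb x) hb0 => A B B0; field; by rewrite B0 h0.
have {}hd : omega * complex.Re s < 0 by exact: hd.
have {}s1 : -1 < omega * (complex.Re s - (nb x)%:R * e) by exact: s1.
have ss : strip omega s by rewrite /strip hd andbT; nra.
have oq : ok (map negb x).
  by case: (x) lx => [|y z] // lx; rewrite /ok good_negb // orbT.
have s2 : small (nb (map negb x)).+1 e' by apply: small_le sm.
rewrite -[map negb (false :: x)]/(true :: map negb x) -[na (false :: x)]/(na x).+1.
rewrite -[nb (false :: x)]/(nb x) -[V e (false :: x) s]/(Gf omega s * V e x s) Tp_true //.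
have [x0|x0] := eqVneq x [::].
  rewrite x0 -[V e [::] s]/(1 : R[i]) -[Tp e' _ s]/(1 : R[i]) -[na [::]]/0%N -[nb [::]]/0%N.
  by rewrite expr0 expr1; field.
rewrite IH //; last first.
- by rewrite hd orbT.
- by case: (x) x0 lx.
rewrite exprS; move: (h ^+ na x) (h ^+ nb x) hb0 => A B B0; field; by rewrite B0 h0.
Qed.

Lemma V_int e e' (x : seq bool) s : 0 < e < 1 -> last true x = false -> small (size x) e' ->
  -1 < omega * (complex.Re s - (nb x).+1%:R * e) -> omega * complex.Re s <= 0 ->
  cintble (fun y => Kl e y * V e x (s + ((- e) +i* y))).
Proof.
move=> e01 lx sm; rewrite -natr1 mulrDl mul1r => s1 s0; have e0 : 0 < e by case/andP: e01.
have oe : 0 < omega * e by rewrite mulr_gt0.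
have on : 0 <= omega * ((nb x)%:R * e) by rewrite !mulr_ge0 // ltW.
have H y : V e x (s + ((- e) +i* y)) =
    h ^+ na x / h ^+ nb x * Tp e' (map negb x) (s + ((- e) +i* y)).
  apply: V_Tp => //; rewrite raddfD /=; first by nra.
  - by nra.
  - by apply/orP; right; nra.
have sq : small (nb (map negb x)) e'.
  by apply: small_le sm; rewrite nb_negb; exact: count_size.
have ss : strip omega ((- e)%:C + s).
  by rewrite /strip raddfD /=; apply/andP; split; nra.
by have [] := V_step e01 (good_negb lx) sq ss H.
Qed.

Lemma V_nseq e k (x : seq bool) s : V e (nseq k false ++ x) s = Gf omega s ^+ k * V e x s.
Proof. by elim: k => [|k IH]; rewrite ?expr0 ?mul1r //= IH exprS mulrA. Qed.

Lemma nb_code u : nb (Defs.code u) = size u.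
Proof.
rewrite /nb; elim: u => [|k u IH] //=.
by rewrite count_cat -/(Defs.code u) IH count_nseq /= mul0n.
Qed.

Lemma na_code u : na (Defs.code u) = sumn u.
Proof.
rewrite /na; elim: u => [|k u IH] //=.
by rewrite count_cat -/(Defs.code u) IH count_nseq /= mul1n.
Qed.

Lemma rev_code u : admissible u -> u != [::] -> exists2 p, good p & rev (Defs.code u) = false :: p.
Proof.
case/lastP: u => [|u k] //; rewrite /admissible last_rcons -size_eq0 size_rcons /=.
case: k => // k _ _; exists (nseq k false ++ true :: rev (Defs.code u)).
  rewrite /good last_cat /=; case: u => [|j u] //=.
  by rewrite rev_cons last_rcons.
rewrite /Defs.code -cats1 map_cat flatten_cat rev_cat /= cats0 !rev_cons rev_nseq.
have E : rcons (nseq k false) false = false :: nseq k false by elim: (k) => //= j ->.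
by rewrite cat_rcons E.
Qed.

Lemma last_code u : admissible u -> u != [::] -> last true (Defs.code u) = false.
Proof.
move=> au u0; have [p _ E] := rev_code au u0.
by rewrite -(revK (Defs.code u)) E rev_cons last_rcons.
Qed.

Lemma I_omegaE k s : I_omega omega k s = h ^+ (k == 0%N) * Gf omega s ^+ k.
Proof. by case: k => [|k]; rewrite ?expr1 ?expr0 ?mulr1 ?mul1r. Qed.

Lemma line_integralE e (f : R[i] -> R[i]) :
  line_integral e f = 'i * cint (fun y => f ((- e) +i* y)).
Proof. by []. Qed.

(** Generalised for the induction: once the first variable is fixed at t, the same integral remains
    with shift s + t, and the factors depending on t alone join the prefactor [c]. *)
Lemma Z_shift e e' u s (c : R[i]) : 0 < e < 1 -> admissible u -> small (size (Defs.code u)) e' ->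
  -1 < omega * (complex.Re s - (size u)%:R * e) -> omega * complex.Re s <= 0 ->
  line_integrals e (size u) (fun ts : seq R[i] => c *
    ((\prod_(a < size u) (expC (two_pi_i * ts`_a) - 1)^-1) *
     (\prod_(a < size u) I_omega omega (nth 0%N u a) (s + \sum_(j < a.+1) ts`_j)))) =
  c * (h ^+ count (pred1 0%N) u * V e (Defs.code u) s).
Proof.
move=> e01; have e0 : 0 < e by case/andP: e01.
have oe : 0 < omega * e by rewrite mulr_gt0.
elim: u s c => [|k u IH] s c au sm s1 s0.
  by rewrite /= !big_ord0 expr0 !mulr1.
have on : 0 <= omega * ((size u)%:R * e) by rewrite !mulr_ge0 // ltW.
have s1' : -1 < omega * (complex.Re s - ((size u)%:R * e + e)).
  by move: s1; rewrite /= -natr1 mulrDl mul1r.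
have au' : admissible u by move: au; rewrite /admissible /=; case: (u).
have lx : last true (nseq k false ++ Defs.code u) = false.
  exact: (last_code au isT).
have smx : small (size (nseq k false ++ Defs.code u)) e' by apply: small_le sm.
have smu : small (size (Defs.code u)) e'.
  by apply: small_le smx; rewrite size_cat leq_addl.
(* The division by ['i] undoes the one inside [Kl]; the outer line integral supplies it again. *)
have inner y : line_integrals e (size u) (fun ts : seq R[i] => c *
    ((\prod_(a < (size u).+1) (expC (two_pi_i * (((- e) +i* y) :: ts)`_a) - 1)^-1) *
     (\prod_(a < (size u).+1) I_omega omega (nth 0%N (k :: u) a)
        (s + \sum_(j < a.+1) (((- e) +i* y) :: ts)`_j)))) =
    (c * h ^+ count (pred1 0%N) (k :: u) / 'i) *
    (Kl e y * V e (nseq k false ++ Defs.code u) (s + ((- e) +i* y))).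
  set t := (- e) +i* y.
  transitivity (c * ker t * I_omega omega k (s + t) *
      (h ^+ count (pred1 0%N) u * V e (Defs.code u) (s + t))).
    rewrite -IH //; last first.
    - by rewrite raddfD /=; nra.
    - by rewrite raddfD /=; nra.
    congr (line_integrals _ _ _); apply/funext => ts.
    rewrite big_ord_recl [X in _ * (_ * X)]big_ord_recl /= big_ord1 /=.
    have -> : \prod_(i < size u) I_omega omega (nth 0%N u i)
        (s + \sum_(j < (bump 0 i).+1) (t :: ts)`_j) =
        \prod_(i < size u) I_omega omega (nth 0%N u i) (s + t + \sum_(j < i.+1) ts`_j).
      by apply: eq_bigr => i _; rewrite big_ord_recl addrA.
    by rewrite /ker; move: (\prod_(_ < _) _) (\prod_(_ < _) _) => A B; ring.
  rewrite V_nseq I_omegaE /= exprD /Kl eq_sym.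
  have i0 : 'i != 0 :> R[i] by exact: neq0Ci.
  move: (h ^+ _) (h ^+ _) (_ ^+ k) (ker t) (V _ _ _) => A B C D G.
  by field.
rewrite -[size (k :: u)]/(size u).+1.
rewrite -[line_integrals _ _ _]/(line_integral e (fun t => line_integrals e (size u) _)).
rewrite line_integralE; under [in X in 'i * X]eq_cint => y do rewrite inner.
rewrite cintZ; last first.
  apply: (V_int (e' := e')) => //.
  by rewrite /nb count_cat count_nseq mul0n -/(nb (Defs.code u)) nb_code.
have i0 : 'i != 0 :> R[i] by exact: neq0Ci.
rewrite -[V e (Defs.code (k :: u)) s]/(cint _).
by move: (cint _) (h ^+ _) => A B; field.
Qed.

(** The balance of powers of hbar: letters a and explicit factors hbar on one side, letters b and
    the power from [phiw] on the other. *)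
Lemma sumn_predn u : (sumn u + count (pred1 0%N) u = size u + sumn (map predn u))%N.
Proof.
elim: u => [|k u IH] //=; case: k => [|k] /=.
  by rewrite !add0n addnCA IH add1n addSn.
by rewrite add0n -addnA IH !addSn addnCA.
Qed.

Lemma EE_phiw u : admissible u -> u != [::] ->
  EE (phiw u) = h ^+ sumn (map predn u) * Eint (epsz (size (Defs.code u))) (map negb (Defs.code u)).
Proof.
move=> au u0; rewrite phiwE EEZ evalC_hbarX EE_wd; congr (_ * _).
have [p gp E] := rev_code au u0.
rewrite /Ew /dual_word E /= -[negb false :: _]/(map negb (false :: p)) -E map_rev revK.
by rewrite size_map -(size_rev (Defs.code u)) E.
Qed.

(** At shift 0 the transform of the dual density is its total integral. The parameter [e] of the
    iterated integral is unrelated to the one used by [EE]. *)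
Lemma Z_word_phiw e u : admissible u -> u != [::] -> 0 < e < 1 ->
  omega * ((size u)%:R * e) < 1 -> Z_word omega e u = EE (phiw u).
Proof.
move=> au u0 e01 eu; have e0 : 0 < e by case/andP: e01.
have sm := epszP (size (Defs.code u)).
have Re0 : complex.Re (0 : R[i]) = 0 by [].
have s1 : -1 < omega * (complex.Re (0 : R[i]) - (size u)%:R * e).
  by rewrite Re0 sub0r mulrN ltrN2.
have := Z_shift 1 e01 au sm s1; rewrite Re0 mulr0 lexx mul1r => /(_ isT) ZE.
have -> : Z_word omega e u = h ^+ count (pred1 0%N) u * V e (Defs.code u) 0.
  rewrite -ZE /Z_word; congr (line_integrals _ _ _); apply/funext => ts.
  rewrite mul1r; congr (_ * _); apply: eq_bigr => i _; by rewrite add0r.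
rewrite EE_phiw // (V_Tp (e' := epsz (size (Defs.code u))) e01 (last_code au u0) sm) ?Re0 ?mulr0 //.
- rewrite Tp_good; last exact: good_negb (last_code au u0).
  have -> : Tf omega ((nb (map negb (Defs.code u)))%:R * epsz (size (Defs.code u)))
      (dens (epsz (size (Defs.code u))) (map negb (Defs.code u))) 0 =
      Eint (epsz (size (Defs.code u))) (map negb (Defs.code u)).
    by apply: eq_cint => y; rewrite mulr0 mul0r expC0 mul1r.
  rewrite mulrA mulrA -exprD nb_code na_code addnC sumn_predn exprD.
  by rewrite (mulrAC (h ^+ size u)) divff ?mul1r // expf_neq0.
- by rewrite nb_code sub0r mulrN ltrN2.
- by case: (u) u0.
Qed.

Lemma EE_word_prod u : admissible u -> EE (word_prod u) = EE (phiw u).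
Proof.
move=> au; have [->|u0] := eqVneq u [::]; first by rewrite /word_prod big_nil.
rewrite EE_phiw // word_prodE EEZ evalC_hbarX EE_wd.
have [p gp E] := rev_code au u0; have Ec : Defs.code u = rev (false :: p) by rewrite -E revK.
have sz : size (Defs.code u) = (size p).+1 by rewrite Ec size_rev.
have Em : map negb (Defs.code u) = rev (map negb (false :: p)) by rewrite Ec map_rev.
have nbE : nb p = size u by rewrite -nb_code Ec /nb count_rev.
have naE : (na p).+1 = sumn u by rewrite -na_code Ec /na count_rev.
rewrite Em {1}Ec Ew_rev // sz.
have D := dual_Eint gp (epszP (size p).+1) (epszP (size p).+1).
apply: (mulfI (expf_neq0 (nb p) h0)).
by rewrite mulrCA D naE !mulrA -!exprD nbE addnC sumn_predn.
Qed.

(** * Comparison of the two products *)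

Inductive okspan : frakH -> Prop :=
| okspan_wd w : okw w -> okspan (wd w)
| okspan_lin c x y : okspan x -> okspan y -> okspan (c *: x + y).

Lemma EE_shuffle x y : okspan x -> okspan y -> EE (shuffle_hbar x y) = EE x * EE y.
Proof.
elim=> [w ow|c {}x x' _ IH1 _ IH2] oy; last first.
  by rewrite shuffleDl !EE_lin IH1 // IH2 // mulrDl mulrA.
elim: oy => [w' ow'|c {}y y' _ IH1 _ IH2]; first exact: EE_shuffle_wd.
by rewrite shuffleDr !EE_lin IH1 // IH2 // mulrDr mulrCA.
Qed.

Lemma okspan0 : okspan 0.
Proof.
have o1 : okspan (wd [::]) by apply: okspan_wd; left.
by have := okspan_lin (-1) o1 o1; rewrite scaleN1r addNr.
Qed.

Lemma okspanZ c x : okspan x -> okspan (c *: x).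
Proof. by move=> ox; have := okspan_lin c ox okspan0; rewrite addr0. Qed.

Lemma okspan_word_prod u : admissible u -> okspan (word_prod u).
Proof.
move=> au; rewrite word_prodE; apply/okspanZ/okspan_wd.
by have [->|u0] := eqVneq u [::]; [left|right; exact: rev_code].
Qed.

Lemma okspan_phiw u : admissible u -> okspan (phiw u).
Proof.
move=> au; rewrite phiwE; apply/okspanZ/okspan_wd.
have [->|u0] := eqVneq u [::]; [by left|right].
have lu := last_code au u0.
rewrite /dual_word -map_rev revK; case: u {au} u0 lu => [|k u] // _ lu.
exists (map negb (nseq k false ++ Defs.code u)) => //; exact: good_negb.
Qed.

Lemma okspan_sum (v : frakA) (f : seq nat -> frakH) :
  (forall u, admissible u -> okspan (f u)) ->
  {in msupp v, forall u : {fmonom nat}, admissible u} ->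
  okspan (\sum_(u <- msupp v) v@_u *: f u).
Proof.
move=> of_ av; rewrite big_seq; elim/big_ind: _ => [|x y ox oy|u /av au].
- exact: okspan0.
- by have := okspan_lin 1 ox oy; rewrite scale1r.
- exact/okspanZ/of_.
Qed.

Lemma EE_sum (v : frakA) (f : seq nat -> frakH) :
  EE (\sum_(u <- msupp v) v@_u *: f u) = \sum_(u <- msupp v) evalC omega v@_u * EE (f u).
Proof.
rewrite (big_morph EE EED EE0); apply: eq_bigr => u _; exact: EEZ.
Qed.

Lemma EE_embed (v : frakA) : {in msupp v, forall u : {fmonom nat}, admissible u} ->
  EE (embed v) = EE (phi v).
Proof.
move=> av; rewrite (EE_sum v word_prod) [RHS](EE_sum v phiw).
rewrite !big_seq; apply: eq_bigr => u /av au; by rewrite EE_word_prod.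
Qed.

Lemma Z_omega_EE (eps : nat -> R) (v : frakA) :
  (forall r : nat, (0 < r)%N -> 0 < eps r < Num.min 1 (1 / (r%:R * omega))) ->
  {in msupp v, forall u : {fmonom nat}, admissible u} ->
  Z_omega omega eps (embed v) = EE (phi v).
Proof.
move=> heps av; rewrite /Z_omega embedK [RHS](EE_sum v phiw).
rewrite !big_seq; apply: eq_bigr => u /av au; congr (_ * _).
have [->|u0] := eqVneq (fmonom_val u) [::].
  by rewrite -[phiw [::]]/(1 : frakH) -wd1 EE_wd /Z_word /= !big_ord0 mulr1.
have r0 : (0 < size (fmonom_val u))%N by rewrite lt0n size_eq0.
have /andP[e0] := heps _ r0; rewrite lt_min => /andP[e1 e2].
apply: Z_word_phiw => //; first by rewrite e0.
have r0' : 0 < (size (fmonom_val u))%:R :> R by rewrite ltr0n.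
by move: e2; rewrite ltr_pdivlMr ?mulr_gt0 // mulrC -mulrA mulrCA.
Qed.

(** Both products have the value [EE w * EE w']: for the shuffle, [EE] is multiplicative on [w] and
    [w'] themselves; for the harmonic product, on their images under [phi]. The two values agree
    because [EE_embed] equates [EE] on an element and on its image. *)
Lemma Z_shuffle_harmonic (eps : nat -> R) (w w' : frakH) :
  (forall r : nat, (0 < r)%N -> 0 < eps r < Num.min 1 (1 / (r%:R * omega))) ->
  hatH0 w -> hatH0 w' ->
  Z_omega omega eps (shuffle_hbar w w' - harmonic_hbar w w') = 0.
Proof.
move=> heps hw hw'; have [v av Ev] := shuffle_hatH0 hw hw'.
have [v3 av3 Ev3] := harmonic_hatH0 hw hw'.
case: hw hw' => v1 av1 E1 [v2 av2 E2].
have Ev3' : v3 = harmonicA v1 v2.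
  apply: embed_inj; apply: etrans Ev3 _.
  apply: etrans (congr2 harmonic_hbar (esym E1) (esym E2)) _; exact: harmonicE.
have h3 : hatH0 (embed v3) by exists v3.
have hv : hatH0 (embed v) by exists v.
(* [Z_omega] works through coordinates on admissible words, so the difference is given admissible
   coordinates of its own; it is split only after passing to [EE], which is linear. *)
have [v4 av4 Ev4] : hatH0 (embed (-1 *: v3 + v)).
  rewrite embed_lin; exact: (hatH0_lin (-1) h3 hv).
have -> : shuffle_hbar w w' - harmonic_hbar w w' = embed v4.
  apply: esym; apply: etrans Ev4 _; apply: etrans (embed_lin _ _ _) _.
  rewrite Ev3 Ev scaleN1r; exact: addrC.
apply: etrans (Z_omega_EE heps av4) _.
have P4 : EE (phi v4) = evalC omega (-1) * EE (phi v3) + EE (phi v).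
  rewrite (embed_inj Ev4); exact: etrans (congr1 EE (phi_lin _ _ _)) (EE_lin _ _ _).
have o1 : okspan w by rewrite -E1; exact: (okspan_sum okspan_word_prod av1).
have o2 : okspan w' by rewrite -E2; exact: (okspan_sum okspan_word_prod av2).
have p1 : okspan (phi v1) by exact: (okspan_sum okspan_phiw av1).
have p2 : okspan (phi v2) by exact: (okspan_sum okspan_phiw av2).
have W1 : EE w = EE (phi v1) by rewrite -E1; exact: EE_embed.
have W2 : EE w' = EE (phi v2) by rewrite -E2; exact: EE_embed.
have P : EE (phi v) = EE (phi v1) * EE (phi v2).
  apply: etrans (esym (EE_embed av)) _; rewrite Ev.
  by apply: etrans (EE_shuffle o1 o2) _; rewrite W1 W2.
have P3 : EE (phi v3) = EE (phi v1) * EE (phi v2).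
  rewrite Ev3'; exact: etrans (congr1 EE (esym (shuffle_phi v1 v2))) (EE_shuffle p1 p2).
have evN : evalC omega (-1) = -1.
  apply: (addrI (evalC omega 1)); rewrite -evalCD subrr evalC1 subrr.
  by rewrite /evalC rmorph0 horner0.
by rewrite P4 P3 P evN mulN1r addNr.
Qed.

End Words.

Theorem theorem4p6 (R : realType) (omega : R) (eps : nat -> R)
    (homega : 0 < omega < 2)
    (heps : forall r : nat, (0 < r)%N ->
       0 < eps r < Num.min 1 (1 / (r%:R * omega)))
    (w w' : frakH) (hw : hatH0 w) (hw' : hatH0 w') :
  Z_omega omega eps (shuffle_hbar w w' - harmonic_hbar w w') = 0.
Proof. by case/andP: homega => om0 _; exact: (Z_shuffle_harmonic om0 heps hw hw'). Qed.
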